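(* Let $\alpha,a\in\mathbb R$, let $e_{\widehat{2\,0}}=\mathrm{sgrad}\big(\tfrac12\sqrt{\tfrac{15}{8\pi}}\,\mu^2\big)$ and $\hat\xi=(e_{\widehat{2\,0}},a)\in\hat{\mathfrak g}$. For integers $1\le m_0\le l_0$ let $\hat\eta=(\eta_{l_0m_0}e_{l_0m_0}+\eta_{l_0\,-m_0}e_{l_0\,-m_0},0)\in\hat{\mathfrak g}$ be of norm one, i.e. $2(-1)^{m_0}(\alpha^2+l_0(l_0+1))\eta_{l_0m_0}\eta_{l_0\,-m_0}=1$. (i) The sectional curvature of the plane spanned by $\hat\xi$ and $\hat\eta$ is $$\hat\kappa(\hat\xi,\hat\eta)=\frac{1}{\frac38\alpha^2+1+a^2}\Big(\frac{15m_0^2}{32\pi}\Theta+\frac14\frac{a^2m_0^2}{(\alpha^2+l_0(l_0+1))^2}\Big),$$ where $$\Theta=(1-c_{l_0})^2\Big(a^{l_0}_{m_0}b_{l_0}+\frac{a^{l_0+1}_{m_0}}{b_{l_0+1}}\Big)+2(1+c_{l_0})\big(a^{l_0}_{m_0}+a^{l_0+1}_{m_0}\big)-3\Big(\frac{a^{l_0}_{m_0}}{b_{l_0}}+a^{l_0+1}_{m_0}b_{l_0+1}\Big)$$ $$+x_{l_0-1}\frac{a^{l_0}_{m_0}}{b_{l_0}}\Big(x_{l_0-1}-2b_{l_0}(1-c_{l_0})+2\Big)+x_{l_0+1}a^{l_0+1}_{m_0}b_{l_0+1}\Big(x_{l_0+1}-\frac{2}{b_{l_0+1}}(1-c_{l_0})+2\Big),$$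 with $a^l_m=\frac{l^2-m^2}{4l^2-1}$, $b_l=\frac{\alpha^2+l(l+1)}{\alpha^2+l(l-1)}$, $c_l=\frac{6}{\alpha^2+l(l+1)}$, $x_l=\frac{\alpha^2}{\alpha^2+l(l+1)}$. (ii) For $\hat\eta=(\eta_{l_0l_0}e_{l_0l_0}+\eta_{l_0\,-l_0}e_{l_0\,-l_0},0)$ (the case $m_0=l_0$, of norm one for each $l_0$), $$\lim_{l_0\to\infty}\hat\kappa(\hat\xi,\hat\eta)=\frac{-1}{\frac38\alpha^2+1+a^2}\,\frac{15}{8\pi}.$$
   Context: Use coordinates $(\lambda,\mu)$, $0\le\lambda\le2\pi$, $-1\le\mu\le1$, on the unit sphere $\mathbb S^2$ ($\mu$ = height, $\lambda$ = longitude). Put $\{f,g\}=\frac{\partial f}{\partial\lambda}\frac{\partial g}{\partial\mu}-\frac{\partial f}{\partial\mu}\frac{\partial g}{\partial\lambda}$ and $\langle f,g\rangle=\int_{-1}^1\int_0^{2\pi}fg\,d\lambda\,d\mu$ (complex bilinear, no conjugation). $\Delta$ is the Laplace–Beltrami operator of $\mathbb S^2$, and $\Delta_\theta=\alpha^2-\Delta$. $\mathfrak g$ is the Lie algebra of elements written $\mathrm{sgrad} f$, where $f$ is a function on $\mathbb S^2$ and $f\mapsto\mathrm{sgrad} f$ is a linear isomorphism (functions are taken modulo constants if $\alpha=0$), with $[\mathrm{sgrad} f,\mathrm{sgrad} g]=\mathrm{sgrad}\{f,g\}$ and $\ll\mathrm{sgrad} f,\mathrm{sgrad} g\gg_{\mathfrak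 g}=\langle\Delta_\theta f,g\rangle$; everything is extended complex-bilinearly to complex-valued functions. The central extension $\hat{\mathfrak g}=\mathfrak g\ltimes_\Omega\mathbb R$ has bracket $[(u,a),(v,b)]=([u,v],\Omega(u,v))$ and inner product $\ll(u,a),(v,b)\gg_{\hat{\mathfrak g}}=\ll u,v\gg_{\mathfrak g}+ab$, where $\Omega(\mathrm{sgrad} f,\mathrm{sgrad} g)=\langle\mu,\{f,g\}\rangle$. The connection $\hat\nabla$ on $\hat{\mathfrak g}$ is the bilinear map determined by $2\ll\hat\nabla_XY,Z\gg=\ll[X,Y],Z\gg-\ll[Y,Z],X\gg+\ll[Z,X],Y\gg$, the curvature is $\hat R(X,Y)Z=\hat\nabla_X\hat\nabla_YZ-\hat\nabla_Y\hat\nabla_XZ-\hat\nabla_{[X,Y]}Z$, and $\hat\kappa(X,Y)=\frac{\ll\hat R(X,Y)Y,X\gg}{\ll X,X\gg\ll Y,Y\gg-\ll X,Y\gg^2}$. $Y_{lm}$, $|m|\le l$, are the standard complex spherical harmonics on $\mathbb S^2$ with Condon–Shortley phase: $\Delta Y_{lm}=-l(l+1)Y_{lm}$, $\overline{Y_{lm}}=(-1)^mY_{l\,-m}$, $\langle Y_{l_1m_1},Y_{l_2m_2}\rangle=(-1)^{m_1}\delta^{l_1}_{l_2}\delta^{m_1}_{-m_2}$; i.e. $Y_{lm}=C_l^mP_l^{|m|}(\mu)e^{im\lambda}$ with $P_l^{|m|}(\mu)=\frac{(1-\mu^2)^{|m|/2}}{2^ll!}\frac{d^{l+|m|}}{d\mu^{l+|m|}}(\mu^2-1)^l$,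 $C_l^m=\epsilon_m\sqrt{\frac{2l+1}{4\pi}\frac{(l-|m|)!}{(l+|m|)!}}$, $\epsilon_m=(-1)^m$ for $m\ge0$ and $\epsilon_m=1$ for $m<0$. Write $e_{lm}=\mathrm{sgrad}(Y_{lm})$. In $\Theta$, terms containing the factor $a^{l_0}_{m_0}$ are read as $0$ when $m_0=l_0$ (this only matters for $\alpha=0$, $l_0=m_0=1$, where $b_1$ and $x_0$ are undefined). *)

(* Defs.v *)
From Stdlib Require Export Reals ZArith.
From Coquelicot Require Export Coquelicot.

Open Scope R_scope.

(** * Complex-valued calculus in one real variable *)

Definition CDerive (f : R -> C) (t : R) : C :=
  (Derive (fun s => Re (f s)) t, Derive (fun s => Im (f s)) t).

Definition CRInt (f : R -> C) (a b : R) : C :=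
  RInt (V := C_R_CompleteNormedModule) f a b.

Definition cis (t : R) : C := (cos t, sin t).

(** * Functions on the sphere

    A function on the unit sphere is given by its expression [f lambda mu] in
    the longitude/height chart.  Only the values with [-1 < mu < 1] matter: the
    poles are null for the area form, a smooth function is determined there by
    continuity, and the coordinate formulas below degenerate at [mu = 1, -1]. *)

Definition chart_fun := R -> R -> C.

Fixpoint is_Cn3 (n : nat) (F : R -> R -> R -> R) : Prop :=
  match n with
  | O => forall x y z : R,
      continuous (fun p : R * R * R => F (fst (fst p)) (snd (fst p)) (snd p))
                 (x, y, z)
  | S n' =>
      (forall x y z : R,
          ex_derive (fun t => F t y z) x /\
          ex_derive (fun t => F x t z) y /\
          ex_derive (fun t => F x y t) z) /\
      is_Cn3 n' (fun x y z => Derive (fun t => F t y z) x) /\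
      is_Cn3 n' (fun x y z => Derive (fun t => F x t z) y) /\
      is_Cn3 n' (fun x y z => Derive (fun t => F x y t) z)
  end.

Definition smooth3 (F : R -> R -> R -> R) : Prop := forall n, is_Cn3 n F.

(** The sphere is a closed submanifold of R^3, so its smooth functions are the
    restrictions of smooth functions on R^3. *)
Definition smooth_on_sphere (f : chart_fun) : Prop :=
  exists U V : R -> R -> R -> R,
    smooth3 U /\ smooth3 V /\
    forall lambda mu : R, -1 < mu < 1 ->
      let rho := sqrt (1 - mu ^ 2) in
      f lambda mu = (U (rho * cos lambda) (rho * sin lambda) mu,
                     V (rho * cos lambda) (rho * sin lambda) mu).

Definition d_lambda (f : chart_fun) : chart_fun :=
  fun lambda mu => CDerive (fun t => f t mu) lambda.

Definition d_mu (f : chart_fun) : chart_fun :=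
  fun lambda mu => CDerive (fun t => f lambda t) mu.

Definition poisson (f g : chart_fun) : chart_fun :=
  fun lambda mu =>
    (d_lambda f lambda mu * d_mu g lambda mu
     - d_mu f lambda mu * d_lambda g lambda mu)%C.

Definition pairing (f g : chart_fun) : C :=
  CRInt (fun mu => CRInt (fun lambda => (f lambda mu * g lambda mu)%C) 0 (2 * PI))
        (-1) 1.

(** The round metric is [dmu^2 / (1 - mu^2) + (1 - mu^2) dlambda^2]. *)
Definition laplacian (f : chart_fun) : chart_fun :=
  fun lambda mu =>
    (d_mu (fun l m => RtoC (1 - m ^ 2) * d_mu f l m) lambda mu
     + RtoC (/ (1 - mu ^ 2)) * d_lambda (d_lambda f) lambda mu)%C.

Definition Delta_theta (alpha : R) (f : chart_fun) : chart_fun :=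
  fun lambda mu => (RtoC (alpha ^ 2) * f lambda mu - laplacian f lambda mu)%C.

(** * The (complexified) central extension

    The element [(sgrad f, a)] is represented by the pair [(f, a)], with [f]
    smooth on the sphere; [ghat_eq] is equality in the Lie algebra, so functions
    are identified modulo constants exactly when [alpha = 0]. *)

Definition sgrad_eq (alpha : R) (f g : chart_fun) : Prop :=
  exists c : C, (alpha <> 0 -> c = RtoC 0) /\
    forall lambda mu : R, -1 < mu < 1 -> f lambda mu = (g lambda mu + c)%C.

Definition ghat : Type := (chart_fun * C)%type.

Definition in_ghat (X : ghat) : Prop := smooth_on_sphere (fst X).

Definition ghat_eq (alpha : R) (X Y : ghat) : Prop :=
  sgrad_eq alpha (fst X) (fst Y) /\ snd X = snd Y.

Definition gadd (X Y : ghat) : ghat :=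
  (fun lambda mu => (fst X lambda mu + fst Y lambda mu)%C, (snd X + snd Y)%C).

Definition gscale (c : C) (X : ghat) : ghat :=
  (fun lambda mu => (c * fst X lambda mu)%C, (c * snd X)%C).

Definition gsub (X Y : ghat) : ghat := gadd X (gscale (RtoC (-1)) Y).

Definition Omega (f g : chart_fun) : C :=
  pairing (fun _ mu => RtoC mu) (poisson f g).

Definition bracket (X Y : ghat) : ghat :=
  (poisson (fst X) (fst Y), Omega (fst X) (fst Y)).

Definition inner (alpha : R) (X Y : ghat) : C :=
  (pairing (Delta_theta alpha (fst X)) (fst Y) + snd X * snd Y)%C.

Record is_connection (alpha : R) (nabla : ghat -> ghat -> ghat) : Prop := {
  connection_closed : forall X Y, in_ghat X -> in_ghat Y -> in_ghat (nabla X Y);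
  connection_proper : forall X X' Y Y',
    in_ghat X -> in_ghat X' -> in_ghat Y -> in_ghat Y' ->
    ghat_eq alpha X X' -> ghat_eq alpha Y Y' ->
    ghat_eq alpha (nabla X Y) (nabla X' Y');
  connection_linear_l : forall (c : C) X X' Y,
    in_ghat X -> in_ghat X' -> in_ghat Y ->
    ghat_eq alpha (nabla (gadd (gscale c X) X') Y)
                  (gadd (gscale c (nabla X Y)) (nabla X' Y));
  connection_linear_r : forall (c : C) X Y Y',
    in_ghat X -> in_ghat Y -> in_ghat Y' ->
    ghat_eq alpha (nabla X (gadd (gscale c Y) Y'))
                  (gadd (gscale c (nabla X Y)) (nabla X Y'));
  connection_koszul : forall X Y Z,
    in_ghat X -> in_ghat Y -> in_ghat Z ->
    (RtoC 2 * inner alpha (nabla X Y) Z)%C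
    = (inner alpha (bracket X Y) Z - inner alpha (bracket Y Z) X
       + inner alpha (bracket Z X) Y)%C
}.

Definition curvature (nabla : ghat -> ghat -> ghat) (X Y Z : ghat) : ghat :=
  gsub (gsub (nabla X (nabla Y Z)) (nabla Y (nabla X Z)))
       (nabla (bracket X Y) Z).

Definition sectional_curvature (alpha : R) (nabla : ghat -> ghat -> ghat)
    (X Y : ghat) : C :=
  (inner alpha (curvature nabla X Y Y) X
   / (inner alpha X X * inner alpha Y Y - inner alpha X Y * inner alpha X Y))%C.

(** * Spherical harmonics *)

Definition legendre (l m : nat) (mu : R) : R :=
  sqrt (1 - mu ^ 2) ^ m / (2 ^ l * INR (fact l))
  * Derive_n (fun t => (t ^ 2 - 1) ^ l) (l + m) mu.

Definition condon_shortley (m : Z) : R :=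
  if (0 <=? m)%Z then (-1) ^ Z.abs_nat m else 1.

Definition Y_const (l : nat) (m : Z) : R :=
  condon_shortley m
  * sqrt ((2 * INR l + 1) / (4 * PI)
          * (INR (fact (l - Z.abs_nat m)) / INR (fact (l + Z.abs_nat m)))).

Definition Ylm (l : nat) (m : Z) : chart_fun :=
  fun lambda mu =>
    (RtoC (Y_const l m * legendre l (Z.abs_nat m) mu) * cis (IZR m * lambda))%C.

(** * The two directions and the curvature formula *)

Definition xi_hat (a : R) : ghat :=
  (fun _ mu => RtoC (1 / 2 * sqrt (15 / (8 * PI)) * mu ^ 2), RtoC a).

(** [p] and [q] are the coefficients of indices [(l, m)] and [(l, -m)]. *)
Definition eta_hat (l m : nat) (p q : C) : ghat :=
  (fun lambda mu => (p * Ylm l (Z.of_nat m) lambda mu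
                     + q * Ylm l (- Z.of_nat m) lambda mu)%C,
   RtoC 0).

Definition coef_a (l m : R) : R := (l ^ 2 - m ^ 2) / (4 * l ^ 2 - 1).

Definition coef_b (alpha l : R) : R :=
  (alpha ^ 2 + l * (l + 1)) / (alpha ^ 2 + l * (l - 1)).

Definition coef_c (alpha l : R) : R := 6 / (alpha ^ 2 + l * (l + 1)).

Definition coef_x (alpha l : R) : R := alpha ^ 2 / (alpha ^ 2 + l * (l + 1)).

(** When [alpha = 0] and [l0 = m0 = 1], [coef_b] at [l0] and [coef_x] at
    [l0 - 1] divide by zero; division is total and each such term carries the
    factor [coef_a l0 m0 = 0], so it is [0] as intended. *)
Definition Theta (alpha : R) (l0 m0 : nat) : R :=
  let l := INR l0 in
  let a0 := coef_a l (INR m0) in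
  let a1 := coef_a (l + 1) (INR m0) in
  let b0 := coef_b alpha l in
  let b1 := coef_b alpha (l + 1) in
  let c := coef_c alpha l in
  let xm := coef_x alpha (l - 1) in
  let xp := coef_x alpha (l + 1) in
  (1 - c) ^ 2 * (a0 * b0 + a1 / b1)
  + 2 * (1 + c) * (a0 + a1)
  - 3 * (a0 / b0 + a1 * b1)
  + xm * (a0 / b0) * (xm - 2 * b0 * (1 - c) + 2)
  + xp * a1 * b1 * (xp - 2 / b1 * (1 - c) + 2).

(* Main.v *)
From Stdlib Require Import FunctionalExtensionality Lra Lia.
Require Import Defs.

(** Write [xi = (f, a)] with [f = k mu^2], and [eta = (P_l^m E(lambda), 0)] where
    [E] is a combination of [exp(i m lambda)] and [exp(- i m lambda)].

    Three facts on the sphere carry the argument: the Laplacian is self-adjoint for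
    the pairing, the pairing is invariant for the Poisson bracket
    ([<{f, g}, h> = <f, {g, h}>]), and smooth functions are stable under both
    operations.  The first two are instances of one divergence theorem
    ([sphere_int_divergence]): after integration over the longitude only a total
    derivative in the height [mu] remains, of a function which vanishes at the poles.
    That the integrands stay bounded at the poles, where the chart degenerates, is
    seen by writing [d/dlambda], [(1 - mu^2) d/dmu], the Laplacian and the bracket as
    restrictions of differential operators on R^3 ([pull_lap3], [pull_brk3]).

    Since [f] is zonal, [<nabla_xi W, xi> = 0] for every [W], so
    [<R(xi, eta) eta, xi> = - <nabla_eta U, xi> - <nabla_V eta, xi>] with
    [U = nabla_xi eta] and [V = [xi, eta]].  The connection is known only through the
    Koszul formula, but this is enough.  Every term of the Koszul formula for
    [<nabla_eta U, xi>] can be moved, by self-adjointness and invariance, to a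
    pairing of [U] with an explicit function: [{f, eta}] and [{eta, Delta_theta f + a mu}]
    are combinations of [mu P_l^m E'] and [P_l^m E'], which Bonnet's recursion expands
    in the modes [P_j^m E'] with [j = l - 1, l, l + 1].  A second use of the Koszul
    formula, for [<nabla_xi eta, P_j^m E'>], gives these pairings, because the modes are
    orthogonal eigenfunctions.  No non-degeneracy of the inner product is needed.
    As [<xi, eta> = 0] and [eta] has norm one, it remains to divide by [<xi, xi>].

    The norms of the modes follow from the recursion and from the Wallis integral for
    [P_m^m].  The formula for [Theta] and the limit are then identities between
    rational functions. *)

(** * Smooth functions of three real variables *)

(** The partial derivatives. *)
Definition dX (F : R -> R -> R -> R) : R -> R -> R -> R :=
  fun x y z => Derive (fun t => F t y z) x.
Definition dY (F : R -> R -> R -> R) : R -> R -> R -> R :=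
  fun x y z => Derive (fun t => F x t z) y.
Definition dZ (F : R -> R -> R -> R) : R -> R -> R -> R :=
  fun x y z => Derive (fun t => F x y t) z.

(** Pointwise sum and product, constants and coordinates.  Smooth functions are
    built from these combinators so that smoothness and partial derivatives can be
    computed structurally. *)
Definition add3 (F G : R -> R -> R -> R) := fun x y z => F x y z + G x y z.
Definition mul3 (F G : R -> R -> R -> R) := fun x y z => F x y z * G x y z.
Definition cst3 (c : R) : R -> R -> R -> R := fun _ _ _ => c.
Definition pX : R -> R -> R -> R := fun x _ _ => x.
Definition pY : R -> R -> R -> R := fun _ y _ => y.
Definition pZ : R -> R -> R -> R := fun _ _ z => z.

Ltac funext3 :=
  apply functional_extensionality; intro; apply functional_extensionality; intro;
  apply functional_extensionality; intro.

Lemma smooth3_dX F : smooth3 F -> smooth3 (dX F).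
Proof. intros H n. exact (proj1 (proj2 (H (S n)))). Qed.
Lemma smooth3_dY F : smooth3 F -> smooth3 (dY F).
Proof. intros H n. exact (proj1 (proj2 (proj2 (H (S n))))). Qed.
Lemma smooth3_dZ F : smooth3 F -> smooth3 (dZ F).
Proof. intros H n. exact (proj2 (proj2 (proj2 (H (S n))))). Qed.

Lemma smooth3_ex_dX F x y z : smooth3 F -> ex_derive (fun t => F t y z) x.
Proof. intros H. destruct (H 1%nat) as [D _]. apply (D x y z). Qed.
Lemma smooth3_ex_dY F x y z : smooth3 F -> ex_derive (fun t => F x t z) y.
Proof. intros H. destruct (H 1%nat) as [D _]. apply (D x y z). Qed.
Lemma smooth3_ex_dZ F x y z : smooth3 F -> ex_derive (fun t => F x y t) z.
Proof. intros H. destruct (H 1%nat) as [D _]. apply (D x y z). Qed.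

Lemma smooth3_is_dX F x y z : smooth3 F -> is_derive (fun t => F t y z) x (dX F x y z).
Proof. intros H. apply Derive_correct, smooth3_ex_dX, H. Qed.
Lemma smooth3_is_dY F x y z : smooth3 F -> is_derive (fun t => F x t z) y (dY F x y z).
Proof. intros H. apply Derive_correct, smooth3_ex_dY, H. Qed.
Lemma smooth3_is_dZ F x y z : smooth3 F -> is_derive (fun t => F x y t) z (dZ F x y z).
Proof. intros H. apply Derive_correct, smooth3_ex_dZ, H. Qed.

Lemma smooth3_continuous F p :
  smooth3 F ->
  continuous (fun p : R * R * R => F (fst (fst p)) (snd (fst p)) (snd p)) p.
Proof. intros H. destruct p as [[x y] z]. apply (H O x y z). Qed.

(** Composition of a smooth function with continuous coordinates. *)
Lemma smooth3_comp_continuous {T : UniformSpace} F (u v w : T -> R) t :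
  smooth3 F -> continuous u t -> continuous v t -> continuous w t ->
  continuous (fun s => F (u s) (v s) (w s)) t.
Proof.
  intros HF Hu Hv Hw.
  apply (continuous_comp_2 (fun s => (u s, v s)) w
           (fun (q : R * R) (r : R) => F (fst q) (snd q) r)).
  - apply (continuous_comp_2 u v (fun a b => (a, b))); try assumption.
    apply (continuous_ext (fun p : R * R => p)); [now intros [? ?]|apply continuous_id].
  - exact Hw.
  - apply (smooth3_continuous F (u t, v t, w t) HF).
Qed.

Lemma is_Cn3_S_intro n F :
  (forall x y z, ex_derive (fun t => F t y z) x) ->
  (forall x y z, ex_derive (fun t => F x t z) y) ->
  (forall x y z, ex_derive (fun t => F x y t) z) ->
  is_Cn3 n (dX F) -> is_Cn3 n (dY F) -> is_Cn3 n (dZ F) -> is_Cn3 (S n) F.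
Proof.
  intros H1 H2 H3 A B C.
  exact (conj (fun x y z => conj (H1 x y z) (conj (H2 x y z) (H3 x y z)))
              (conj A (conj B C))).
Qed.

Lemma is_Cn3_const n c : is_Cn3 n (cst3 c).
Proof.
  revert c; induction n as [|n IH]; intros c.
  - intros x y z. apply continuous_const.
  - assert (E : forall F, (F = cst3 0) -> is_Cn3 n F) by (intros F ->; apply IH).
    apply is_Cn3_S_intro;
      try (intros x y z; unfold cst3;
           apply (@ex_derive_const R_AbsRing R_NormedModule));
      apply E; funext3; unfold dX, dY, dZ, cst3; apply Derive_const.
Qed.

Lemma smooth3_const c : smooth3 (cst3 c).
Proof. intros n; apply is_Cn3_const. Qed.

Lemma is_Cn3_eq_const n c F : F = cst3 c -> is_Cn3 n F.
Proof. intros ->. apply is_Cn3_const. Qed.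

Lemma smooth3_pX : smooth3 pX.
Proof.
  intros [|n].
  {
  intros x y z. unfold pX.
  apply (continuous_comp (fun p : R * R * R => fst p) (fun q : R * R => fst q));
    apply continuous_fst. }
  apply is_Cn3_S_intro.
  - intros x y z. apply (@ex_derive_id R_AbsRing).
  - intros x y z. unfold pX, pY, pZ. apply (@ex_derive_const R_AbsRing R_NormedModule).
  - intros x y z. unfold pX, pY, pZ. apply (@ex_derive_const R_AbsRing R_NormedModule).
  - apply (is_Cn3_eq_const n 1); funext3; exact (Derive_id _).
  - apply (is_Cn3_eq_const n 0); funext3; exact (Derive_const _ _).
  - apply (is_Cn3_eq_const n 0); funext3; exact (Derive_const _ _).
Qed.

Lemma smooth3_pY : smooth3 pY.
Proof.
  intros [|n].
  {
  intros x y z. unfold pY.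
  apply (continuous_comp (fun p : R * R * R => fst p) (fun q : R * R => snd q));
    [apply continuous_fst | apply continuous_snd]. }
  apply is_Cn3_S_intro.
  - intros x y z. unfold pX, pY, pZ. apply (@ex_derive_const R_AbsRing R_NormedModule).
  - intros x y z. apply (@ex_derive_id R_AbsRing).
  - intros x y z. unfold pX, pY, pZ. apply (@ex_derive_const R_AbsRing R_NormedModule).
  - apply (is_Cn3_eq_const n 0); funext3; exact (Derive_const _ _).
  - apply (is_Cn3_eq_const n 1); funext3; exact (Derive_id _).
  - apply (is_Cn3_eq_const n 0); funext3; exact (Derive_const _ _).
Qed.

Lemma smooth3_pZ : smooth3 pZ.
Proof.
  intros [|n].
  {
  intros x y z.
  apply (continuous_snd (U := prod_UniformSpace R_UniformSpace R_UniformSpace)). }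
  apply is_Cn3_S_intro.
  - intros x y z. unfold pX, pY, pZ. apply (@ex_derive_const R_AbsRing R_NormedModule).
  - intros x y z. unfold pX, pY, pZ. apply (@ex_derive_const R_AbsRing R_NormedModule).
  - intros x y z. apply (@ex_derive_id R_AbsRing).
  - apply (is_Cn3_eq_const n 0); funext3; exact (Derive_const _ _).
  - apply (is_Cn3_eq_const n 0); funext3; exact (Derive_const _ _).
  - apply (is_Cn3_eq_const n 1); funext3; exact (Derive_id _).
Qed.

Lemma is_Cn3_add n F G : is_Cn3 n F -> is_Cn3 n G -> is_Cn3 n (add3 F G).
Proof.
  revert F G; induction n as [|n IH]; intros F G HF HG.
  - intros x y z. apply (continuous_plus (V := R_NormedModule)); [apply HF|apply HG].
  - destruct HF as (DF & F1 & F2 & F3), HG as (DG & G1 & G2 & G3).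
    assert (E : forall H F' G', is_Cn3 n F' -> is_Cn3 n G' -> H = add3 F' G' -> is_Cn3 n H)
      by (intros H F' G' ? ? ->; now apply IH).
    apply is_Cn3_S_intro;
      [intros x y z; unfold add3;
       exact (@ex_derive_plus R_AbsRing R_NormedModule _ _ _
                (proj1 (DF x y z)) (proj1 (DG x y z)))
      |intros x y z; unfold add3;
       exact (@ex_derive_plus R_AbsRing R_NormedModule _ _ _
                (proj1 (proj2 (DF x y z))) (proj1 (proj2 (DG x y z))))
      |intros x y z; unfold add3;
       exact (@ex_derive_plus R_AbsRing R_NormedModule _ _ _
                (proj2 (proj2 (DF x y z))) (proj2 (proj2 (DG x y z))))
      |apply (E _ _ _ F1 G1); funext3;
       exact (Derive_plus _ _ _ (proj1 (DF _ _ _)) (proj1 (DG _ _ _)))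
      |apply (E _ _ _ F2 G2); funext3;
       exact (Derive_plus _ _ _ (proj1 (proj2 (DF _ _ _))) (proj1 (proj2 (DG _ _ _))))
      |apply (E _ _ _ F3 G3); funext3;
       exact (Derive_plus _ _ _ (proj2 (proj2 (DF _ _ _))) (proj2 (proj2 (DG _ _ _))))].
Qed.

Lemma smooth3_add F G : smooth3 F -> smooth3 G -> smooth3 (add3 F G).
Proof. intros HF HG n; now apply is_Cn3_add. Qed.

Lemma smooth3_mul F G : smooth3 F -> smooth3 G -> smooth3 (mul3 F G).
Proof.
  intros HF HG n; revert F G HF HG; induction n as [|n IH]; intros F G HF HG.
  - intros x y z. apply (continuous_mult (K := R_AbsRing));
      [apply (smooth3_continuous F (x, y, z)) | apply (smooth3_continuous G (x, y, z))];
      assumption.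
  - assert (E : forall H F' G', smooth3 F' -> smooth3 G' ->
               H = add3 (mul3 F' G) (mul3 F G') -> is_Cn3 n H)
      by (intros H F' G' ? ? ->; apply is_Cn3_add; now apply IH).
    apply is_Cn3_S_intro; unfold mul3 at 1;
      [intros; apply ex_derive_mult; now apply smooth3_ex_dX
      |intros; apply ex_derive_mult; now apply smooth3_ex_dY
      |intros; apply ex_derive_mult; now apply smooth3_ex_dZ
      |apply (E _ _ _ (smooth3_dX F HF) (smooth3_dX G HG));
       funext3; apply Derive_mult; now apply smooth3_ex_dX
      |apply (E _ _ _ (smooth3_dY F HF) (smooth3_dY G HG));
       funext3; apply Derive_mult; now apply smooth3_ex_dY
      |apply (E _ _ _ (smooth3_dZ F HF) (smooth3_dZ G HG));
       funext3; apply Derive_mult; now apply smooth3_ex_dZ].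
Qed.

Lemma smooth3_continuity_2d_XY F x y z :
  smooth3 F -> continuity_2d_pt (fun u v => F u v z) x y.
Proof.
  intros HF. apply continuity_2d_pt_filterlim.
  apply (smooth3_comp_continuous F (fun p : R * R => fst p) (fun p => snd p) (fun _ => z)
           (x, y) HF); [apply continuous_fst|apply continuous_snd|apply continuous_const].
Qed.
Lemma smooth3_continuity_2d_XZ F x y z :
  smooth3 F -> continuity_2d_pt (fun u v => F u y v) x z.
Proof.
  intros HF. apply continuity_2d_pt_filterlim.
  apply (smooth3_comp_continuous F (fun p : R * R => fst p) (fun _ => y) (fun p => snd p)
           (x, z) HF); [apply continuous_fst|apply continuous_const|apply continuous_snd].
Qed.
Lemma smooth3_continuity_2d_YZ F x y z :
  smooth3 F -> continuity_2d_pt (fun u v => F x u v) y z.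
Proof.
  intros HF. apply continuity_2d_pt_filterlim.
  apply (smooth3_comp_continuous F (fun _ => x) (fun p : R * R => fst p) (fun p => snd p)
           (y, z) HF); [apply continuous_const|apply continuous_fst|apply continuous_snd].
Qed.

Lemma locally_2d_always (P : R -> R -> Prop) x y :
  (forall u v, P u v) -> locally_2d P x y.
Proof. intros H. exists (mkposreal 1 Rlt_0_1). intros; apply H. Qed.

(** Mixed partial derivatives commute. *)
Lemma smooth3_dXY F : smooth3 F -> dX (dY F) = dY (dX F).
Proof.
  intros HF. funext3. rename x1 into z0, x0 into y0, x into x0. unfold dX, dY.
  apply (Schwarz (fun u v => F u v z0)).
  - apply locally_2d_always; intros u v.
    exact (conj (smooth3_ex_dX F _ _ _ HF) (conj (smooth3_ex_dY F _ _ _ HF)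
      (conj (smooth3_ex_dX (dY F) _ _ _ (smooth3_dY F HF))
            (smooth3_ex_dY (dX F) _ _ _ (smooth3_dX F HF))))).
  - apply (smooth3_continuity_2d_XY (dX (dY F))). now apply smooth3_dX, smooth3_dY.
  - apply (smooth3_continuity_2d_XY (dY (dX F))). now apply smooth3_dY, smooth3_dX.
Qed.
Lemma smooth3_dXZ F : smooth3 F -> dX (dZ F) = dZ (dX F).
Proof.
  intros HF. funext3. rename x1 into z0, x0 into y0, x into x0. unfold dX, dZ.
  apply (Schwarz (fun u v => F u y0 v)).
  - apply locally_2d_always; intros u v.
    exact (conj (smooth3_ex_dX F _ _ _ HF) (conj (smooth3_ex_dZ F _ _ _ HF)
      (conj (smooth3_ex_dX (dZ F) _ _ _ (smooth3_dZ F HF))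
            (smooth3_ex_dZ (dX F) _ _ _ (smooth3_dX F HF))))).
  - apply (smooth3_continuity_2d_XZ (dX (dZ F))). now apply smooth3_dX, smooth3_dZ.
  - apply (smooth3_continuity_2d_XZ (dZ (dX F))). now apply smooth3_dZ, smooth3_dX.
Qed.
Lemma smooth3_dYZ F : smooth3 F -> dY (dZ F) = dZ (dY F).
Proof.
  intros HF. funext3. rename x1 into z0, x0 into y0, x into x0. unfold dY, dZ.
  apply (Schwarz (fun u v => F x0 u v)).
  - apply locally_2d_always; intros u v.
    exact (conj (smooth3_ex_dY F _ _ _ HF) (conj (smooth3_ex_dZ F _ _ _ HF)
      (conj (smooth3_ex_dY (dZ F) _ _ _ (smooth3_dZ F HF))
            (smooth3_ex_dZ (dY F) _ _ _ (smooth3_dY F HF))))).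
  - apply (smooth3_continuity_2d_YZ (dY (dZ F))). now apply smooth3_dY, smooth3_dZ.
  - apply (smooth3_continuity_2d_YZ (dZ (dY F))). now apply smooth3_dZ, smooth3_dY.
Qed.

(** Two- and three-variable chain rules. *)
Lemma is_derive_chain2 (H Hx : R -> R -> R) (u v : R -> R) (t du dv hy : R) :
  is_derive u t du -> is_derive v t dv ->
  (forall a b, is_derive (fun s => H s b) a (Hx a b)) ->
  is_derive (fun s => H (u t) s) (v t) hy ->
  continuous (fun q : R * R => Hx (fst q) (snd q)) (u t, v t) ->
  is_derive (fun s => H (u s) (v s)) t (du * Hx (u t) (v t) + dv * hy).
Proof.
  intros Hu Hv HX HY HC.
  pose proof (is_derive_filterdiff H (u t) (v t) Hx hy
    (filter_forall _ (fun q => HX (fst q) (snd q))) HY HC) as D.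
  pose proof (filterdiff_comp'_2 u v H t _ _
    (fun p q : R => plus (scal p (Hx (u t) (v t))) (scal q hy)) Hu Hv D) as E.
  refine (filterdiff_ext_lin _ _ _ E _).
  intros s. simpl. unfold plus, scal; simpl; unfold mult; simpl. ring.
Qed.

Lemma is_derive_chain3 F (u v w : R -> R) (t du dv dw : R) :
  smooth3 F -> is_derive u t du -> is_derive v t dv -> is_derive w t dw ->
  is_derive (fun s => F (u s) (v s) (w s)) t
    (du * dX F (u t) (v t) (w t) + dv * dY F (u t) (v t) (w t)
     + dw * dZ F (u t) (v t) (w t)).
Proof.
  intros HF Hu Hv Hw.
  (* inner two-variable chain rule at fixed third coordinate *)
  assert (D2 : is_derive (fun s => F (u s) (v s) (w t)) t
    (du * dX F (u t) (v t) (w t) + dv * dY F (u t) (v t) (w t))).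
  { apply (is_derive_chain2 (fun a b => F a b (w t)) (fun a b => dX F a b (w t)));
      try assumption.
    - intros; now apply smooth3_is_dX.
    - now apply smooth3_is_dY.
    - apply (smooth3_comp_continuous (dX F) (fun q : R * R => fst q) (fun q => snd q)
               (fun _ => w t)); [now apply smooth3_dX|apply continuous_fst
        |apply continuous_snd|apply continuous_const]. }
  assert (Cu : continuous u t) by (apply (ex_derive_continuous (V := R_NormedModule)); eexists; apply Hu).
  assert (Cv : continuous v t) by (apply (ex_derive_continuous (V := R_NormedModule)); eexists; apply Hv).
  evar_last.
  { apply (is_derive_chain2 (fun a s => F (u s) (v s) a)
      (fun a s => dZ F (u s) (v s) a) w (fun s => s) t dw 1
      (du * dX F (u t) (v t) (w t) + dv * dY F (u t) (v t) (w t)) Hw (is_derive_id t)).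
  - intros; now apply smooth3_is_dZ.
  - exact D2.
  - apply (smooth3_comp_continuous (dZ F) (fun q : R * R => u (snd q))
      (fun q => v (snd q)) (fun q => fst q)).
    + now apply smooth3_dZ.
    + apply (continuous_comp (fun q : R * R => snd q) u); [apply continuous_snd|exact Cu].
    + apply (continuous_comp (fun q : R * R => snd q) v); [apply continuous_snd|exact Cv].
    + apply continuous_fst. }
  ring.
Qed.

(** * The rotation field, the meridian field, and the ambient Laplacian *)

Create HintDb smooth3.
#[local] Hint Resolve smooth3_add smooth3_mul smooth3_const smooth3_pX smooth3_pY
  smooth3_pZ smooth3_dX smooth3_dY smooth3_dZ : smooth3.
Ltac smooth3 := auto 30 with smooth3.

Lemma dX_add F G : smooth3 F -> smooth3 G -> dX (add3 F G) = add3 (dX F) (dX G).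
Proof. intros HF HG. funext3. apply Derive_plus; now apply smooth3_ex_dX. Qed.
Lemma dY_add F G : smooth3 F -> smooth3 G -> dY (add3 F G) = add3 (dY F) (dY G).
Proof. intros HF HG. funext3. apply Derive_plus; now apply smooth3_ex_dY. Qed.
Lemma dZ_add F G : smooth3 F -> smooth3 G -> dZ (add3 F G) = add3 (dZ F) (dZ G).
Proof. intros HF HG. funext3. apply Derive_plus; now apply smooth3_ex_dZ. Qed.

Lemma dX_mul F G : smooth3 F -> smooth3 G ->
  dX (mul3 F G) = add3 (mul3 (dX F) G) (mul3 F (dX G)).
Proof. intros HF HG. funext3. apply Derive_mult; now apply smooth3_ex_dX. Qed.
Lemma dY_mul F G : smooth3 F -> smooth3 G ->
  dY (mul3 F G) = add3 (mul3 (dY F) G) (mul3 F (dY G)).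
Proof. intros HF HG. funext3. apply Derive_mult; now apply smooth3_ex_dY. Qed.
Lemma dZ_mul F G : smooth3 F -> smooth3 G ->
  dZ (mul3 F G) = add3 (mul3 (dZ F) G) (mul3 F (dZ G)).
Proof. intros HF HG. funext3. apply Derive_mult; now apply smooth3_ex_dZ. Qed.

Lemma dX_cst c : dX (cst3 c) = cst3 0.
Proof. funext3. exact (Derive_const _ _). Qed.
Lemma dY_cst c : dY (cst3 c) = cst3 0.
Proof. funext3. exact (Derive_const _ _). Qed.
Lemma dZ_cst c : dZ (cst3 c) = cst3 0.
Proof. funext3. exact (Derive_const _ _). Qed.
Lemma dX_pX : dX pX = cst3 1.
Proof. funext3. exact (Derive_id _). Qed.
Lemma dX_pY : dX pY = cst3 0.
Proof. funext3. exact (Derive_const _ _). Qed.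
Lemma dX_pZ : dX pZ = cst3 0.
Proof. funext3. exact (Derive_const _ _). Qed.
Lemma dY_pX : dY pX = cst3 0.
Proof. funext3. exact (Derive_const _ _). Qed.
Lemma dY_pY : dY pY = cst3 1.
Proof. funext3. exact (Derive_id _). Qed.
Lemma dY_pZ : dY pZ = cst3 0.
Proof. funext3. exact (Derive_const _ _). Qed.
Lemma dZ_pX : dZ pX = cst3 0.
Proof. funext3. exact (Derive_const _ _). Qed.
Lemma dZ_pY : dZ pY = cst3 0.
Proof. funext3. exact (Derive_const _ _). Qed.
Lemma dZ_pZ : dZ pZ = cst3 1.
Proof. funext3. exact (Derive_id _). Qed.

Ltac partials :=
  rewrite ?dX_cst, ?dY_cst, ?dZ_cst, ?dX_pX, ?dX_pY, ?dX_pZ, ?dY_pX, ?dY_pY, ?dY_pZ,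
          ?dZ_pX, ?dZ_pY, ?dZ_pZ;
  repeat first
    [ rewrite dX_add by smooth3 | rewrite dY_add by smooth3 | rewrite dZ_add by smooth3
    | rewrite dX_mul by smooth3 | rewrite dY_mul by smooth3 | rewrite dZ_mul by smooth3 ];
  rewrite ?dX_cst, ?dY_cst, ?dZ_cst, ?dX_pX, ?dX_pY, ?dX_pZ, ?dY_pX, ?dY_pY, ?dY_pZ,
          ?dZ_pX, ?dZ_pY, ?dZ_pZ.

(** [x d/dy - y d/dx], which restricts to [d/dlambda] on the sphere. *)
Definition rot3 F := add3 (mul3 pX (dY F)) (mul3 (cst3 (-1)) (mul3 pY (dX F))).

(** [x d/dx + y d/dy]. *)
Definition rad3 F := add3 (mul3 pX (dX F)) (mul3 pY (dY F)).

(** The function [1 - z^2]. *)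
Definition one_minus_z2 := add3 (cst3 1) (mul3 (cst3 (-1)) (mul3 pZ pZ)).

(** [(1 - z^2) d/dz - z (x d/dx + y d/dy)], which restricts to
    [(1 - mu^2) d/dmu] on the sphere. *)
Definition mer3 F :=
  add3 (mul3 one_minus_z2 (dZ F)) (mul3 (cst3 (-1)) (mul3 pZ (rad3 F))).

(** An operator on R^3 which restricts to the spherical Laplacian. *)
Definition lap3 F :=
  add3 (add3 (dX (dX F)) (add3 (dY (dY F)) (mul3 one_minus_z2 (dZ (dZ F)))))
       (mul3 (cst3 (-1))
         (add3 (mul3 (cst3 2) (mul3 pZ (dZ F)))
           (add3 (rad3 F)
             (add3 (mul3 (cst3 2) (mul3 pZ (rad3 (dZ F)))) (rad3 (rad3 F)))))).

(** An operator on R^3 which restricts to the Poisson bracket of the sphere. *)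
Definition brk3 F G :=
  add3 (add3 (mul3 (rot3 F) (dZ G)) (mul3 (cst3 (-1)) (mul3 (dZ F) (rot3 G))))
    (mul3 pZ (add3 (mul3 (dX F) (dY G)) (mul3 (cst3 (-1)) (mul3 (dY F) (dX G))))).

Lemma smooth3_rot3 F : smooth3 F -> smooth3 (rot3 F).
Proof. unfold rot3; smooth3. Qed.
Lemma smooth3_rad3 F : smooth3 F -> smooth3 (rad3 F).
Proof. unfold rad3; smooth3. Qed.
Lemma smooth3_one_minus_z2 : smooth3 one_minus_z2.
Proof. unfold one_minus_z2; smooth3. Qed.
#[local] Hint Resolve smooth3_rot3 smooth3_rad3 smooth3_one_minus_z2 : smooth3.
Lemma smooth3_mer3 F : smooth3 F -> smooth3 (mer3 F).
Proof. unfold mer3; smooth3. Qed.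
Lemma smooth3_lap3 F : smooth3 F -> smooth3 (lap3 F).
Proof. unfold lap3; smooth3. Qed.
Lemma smooth3_brk3 F G : smooth3 F -> smooth3 G -> smooth3 (brk3 F G).
Proof. unfold brk3; smooth3. Qed.
#[local] Hint Resolve smooth3_mer3 smooth3_lap3 smooth3_brk3 : smooth3.

Lemma rot3_mer3 F : smooth3 F -> rot3 (mer3 F) = mer3 (rot3 F).
Proof.
  intros HF. unfold mer3, rot3, rad3, one_minus_z2. partials.
  rewrite ?(smooth3_dXY F HF), <- ?(smooth3_dXZ F HF), <- ?(smooth3_dYZ F HF).
  funext3. unfold add3, mul3, cst3, pX, pY, pZ. ring.
Qed.

(** On the unit sphere [1 - z^2] divides the square of the meridian field plus the
    square of the rotation field; the quotient [lap3] is regular at the poles. *)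
Lemma lap3_eq F x y z :
  smooth3 F -> x ^ 2 + y ^ 2 + z ^ 2 = 1 ->
  mer3 (mer3 F) x y z + rot3 (rot3 F) x y z = (1 - z ^ 2) * lap3 F x y z.
Proof.
  intros HF Hs. unfold lap3, mer3, rot3, rad3, one_minus_z2. partials.
  rewrite ?(smooth3_dXY F HF), <- ?(smooth3_dXZ F HF), <- ?(smooth3_dYZ F HF).
  unfold add3, mul3, cst3, pX, pY, pZ.
  generalize (dX F x y z), (dY F x y z), (dZ F x y z), (dX (dX F) x y z),
    (dY (dX F) x y z), (dY (dY F) x y z), (dX (dZ F) x y z), (dY (dZ F) x y z),
    (dZ (dZ F) x y z).
  intros fx fy fz fxx fxy fyy fxz fyz fzz.
  assert (E : x ^ 2 = 1 - y ^ 2 - z ^ 2) by lra.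
  ring [E].
Qed.

Lemma brk3_eq F G x y z :
  x ^ 2 + y ^ 2 + z ^ 2 = 1 ->
  rot3 F x y z * mer3 G x y z - mer3 F x y z * rot3 G x y z
  = (1 - z ^ 2) * brk3 F G x y z.
Proof.
  intros Hs. unfold brk3, mer3, rot3, rad3, one_minus_z2, add3, mul3, cst3, pX, pY, pZ.
  assert (E : x ^ 2 = 1 - y ^ 2 - z ^ 2) by lra.
  ring [E].
Qed.

(** * Restriction to the sphere in the longitude/height chart *)

(** The expression of a function on R^3 in the longitude/height chart. *)
Definition pull (F : R -> R -> R -> R) : R -> R -> R :=
  fun l m => F (sqrt (1 - m ^ 2) * cos l) (sqrt (1 - m ^ 2) * sin l) m.

Lemma strip_pos m : -1 < m < 1 -> 0 < 1 - m ^ 2.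
Proof. intros ?. nra. Qed.

Lemma chart_on_sphere l m : -1 < m < 1 ->
  (sqrt (1 - m ^ 2) * cos l) ^ 2 + (sqrt (1 - m ^ 2) * sin l) ^ 2 + m ^ 2 = 1.
Proof.
  intros Hm. pose proof (strip_pos m Hm).
  rewrite !Rpow_mult_distr, pow2_sqrt by lra.
  pose proof (sin2_cos2 l) as E. unfold Rsqr in E.
  replace (cos l ^ 2) with (1 - sin l ^ 2) by (simpl; lra). ring.
Qed.

Lemma is_derive_sqrt_1_m2 m : -1 < m < 1 ->
  is_derive (fun t => sqrt (1 - t ^ 2)) m (- m / sqrt (1 - m ^ 2)).
Proof.
  intros Hm. pose proof (strip_pos m Hm). pose proof (sqrt_lt_R0 _ H).
  auto_derive; [simpl in *; lra|].
  replace (1 + - (m * (m * 1))) with (1 - m ^ 2) by ring. field; lra.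
Qed.

Lemma is_derive_pull_lambda F l m : smooth3 F ->
  is_derive (fun t => pull F t m) l (pull (rot3 F) l m).
Proof.
  intros HF. unfold pull.
  evar_last.
  { apply (is_derive_chain3 F (fun t => sqrt (1 - m ^ 2) * cos t)
      (fun t => sqrt (1 - m ^ 2) * sin t) (fun _ => m) l
      (sqrt (1 - m ^ 2) * - sin l) (sqrt (1 - m ^ 2) * cos l) 0 HF).
    - apply is_derive_scal, is_derive_cos.
    - apply is_derive_scal, is_derive_sin.
    - apply (@is_derive_const R_AbsRing R_NormedModule). }
  unfold rot3, add3, mul3, cst3, pX, pY. ring.
Qed.

Lemma is_derive_pull_mu F l m : smooth3 F -> -1 < m < 1 ->
  is_derive (fun t => pull F l t) m (pull (mer3 F) l m / (1 - m ^ 2)).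
Proof.
  intros HF Hm. unfold pull.
  pose proof (strip_pos m Hm) as Hp. pose proof (sqrt_lt_R0 _ Hp) as Hr.
  pose proof (is_derive_sqrt_1_m2 m Hm) as Dr.
  evar_last.
  { apply (is_derive_chain3 F (fun t => sqrt (1 - t ^ 2) * cos l)
      (fun t => sqrt (1 - t ^ 2) * sin l) (fun t => t) m
      (- m / sqrt (1 - m ^ 2) * cos l) (- m / sqrt (1 - m ^ 2) * sin l) 1 HF).
    - apply (is_derive_scal_l (V := R_NormedModule)). exact Dr.
    - apply (is_derive_scal_l (V := R_NormedModule)). exact Dr.
    - apply (@is_derive_id R_AbsRing). }
  unfold mer3, rad3, one_minus_z2, add3, mul3, cst3, pX, pY, pZ.
  set (s := sqrt (1 - m ^ 2)) in *.
  assert (E : s * s = 1 - m ^ 2) by (apply sqrt_sqrt; lra).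
  generalize (dX F (s * cos l) (s * sin l) m), (dY F (s * cos l) (s * sin l) m),
    (dZ F (s * cos l) (s * sin l) m); intros fx fy fz.
  rewrite <- E.
  replace (1 + -1 * (m * m)) with (s * s) by (rewrite E; ring).
  field. lra.
Qed.

Lemma pull_rot3_pole F l m : m = 1 \/ m = -1 -> pull (rot3 F) l m = 0.
Proof.
  intros Hm. unfold pull. replace (1 - m ^ 2) with 0 by (destruct Hm; subst; ring).
  rewrite sqrt_0. unfold rot3, add3, mul3, cst3, pX, pY. ring.
Qed.

Lemma pull_mer3_pole F l m : m = 1 \/ m = -1 -> pull (mer3 F) l m = 0.
Proof.
  intros Hm. unfold pull. replace (1 - m ^ 2) with 0 by (destruct Hm; subst; ring).
  rewrite sqrt_0. unfold mer3, rad3, one_minus_z2, add3, mul3, cst3, pX, pY, pZ.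
  destruct Hm; subst; ring.
Qed.

Lemma pull_lap3 F l m : smooth3 F -> -1 < m < 1 ->
  pull (lap3 F) l m = (pull (mer3 (mer3 F)) l m + pull (rot3 (rot3 F)) l m) / (1 - m ^ 2).
Proof.
  intros HF Hm. unfold pull.
  rewrite lap3_eq; [|exact HF|now apply chart_on_sphere].
  pose proof (strip_pos m Hm). field. lra.
Qed.

Lemma pull_brk3 F G l m : -1 < m < 1 ->
  pull (brk3 F G) l m
  = (pull (rot3 F) l m * pull (mer3 G) l m - pull (mer3 F) l m * pull (rot3 G) l m)
    / (1 - m ^ 2).
Proof.
  intros Hm. unfold pull. rewrite brk3_eq by now apply chart_on_sphere.
  pose proof (strip_pos m Hm). field. lra.
Qed.

Lemma pull_continuous F (p : R * R) :
  smooth3 F -> continuous (fun q : R * R => pull F (fst q) (snd q)) p.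
Proof.
  intros HF. unfold pull.
  assert (Cr : continuous (fun q : R * R => sqrt (1 - snd q ^ 2)) p).
  { apply (continuous_comp (fun q : R * R => 1 - snd q ^ 2) sqrt);
      [|apply continuous_sqrt].
    apply (continuous_comp (fun q : R * R => snd q) (fun t => 1 - t ^ 2));
      [apply continuous_snd|].
    apply (ex_derive_continuous (V := R_NormedModule)). auto_derive; trivial. }
  assert (Ct : forall f : R -> R, (forall t, continuous f t) ->
             continuous (fun q : R * R => sqrt (1 - snd q ^ 2) * f (fst q)) p).
  { intros f Hf. apply (continuous_mult (K := R_AbsRing)); [exact Cr|].
    apply (continuous_comp (fun q : R * R => fst q) f); [apply continuous_fst|apply Hf]. }
  apply (smooth3_comp_continuous F); [exact HF| | |apply continuous_snd].
  - apply (Ct cos). apply continuous_cos.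
  - apply (Ct sin). apply continuous_sin.
Qed.

Lemma pull_periodic F l m : pull F (l + 2 * PI) m = pull F l m.
Proof. unfold pull. now rewrite cos_plus, sin_plus, cos_2PI, sin_2PI, !Rmult_0_r, !Rmult_1_r, Rminus_0_r, Rplus_0_r. Qed.

(** * The divergence theorem on the sphere, in coordinates *)

(** Joint continuity, at all points of the plane and not only for [-1 < mu < 1]. *)
Definition continuous_2d (g : R -> R -> R) : Prop :=
  forall p : R * R, continuous (fun q : R * R => g (fst q) (snd q)) p.

(** The integral over the sphere of a real function given in the chart. *)
Definition chart_int (h : R -> R -> R) : R :=
  RInt (fun m => RInt (fun l => h l m) 0 (2 * PI)) (-1) 1.

Lemma continuous_2d_pull F : smooth3 F -> continuous_2d (pull F).
Proof. intros HF p. now apply pull_continuous. Qed.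

Lemma continuous_2d_fst g l m : continuous_2d g -> continuous (fun t => g t m) l.
Proof.
  intros Hg.
  apply (continuous_comp_2 (fun t : R => t) (fun _ => m) g);
    [apply continuous_id|apply continuous_const|apply (Hg (l, m))].
Qed.

Lemma two_PI_pos : 0 < 2 * PI.
Proof. pose proof PI_RGT_0; lra. Qed.

Lemma ex_RInt_lambda g m : continuous_2d g -> ex_RInt (fun l => g l m) 0 (2 * PI).
Proof.
  intros Hg. apply (ex_RInt_continuous (V := R_CompleteNormedModule)).
  intros l _. now apply continuous_2d_fst.
Qed.

Lemma continuous_RInt_lambda g m : continuous_2d g ->
  continuous (fun m => RInt (fun l => g l m) 0 (2 * PI)) m.
Proof.
  intros Hg. pose proof two_PI_pos as HP.
  apply continuity_pt_filterlim, continuity_pt_locally. intros eps.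
  assert (He : 0 < eps / (2 * PI + 1)) by (apply Rdiv_lt_0_compat; [apply cond_pos|lra]).
  destruct (uniform_continuity_2d_1d g 0 (2 * PI) m) with (eps := mkposreal _ He)
    as [d Hd].
  { intros x _. apply continuity_2d_pt_filterlim, (Hg (x, m)). }
  exists d. intros y Hy.
  assert (Hy' : Rabs (y - m) < d) by exact Hy.
  apply Rabs_def2 in Hy'. pose proof (cond_pos d) as Hd0.
  rewrite <- (RInt_minus (V := R_CompleteNormedModule)) by now apply ex_RInt_lambda.
  apply Rle_lt_trans with ((2 * PI - 0) * (eps / (2 * PI + 1))).
  - apply (abs_RInt_le_const _ 0 (2 * PI)); [lra| |].
    + apply (@ex_RInt_minus R_NormedModule); now apply ex_RInt_lambda.
    + intros t Ht. left. apply (Hd t m t y); try lra.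
      rewrite Rminus_diag, Rabs_R0. exact Hd0.
  - apply Rlt_le_trans with ((2 * PI + 1) * (eps / (2 * PI + 1))).
    + apply Rmult_lt_compat_r; [exact He|lra].
    + right. field. lra.
Qed.

Lemma ex_RInt_mu g : continuous_2d g ->
  ex_RInt (fun m => RInt (fun l => g l m) 0 (2 * PI)) (-1) 1.
Proof.
  intros Hg. apply (ex_RInt_continuous (V := R_CompleteNormedModule)).
  intros m _. now apply continuous_RInt_lambda.
Qed.

Lemma chart_int_ext g h :
  (forall l m, -1 < m < 1 -> g l m = h l m) -> chart_int g = chart_int h.
Proof.
  intros E. apply RInt_ext. intros m Hm.
  rewrite Rmin_left, Rmax_right in Hm by lra.
  apply RInt_ext. intros l _. now apply E.
Qed.

Lemma chart_int_lin (a b : R) g h : continuous_2d g -> continuous_2d h ->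
  chart_int (fun l m => a * g l m + b * h l m) = a * chart_int g + b * chart_int h.
Proof.
  intros Hg Hh. unfold chart_int.
  assert (L : forall (u v : R -> R) c d, ex_RInt u c d -> ex_RInt v c d ->
     RInt (fun t => a * u t + b * v t) c d = a * RInt u c d + b * RInt v c d).
  { intros u v c d Hu Hv.
    apply (is_RInt_unique (V := R_CompleteNormedModule)).
    apply (is_RInt_plus (V := R_NormedModule));
      apply (is_RInt_scal (V := R_NormedModule));
      now apply (RInt_correct (V := R_CompleteNormedModule)). }
  rewrite <- L by now apply ex_RInt_mu.
  apply RInt_ext. intros m _. apply L; now apply ex_RInt_lambda.
Qed.

(** The fundamental theorem of calculus when the derivative is only known in the
    interior of the interval. *)
Lemma RInt_derive_open (G h : R -> R) a b : a < b ->
  (forall x, continuous h x) -> (forall x, continuous G x) ->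
  (forall x, a < x < b -> is_derive G x (h x)) ->
  RInt h a b = G b - G a.
Proof.
  intros Hab Hh HG HD.
  assert (Hex : forall x y, ex_RInt h x y)
    by (intros; apply (ex_RInt_continuous (V := R_CompleteNormedModule)); auto).
  assert (DI : forall x, is_derive (fun t => RInt h a t) x (h x)).
  { intros x. apply (is_derive_RInt (V := R_CompleteNormedModule) h _ a); [|apply Hh].
    apply filter_forall. intros t. apply (RInt_correct (V := R_CompleteNormedModule)), Hex. }
  destruct (MVT_gen (fun t => RInt h a t - G t) a b (fun _ => 0)) as [c [_ Hc]].
  - rewrite Rmin_left, Rmax_right by lra. intros x Hx.
    evar_last; [apply (is_derive_minus (V := R_NormedModule)); [apply DI|now apply HD]|].
    unfold minus, plus, opp; simpl; ring.
  - intros x _. apply continuity_pt_filterlim.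
    apply (continuous_minus (V := R_NormedModule)); [|apply HG].
    apply (ex_derive_continuous (V := R_NormedModule)). eexists; apply DI.
  - assert (E : RInt h a a = 0) by apply (RInt_point (V := R_CompleteNormedModule)). lra.
Qed.

Lemma RInt_pull_rot3 F m : smooth3 F ->
  RInt (fun l => pull (rot3 F) l m) 0 (2 * PI) = 0.
Proof.
  intros HF.
  assert (E : is_RInt (fun l => pull (rot3 F) l m) 0 (2 * PI)
            (minus (pull F (2 * PI) m) (pull F 0 m))).
  { apply (is_RInt_derive (V := R_CompleteNormedModule) (fun l => pull F l m)).
    - intros l _. now apply is_derive_pull_lambda.
    - intros l _. apply continuous_2d_fst, continuous_2d_pull. smooth3. }
  rewrite (is_RInt_unique (V := R_CompleteNormedModule) _ _ _ _ E).
  rewrite <- (pull_periodic F 0 m), Rplus_0_l. unfold minus, plus, opp; simpl; ring.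
Qed.

Lemma locally_strip m : -1 < m < 1 -> locally m (fun t => -1 < t < 1).
Proof.
  intros Hm. apply (locally_open (fun t => -1 < t < 1) (fun t => -1 < t < 1)); trivial.
  apply open_and; [apply open_gt|apply open_lt].
Qed.

Lemma is_derive_RInt_pull F m : smooth3 F -> -1 < m < 1 ->
  is_derive (fun t => RInt (fun l => pull F l t) 0 (2 * PI)) m
    (RInt (fun l => pull (mer3 F) l m / (1 - m ^ 2)) 0 (2 * PI)).
Proof.
  intros HF Hm.
  evar_last.
  { apply (is_derive_RInt_param (fun t l => pull F l t) 0 (2 * PI) m).
    - apply (filter_imp (fun t => -1 < t < 1)); [|now apply locally_strip].
      intros t Ht l _. eexists. now apply is_derive_pull_mu.
    - intros l _.
      apply (continuity_2d_pt_ext_loc (fun t l => / (1 - t ^ 2) * pull (mer3 F) l t)).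
      + destruct (locally_strip m Hm) as [d Hd]. exists d. intros u v Hu _.
        symmetry. apply is_derive_unique.
        evar_last; [apply is_derive_pull_mu; [exact HF|now apply Hd]|].
        unfold Rdiv; apply Rmult_comm.
      + apply continuity_2d_pt_mult.
        * apply (continuity_1d_2d_pt_comp (fun t => / (1 - t ^ 2)) (fun u _ => u)).
          -- apply continuity_pt_filterlim.
             apply (ex_derive_continuous (V := R_NormedModule) (fun t => / (1 - t ^ 2)) m).
             pose proof (strip_pos m Hm). auto_derive; simpl in *; lra.
          -- apply continuity_2d_pt_id1.
        * apply continuity_2d_pt_filterlim.
          exact (continuous_comp_2 (fun q : R * R => snd q) (fun q : R * R => fst q)
                   (pull (mer3 F)) (m, l) (continuous_snd m l) (continuous_fst m l)
                   (pull_continuous (mer3 F) (l, m) (smooth3_mer3 F HF))).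
    - apply filter_forall. intros t. apply ex_RInt_lambda, continuous_2d_pull, HF. }
  apply RInt_ext. intros l _. apply is_derive_unique. now apply is_derive_pull_mu.
Qed.

(** The integral of the divergence [dW/dmu + (1 - mu^2)^-1 dT/dlambda] vanishes if
    [W] vanishes at the poles. *)
Lemma chart_int_divergence W T K :
  smooth3 W -> smooth3 T -> smooth3 K ->
  (forall l m, m = 1 \/ m = -1 -> pull W l m = 0) ->
  (forall l m, -1 < m < 1 ->
     pull K l m = pull (mer3 W) l m / (1 - m ^ 2) + pull (rot3 T) l m / (1 - m ^ 2)) ->
  chart_int (pull K) = 0.
Proof.
  intros HW HT HK Hp E. unfold chart_int.
  assert (Z : forall m, m = 1 \/ m = -1 -> RInt (fun l => pull W l m) 0 (2 * PI) = 0).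
  { intros m Hm. rewrite (RInt_ext _ (fun _ => 0)) by (intros; now apply Hp).
    rewrite RInt_const. unfold scal; simpl; unfold mult; simpl; ring. }
  rewrite (RInt_derive_open (fun m => RInt (fun l => pull W l m) 0 (2 * PI))).
  - rewrite !Z by tauto. ring.
  - lra.
  - intros m. now apply continuous_RInt_lambda, continuous_2d_pull.
  - intros m. now apply continuous_RInt_lambda, continuous_2d_pull.
  - intros m Hm. evar_last; [now apply is_derive_RInt_pull|].
    assert (Cr : ex_RInt (fun l => pull (rot3 T) l m) 0 (2 * PI))
      by (apply ex_RInt_lambda, continuous_2d_pull; smooth3).
    assert (Ck : ex_RInt (fun l => pull K l m) 0 (2 * PI))
      by (apply ex_RInt_lambda, continuous_2d_pull; smooth3).
    rewrite (RInt_ext _ (fun l => minus (pull K l m)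
      (scal (/ (1 - m ^ 2)) (pull (rot3 T) l m)))).
    2:{ intros l _. unfold minus, plus, opp, scal; simpl; unfold mult; simpl.
        rewrite E by exact Hm. simpl. unfold Rdiv. ring. }
    rewrite (RInt_minus (V := R_CompleteNormedModule)), (RInt_scal (V := R_CompleteNormedModule)),
      RInt_pull_rot3; trivial.
    + unfold minus, plus, opp, scal; simpl; unfold mult; simpl; ring.
    + apply (@ex_RInt_scal R_NormedModule), Cr.
Qed.

(** * Complex-valued smooth functions on the sphere *)

(** [U] and [V] are smooth extensions to R^3 of the real and imaginary parts of [f]. *)
Definition extends (U V : R -> R -> R -> R) (f : chart_fun) : Prop :=
  smooth3 U /\ smooth3 V /\
  forall l m, -1 < m < 1 -> f l m = (pull U l m, pull V l m).

(** Equality where the chart is a chart. *)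
Definition strip_eq (f g : chart_fun) : Prop :=
  forall l m, -1 < m < 1 -> f l m = g l m.

(** The meridian derivative [(1 - mu^2) d/dmu], smooth on the whole sphere. *)
Definition d_mer (f : chart_fun) : chart_fun :=
  fun l m => (RtoC (1 - m ^ 2) * d_mu f l m)%C.

(** Pointwise operations on functions on the sphere. *)
Definition cadd (f g : chart_fun) : chart_fun := fun l m => (f l m + g l m)%C.
Definition cmul (f g : chart_fun) : chart_fun := fun l m => (f l m * g l m)%C.
Definition ccst (c : C) : chart_fun := fun _ _ => c.

Lemma smooth_extends f : smooth_on_sphere f <-> exists U V, extends U V f.
Proof. split; intros (U & V & HU & HV & E); exists U, V; repeat split; auto. Qed.

Lemma extends_ext U V f g : strip_eq f g -> extends U V f -> extends U V g.
Proof. intros E (HU & HV & H). repeat split; auto. intros; rewrite <- E; auto. Qed.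

Lemma extends_add U V U' V' f g : extends U V f -> extends U' V' g ->
  extends (add3 U U') (add3 V V') (cadd f g).
Proof.
  intros (HU & HV & H) (HU' & HV' & H'). repeat split; smooth3.
  intros; unfold cadd; rewrite H, H' by assumption. reflexivity.
Qed.

Lemma extends_mul U V U' V' f g : extends U V f -> extends U' V' g ->
  extends (add3 (mul3 U U') (mul3 (cst3 (-1)) (mul3 V V')))
          (add3 (mul3 U V') (mul3 V U')) (cmul f g).
Proof.
  intros (HU & HV & H) (HU' & HV' & H'). repeat split; smooth3.
  intros; unfold cmul; rewrite H, H' by assumption. unfold Cmult; simpl.
  unfold pull, add3, mul3, cst3. f_equal; ring.
Qed.

Lemma extends_const c : extends (cst3 (Re c)) (cst3 (Im c)) (ccst c).
Proof. repeat split; smooth3. intros. apply surjective_pairing. Qed.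

Lemma extends_is_derive_lambda U V f l m : extends U V f -> -1 < m < 1 ->
  is_derive (fun t => Re (f t m)) l (pull (rot3 U) l m) /\
  is_derive (fun t => Im (f t m)) l (pull (rot3 V) l m).
Proof.
  intros (HU & HV & H) Hm. split.
  - apply (is_derive_ext (fun t => pull U t m)); [intros; now rewrite H|].
    now apply is_derive_pull_lambda.
  - apply (is_derive_ext (fun t => pull V t m)); [intros; now rewrite H|].
    now apply is_derive_pull_lambda.
Qed.

Lemma extends_is_derive_mu U V f l m : extends U V f -> -1 < m < 1 ->
  is_derive (fun t => Re (f l t)) m (pull (mer3 U) l m / (1 - m ^ 2)) /\
  is_derive (fun t => Im (f l t)) m (pull (mer3 V) l m / (1 - m ^ 2)).
Proof.
  intros (HU & HV & H) Hm.
  pose proof (locally_strip m Hm) as L. split.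
  - apply (is_derive_ext_loc (fun t => pull U l t)).
    + revert L; apply filter_imp. intros; now rewrite H.
    + now apply is_derive_pull_mu.
  - apply (is_derive_ext_loc (fun t => pull V l t)).
    + revert L; apply filter_imp. intros; now rewrite H.
    + now apply is_derive_pull_mu.
Qed.

Lemma extends_d_lambda U V f : extends U V f ->
  extends (rot3 U) (rot3 V) (d_lambda f).
Proof.
  intros H. pose proof H as (HU & HV & _). repeat split; smooth3.
  intros l m Hm. destruct (extends_is_derive_lambda U V f l m H Hm) as [D1 D2].
  unfold d_lambda, CDerive. f_equal; now apply is_derive_unique.
Qed.

Lemma extends_d_mu U V f l m : extends U V f -> -1 < m < 1 ->
  d_mu f l m = (pull (mer3 U) l m / (1 - m ^ 2), pull (mer3 V) l m / (1 - m ^ 2)).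
Proof.
  intros H Hm. destruct (extends_is_derive_mu U V f l m H Hm) as [D1 D2].
  unfold d_mu, CDerive. f_equal; now apply is_derive_unique.
Qed.

Lemma extends_d_mer U V f : extends U V f -> extends (mer3 U) (mer3 V) (d_mer f).
Proof.
  intros H. pose proof H as (HU & HV & _). repeat split; smooth3.
  intros l m Hm. unfold d_mer. rewrite (extends_d_mu U V) by assumption.
  pose proof (strip_pos m Hm).
  unfold Cmult, RtoC; simpl fst; simpl snd. f_equal; field; lra.
Qed.

Lemma extends_laplacian U V f : extends U V f -> extends (lap3 U) (lap3 V) (laplacian f).
Proof.
  intros H. pose proof H as (HU & HV & _). repeat split; smooth3.
  intros l m Hm. unfold laplacian. fold (d_mer f).
  rewrite (extends_d_mu _ _ _ l m (extends_d_mer _ _ _ H)) by assumption.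
  destruct (extends_d_lambda _ _ _ (extends_d_lambda _ _ _ H)) as (_ & _ & E).
  rewrite E, !pull_lap3 by assumption. pose proof (strip_pos m Hm).
  unfold Cmult, Cplus, RtoC; simpl fst; simpl snd. f_equal; field; lra.
Qed.

Lemma extends_poisson U V U' V' f g : extends U V f -> extends U' V' g ->
  extends (add3 (brk3 U U') (mul3 (cst3 (-1)) (brk3 V V')))
          (add3 (brk3 U V') (brk3 V U')) (poisson f g).
Proof.
  intros H H'. pose proof H as (HU & HV & _). pose proof H' as (HU' & HV' & _).
  repeat split; smooth3.
  intros l m Hm. unfold poisson.
  rewrite (extends_d_mu _ _ _ l m H), (extends_d_mu _ _ _ l m H') by assumption.
  destruct (extends_d_lambda _ _ _ H) as (_ & _ & E).
  destruct (extends_d_lambda _ _ _ H') as (_ & _ & E').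
  rewrite E, E' by assumption. pose proof (strip_pos m Hm).
  change (pull (add3 (brk3 U U') (mul3 (cst3 (-1)) (brk3 V V'))) l m) with
    (pull (brk3 U U') l m + -1 * pull (brk3 V V') l m).
  change (pull (add3 (brk3 U V') (brk3 V U')) l m) with
    (pull (brk3 U V') l m + pull (brk3 V U') l m).
  rewrite !pull_brk3 by assumption.
  unfold Cmult, Cminus, Cplus, Copp, RtoC; simpl fst; simpl snd. f_equal; field; lra.
Qed.

Definition cscal (c : C) (f : chart_fun) : chart_fun := fun l m => (c * f l m)%C.
Definition csub (f g : chart_fun) : chart_fun := fun l m => (f l m - g l m)%C.

Create HintDb sphere.

Lemma smooth_ext f g : strip_eq f g -> smooth_on_sphere f -> smooth_on_sphere g.
Proof.
  rewrite !smooth_extends. intros E (U & V & H). exists U, V. now apply (extends_ext U V f).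
Qed.
Lemma smooth_const c : smooth_on_sphere (ccst c).
Proof. rewrite smooth_extends. eexists _, _. apply extends_const. Qed.
Lemma smooth_add f g : smooth_on_sphere f -> smooth_on_sphere g -> smooth_on_sphere (cadd f g).
Proof.
  rewrite !smooth_extends. intros (U & V & H) (U' & V' & H').
  eexists _, _. eapply extends_add; eassumption.
Qed.
Lemma smooth_mul f g : smooth_on_sphere f -> smooth_on_sphere g -> smooth_on_sphere (cmul f g).
Proof.
  rewrite !smooth_extends. intros (U & V & H) (U' & V' & H').
  eexists _, _. eapply extends_mul; eassumption.
Qed.
Lemma smooth_scal c f : smooth_on_sphere f -> smooth_on_sphere (cscal c f).
Proof. intros H. exact (smooth_mul (ccst c) f (smooth_const c) H). Qed.
Lemma smooth_sub f g : smooth_on_sphere f -> smooth_on_sphere g -> smooth_on_sphere (csub f g).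
Proof.
  intros H H'. apply (smooth_ext (cadd f (cscal (RtoC (-1)) g))).
  - intros l m _. unfold cadd, cscal, csub. ring.
  - apply smooth_add; [exact H|now apply smooth_scal].
Qed.
Lemma smooth_d_lambda f : smooth_on_sphere f -> smooth_on_sphere (d_lambda f).
Proof.
  rewrite !smooth_extends. intros (U & V & H). eexists _, _. eapply extends_d_lambda, H.
Qed.
Lemma smooth_d_mer f : smooth_on_sphere f -> smooth_on_sphere (d_mer f).
Proof.
  rewrite !smooth_extends. intros (U & V & H). eexists _, _. eapply extends_d_mer, H.
Qed.
Lemma smooth_laplacian f : smooth_on_sphere f -> smooth_on_sphere (laplacian f).
Proof.
  rewrite !smooth_extends. intros (U & V & H). eexists _, _. eapply extends_laplacian, H.
Qed.
Lemma smooth_poisson f g : smooth_on_sphere f -> smooth_on_sphere g ->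
  smooth_on_sphere (poisson f g).
Proof.
  rewrite !smooth_extends. intros (U & V & H) (U' & V' & H').
  eexists _, _. eapply extends_poisson; eassumption.
Qed.

(** The height function. *)
Definition height : chart_fun := fun _ m => RtoC m.
Lemma smooth_height : smooth_on_sphere height.
Proof.
  rewrite smooth_extends. exists pZ, (cst3 0). repeat split; smooth3.
Qed.

#[local] Hint Resolve smooth_const smooth_add smooth_mul smooth_scal smooth_sub
  smooth_d_lambda smooth_d_mer smooth_laplacian smooth_poisson smooth_height : sphere.
Ltac sphere := auto 30 with sphere.

(** ** Leibniz rules *)

Lemma CDerive_mul (f g : R -> C) t :
  ex_derive (fun s => Re (f s)) t -> ex_derive (fun s => Im (f s)) t ->
  ex_derive (fun s => Re (g s)) t -> ex_derive (fun s => Im (g s)) t ->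
  CDerive (fun s => f s * g s)%C t = (CDerive f t * g t + f t * CDerive g t)%C.
Proof.
  intros F1 F2 G1 G2. unfold CDerive.
  change (fun s => Re (f s * g s)%C)
    with (fun s => Re (f s) * Re (g s) - Im (f s) * Im (g s)).
  change (fun s => Im (f s * g s)%C)
    with (fun s => Re (f s) * Im (g s) + Im (f s) * Re (g s)).
  rewrite Derive_minus, Derive_plus, !Derive_mult
    by first [assumption | now apply ex_derive_mult].
  unfold Cmult, Cplus, Re, Im; simpl; f_equal; ring.
Qed.

Lemma CDerive_add (f g : R -> C) t :
  ex_derive (fun s => Re (f s)) t -> ex_derive (fun s => Im (f s)) t ->
  ex_derive (fun s => Re (g s)) t -> ex_derive (fun s => Im (g s)) t ->
  CDerive (fun s => f s + g s)%C t = (CDerive f t + CDerive g t)%C.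
Proof.
  intros F1 F2 G1 G2. unfold CDerive.
  change (fun s => Re (f s + g s)%C) with (fun s => Re (f s) + Re (g s)).
  change (fun s => Im (f s + g s)%C) with (fun s => Im (f s) + Im (g s)).
  now rewrite !Derive_plus by assumption.
Qed.

Lemma smooth_ex_derive_lambda f l m : smooth_on_sphere f -> -1 < m < 1 ->
  ex_derive (fun t => Re (f t m)) l /\ ex_derive (fun t => Im (f t m)) l.
Proof.
  rewrite smooth_extends. intros (U & V & H) Hm.
  destruct (extends_is_derive_lambda U V f l m H Hm). split; eexists; eassumption.
Qed.

Lemma smooth_ex_derive_mu f l m : smooth_on_sphere f -> -1 < m < 1 ->
  ex_derive (fun t => Re (f l t)) m /\ ex_derive (fun t => Im (f l t)) m.
Proof.
  rewrite smooth_extends. intros (U & V & H) Hm.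
  destruct (extends_is_derive_mu U V f l m H Hm). split; eexists; eassumption.
Qed.

Lemma d_lambda_ext f g : strip_eq f g -> strip_eq (d_lambda f) (d_lambda g).
Proof.
  intros E l m Hm. unfold d_lambda, CDerive.
  f_equal; apply Derive_ext; intros t; now rewrite E.
Qed.

Lemma d_mu_ext f g : strip_eq f g -> strip_eq (d_mu f) (d_mu g).
Proof.
  intros E l m Hm. unfold d_mu, CDerive.
  f_equal; apply Derive_ext_loc; (apply (filter_imp (fun t => -1 < t < 1));
    [intros t Ht; now rewrite E|now apply locally_strip]).
Qed.

Lemma d_mer_ext f g : strip_eq f g -> strip_eq (d_mer f) (d_mer g).
Proof. intros E l m Hm. unfold d_mer. now rewrite (d_mu_ext f g E). Qed.

Lemma laplacian_ext f g : strip_eq f g -> strip_eq (laplacian f) (laplacian g).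
Proof.
  intros E l m Hm. unfold laplacian. fold (d_mer f) (d_mer g).
  rewrite (d_mu_ext _ _ (d_mer_ext f g E)) by exact Hm.
  now rewrite (d_lambda_ext _ _ (d_lambda_ext f g E)).
Qed.

Lemma d_lambda_mul f g l m : smooth_on_sphere f -> smooth_on_sphere g -> -1 < m < 1 ->
  d_lambda (cmul f g) l m = (d_lambda f l m * g l m + f l m * d_lambda g l m)%C.
Proof.
  intros Hf Hg Hm.
  destruct (smooth_ex_derive_lambda f l m Hf Hm), (smooth_ex_derive_lambda g l m Hg Hm).
  now apply (CDerive_mul (fun t => f t m) (fun t => g t m)).
Qed.
Lemma d_mu_mul f g l m : smooth_on_sphere f -> smooth_on_sphere g -> -1 < m < 1 ->
  d_mu (cmul f g) l m = (d_mu f l m * g l m + f l m * d_mu g l m)%C.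
Proof.
  intros Hf Hg Hm.
  destruct (smooth_ex_derive_mu f l m Hf Hm), (smooth_ex_derive_mu g l m Hg Hm).
  now apply (CDerive_mul (fun t => f l t) (fun t => g l t)).
Qed.
Lemma d_lambda_add f g l m : smooth_on_sphere f -> smooth_on_sphere g -> -1 < m < 1 ->
  d_lambda (cadd f g) l m = (d_lambda f l m + d_lambda g l m)%C.
Proof.
  intros Hf Hg Hm.
  destruct (smooth_ex_derive_lambda f l m Hf Hm), (smooth_ex_derive_lambda g l m Hg Hm).
  now apply (CDerive_add (fun t => f t m) (fun t => g t m)).
Qed.
Lemma d_mu_add f g l m : smooth_on_sphere f -> smooth_on_sphere g -> -1 < m < 1 ->
  d_mu (cadd f g) l m = (d_mu f l m + d_mu g l m)%C.
Proof.
  intros Hf Hg Hm.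
  destruct (smooth_ex_derive_mu f l m Hf Hm), (smooth_ex_derive_mu g l m Hg Hm).
  now apply (CDerive_add (fun t => f l t) (fun t => g l t)).
Qed.
Lemma d_lambda_const c l m : d_lambda (ccst c) l m = RtoC 0.
Proof. unfold d_lambda, CDerive, ccst. now rewrite !Derive_const. Qed.
Lemma d_mu_const c l m : d_mu (ccst c) l m = RtoC 0.
Proof. unfold d_mu, CDerive, ccst. now rewrite !Derive_const. Qed.
Lemma d_lambda_scal c f l m : smooth_on_sphere f -> -1 < m < 1 ->
  d_lambda (cscal c f) l m = (c * d_lambda f l m)%C.
Proof.
  intros Hf Hm. change (cscal c f) with (cmul (ccst c) f).
  rewrite d_lambda_mul, d_lambda_const by sphere. unfold ccst. ring.
Qed.
Lemma d_mu_scal c f l m : smooth_on_sphere f -> -1 < m < 1 ->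
  d_mu (cscal c f) l m = (c * d_mu f l m)%C.
Proof.
  intros Hf Hm. change (cscal c f) with (cmul (ccst c) f).
  rewrite d_mu_mul, d_mu_const by sphere. unfold ccst. ring.
Qed.
Lemma d_lambda_sub f g l m : smooth_on_sphere f -> smooth_on_sphere g -> -1 < m < 1 ->
  d_lambda (csub f g) l m = (d_lambda f l m - d_lambda g l m)%C.
Proof.
  intros Hf Hg Hm.
  rewrite (d_lambda_ext (csub f g) (cadd f (cscal (RtoC (-1)) g)))
    by (try exact Hm; intros ? ? _; unfold csub, cadd, cscal; ring).
  rewrite d_lambda_add, d_lambda_scal by sphere. ring.
Qed.
(** The rotation and the meridian fields commute. *)
Lemma d_lambda_d_mer f : smooth_on_sphere f ->
  strip_eq (d_lambda (d_mer f)) (d_mer (d_lambda f)).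
Proof.
  rewrite smooth_extends. intros (U & V & H) l m Hm.
  destruct (extends_d_lambda _ _ _ (extends_d_mer _ _ _ H)) as (_ & _ & E1).
  destruct (extends_d_mer _ _ _ (extends_d_lambda _ _ _ H)) as (_ & _ & E2).
  destruct H as (HU & HV & _).
  now rewrite E1, E2, !rot3_mer3 by assumption.
Qed.

(** ** Integration over the sphere *)

(** [pairing f g] is by definition the integral of [f g]. *)
Definition sphere_int (f : chart_fun) : C :=
  CRInt (fun m => CRInt (fun l => f l m) 0 (2 * PI)) (-1) 1.

Lemma CRInt_pair (u v : R -> R) a b : ex_RInt u a b -> ex_RInt v a b ->
  CRInt (fun t => (u t, v t)) a b = (RInt u a b, RInt v a b).
Proof.
  intros Hu Hv. apply (is_RInt_unique (V := C_R_CompleteNormedModule)).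
  apply (is_RInt_fct_extend_pair (U := R_NormedModule) (V := R_NormedModule)
    (fun t => (u t, v t))); now apply (RInt_correct (V := R_CompleteNormedModule)).
Qed.

Lemma CRInt_ext f g a b : a <= b -> (forall t, a < t < b -> f t = g t) ->
  CRInt f a b = CRInt g a b.
Proof.
  intros Hab E. apply (RInt_ext (V := C_R_CompleteNormedModule)).
  rewrite Rmin_left, Rmax_right by exact Hab. exact E.
Qed.

Lemma sphere_int_ext f g : strip_eq f g -> sphere_int f = sphere_int g.
Proof.
  intros E. unfold sphere_int. apply CRInt_ext; [lra|]. intros m Hm.
  apply CRInt_ext; [left; apply two_PI_pos|]. intros l _. now apply E.
Qed.

Lemma sphere_int_extends U V f : extends U V f ->
  sphere_int f = (chart_int (pull U), chart_int (pull V)).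
Proof.
  intros (HU & HV & E).
  rewrite (sphere_int_ext f (fun l m => (pull U l m, pull V l m)) E).
  unfold sphere_int, chart_int.
  rewrite <- CRInt_pair by now apply ex_RInt_mu, continuous_2d_pull.
  apply CRInt_ext; [lra|]. intros m _.
  apply (CRInt_pair (fun l => pull U l m) (fun l => pull V l m));
    now apply ex_RInt_lambda, continuous_2d_pull.
Qed.

Lemma sphere_int_add f g : smooth_on_sphere f -> smooth_on_sphere g ->
  sphere_int (cadd f g) = (sphere_int f + sphere_int g)%C.
Proof.
  rewrite !smooth_extends. intros (U & V & H) (U' & V' & H').
  rewrite (sphere_int_extends _ _ _ H), (sphere_int_extends _ _ _ H'),
    (sphere_int_extends _ _ _ (extends_add _ _ _ _ _ _ H H')).
  destruct H as (HU & HV & _), H' as (HU' & HV' & _).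
  assert (L : forall F G, smooth3 F -> smooth3 G ->
     chart_int (pull (add3 F G)) = chart_int (pull F) + chart_int (pull G)).
  { intros F G HF HG. rewrite <- (Rmult_1_l (chart_int (pull F))),
      <- (Rmult_1_l (chart_int (pull G))).
    rewrite <- chart_int_lin by now apply continuous_2d_pull.
    apply chart_int_ext. intros. unfold pull, add3. ring. }
  now rewrite !L by assumption.
Qed.

Lemma sphere_int_scal c f : smooth_on_sphere f ->
  sphere_int (cscal c f) = (c * sphere_int f)%C.
Proof.
  rewrite !smooth_extends. intros (U & V & H).
  rewrite (sphere_int_extends _ _ _ H).
  change (cscal c f) with (cmul (ccst c) f).
  rewrite (sphere_int_extends _ _ _ (extends_mul _ _ _ _ _ _ (extends_const c) H)).
  destruct H as (HU & HV & _).
  assert (L : forall a b h, (forall l m, pull h l m = a * pull U l m + b * pull V l m) ->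
     chart_int (pull h) = a * chart_int (pull U) + b * chart_int (pull V)).
  { intros a b h E. rewrite <- chart_int_lin by now apply continuous_2d_pull.
    apply chart_int_ext. intros. apply E. }
  transitivity (Re c * chart_int (pull U) + - Im c * chart_int (pull V),
                Im c * chart_int (pull U) + Re c * chart_int (pull V)).
  - f_equal; apply L; intros; unfold pull, add3, mul3, cst3; ring.
  - unfold Cmult, Re, Im; simpl. f_equal; ring.
Qed.

(** Vanishing at both poles, stated for the smooth extension because the values of
    [f] at [mu = 1, -1] are irrelevant. *)
Definition vanishes_at_poles (f : chart_fun) : Prop :=
  exists U V, extends U V f /\
    forall l m, m = 1 \/ m = -1 -> pull U l m = 0 /\ pull V l m = 0.

Lemma vanishes_d_lambda f : smooth_on_sphere f -> vanishes_at_poles (d_lambda f).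
Proof.
  rewrite smooth_extends. intros (U & V & H).
  exists (rot3 U), (rot3 V). split; [now apply extends_d_lambda|].
  intros; split; now apply pull_rot3_pole.
Qed.
Lemma vanishes_d_mer f : smooth_on_sphere f -> vanishes_at_poles (d_mer f).
Proof.
  rewrite smooth_extends. intros (U & V & H).
  exists (mer3 U), (mer3 V). split; [now apply extends_d_mer|].
  intros; split; now apply pull_mer3_pole.
Qed.
Lemma vanishes_mul f g : smooth_on_sphere f -> vanishes_at_poles g ->
  vanishes_at_poles (cmul f g).
Proof.
  rewrite smooth_extends. intros (U & V & H) (U' & V' & H' & Z).
  eexists _, _. split; [exact (extends_mul _ _ _ _ _ _ H H')|].
  intros l m Hm. destruct (Z l m Hm) as [Z1 Z2]. unfold pull, add3, mul3 in *.
  rewrite Z1, Z2. split; ring.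
Qed.
Lemma vanishes_add f g : vanishes_at_poles f -> vanishes_at_poles g ->
  vanishes_at_poles (cadd f g).
Proof.
  intros (U & V & H & Y) (U' & V' & H' & Z).
  eexists _, _. split; [exact (extends_add _ _ _ _ _ _ H H')|].
  intros l m Hm. destruct (Z l m Hm) as [Z1 Z2], (Y l m Hm) as [Y1 Y2].
  unfold pull, add3 in *. rewrite Z1, Z2, Y1, Y2. split; ring.
Qed.
(** The divergence theorem for complex-valued functions. *)
Lemma sphere_int_divergence W T K :
  vanishes_at_poles W -> smooth_on_sphere T -> smooth_on_sphere K ->
  (forall l m, -1 < m < 1 ->
     K l m = (d_mu W l m + RtoC (/ (1 - m ^ 2)) * d_lambda T l m)%C) ->
  sphere_int K = RtoC 0.
Proof.
  rewrite !smooth_extends. intros (U & V & HW & Z) (U1 & V1 & HT) (U2 & V2 & HK) E.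
  assert (E' : forall l m, -1 < m < 1 ->
    pull U2 l m = pull (mer3 U) l m / (1 - m ^ 2) + pull (rot3 U1) l m / (1 - m ^ 2) /\
    pull V2 l m = pull (mer3 V) l m / (1 - m ^ 2) + pull (rot3 V1) l m / (1 - m ^ 2)).
  { intros l m Hm. specialize (E l m Hm).
    rewrite (extends_d_mu _ _ _ l m HW Hm) in E.
    destruct (extends_d_lambda _ _ _ HT) as (_ & _ & ET).
    destruct HK as (_ & _ & EK). rewrite EK, ET in E by exact Hm.
    unfold Cmult, Cplus, RtoC in E; simpl fst in E; simpl snd in E.
    injection E as E1 E2. rewrite E1, E2.
    replace (1 - m * (m * 1)) with (1 - m ^ 2) by ring. unfold Rdiv. split; ring. }
  rewrite (sphere_int_extends _ _ _ HK).
  destruct HW as (? & ? & _), HT as (? & ? & _), HK as (? & ? & _).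
  unfold RtoC. f_equal.
  - apply (chart_int_divergence U U1); try assumption.
    + intros; now apply Z.
    + intros; now apply E'.
  - apply (chart_int_divergence V V1); try assumption.
    + intros; now apply Z.
    + intros; now apply E'.
Qed.

(** ** The pairing *)

Lemma pairingE f g : pairing f g = sphere_int (cmul f g).
Proof. reflexivity. Qed.

Lemma pairing_ext f f' g g' : strip_eq f f' -> strip_eq g g' -> pairing f g = pairing f' g'.
Proof.
  intros E E'. rewrite !pairingE. apply sphere_int_ext.
  intros l m Hm. unfold cmul. now rewrite E, E'.
Qed.

Lemma pairing_sym f g : pairing f g = pairing g f.
Proof. rewrite !pairingE. apply sphere_int_ext. intros l m _. apply Cmult_comm. Qed.

Lemma pairing_add_l f g h : smooth_on_sphere f -> smooth_on_sphere g -> smooth_on_sphere h ->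
  pairing (cadd f g) h = (pairing f h + pairing g h)%C.
Proof.
  intros Hf Hg Hh.
  rewrite !pairingE.
  rewrite <- sphere_int_add by sphere.
  apply sphere_int_ext. intros l m _. unfold cadd, cmul. ring.
Qed.
Lemma pairing_scal_l c f h : smooth_on_sphere f -> smooth_on_sphere h ->
  pairing (cscal c f) h = (c * pairing f h)%C.
Proof.
  intros Hf Hh.
  rewrite !pairingE.
  rewrite <- sphere_int_scal by sphere.
  apply sphere_int_ext. intros l m _. unfold cscal, cmul. ring.
Qed.
Lemma pairing_sub_l f g h : smooth_on_sphere f -> smooth_on_sphere g -> smooth_on_sphere h ->
  pairing (csub f g) h = (pairing f h - pairing g h)%C.
Proof.
  intros Hf Hg Hh.
  rewrite (pairing_ext (csub f g) (cadd f (cscal (RtoC (-1)) g)) h h)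
    by (intros ? ? _; unfold csub, cadd, cscal; ring).
  rewrite pairing_add_l, pairing_scal_l by sphere. ring.
Qed.
Lemma pairing_add_r f g h : smooth_on_sphere f -> smooth_on_sphere g -> smooth_on_sphere h ->
  pairing h (cadd f g) = (pairing h f + pairing h g)%C.
Proof. intros. rewrite 3!(pairing_sym h). now apply pairing_add_l. Qed.
Lemma pairing_scal_r c f h : smooth_on_sphere f -> smooth_on_sphere h ->
  pairing h (cscal c f) = (c * pairing h f)%C.
Proof. intros. rewrite 2!(pairing_sym h). now apply pairing_scal_l. Qed.
Lemma pairing_sub_r f g h : smooth_on_sphere f -> smooth_on_sphere g -> smooth_on_sphere h ->
  pairing h (csub f g) = (pairing h f - pairing h g)%C.
Proof. intros. rewrite 3!(pairing_sym h). now apply pairing_sub_l. Qed.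

Lemma RtoC_inv_strip m : -1 < m < 1 -> (RtoC (/ (1 - m ^ 2)) * RtoC (1 - m ^ 2))%C = RtoC 1.
Proof.
  intros Hm. pose proof (strip_pos m Hm). rewrite <- RtoC_mult. f_equal. field. lra.
Qed.

(** Green's formula. *)
Lemma laplacian_self_adjoint u v : smooth_on_sphere u -> smooth_on_sphere v ->
  pairing (laplacian u) v = pairing u (laplacian v).
Proof.
  intros Hu Hv.
  (* the integrand is the divergence of [v grad u - u grad v] *)
  assert (Z : sphere_int (csub (cmul (laplacian u) v) (cmul u (laplacian v))) = RtoC 0).
  { apply (sphere_int_divergence
      (cadd (cmul v (d_mer u)) (cmul (cscal (RtoC (-1)) u) (d_mer v)))
      (csub (cmul (d_lambda u) v) (cmul u (d_lambda v)))).
    - apply vanishes_add; apply vanishes_mul; sphere; now apply vanishes_d_mer.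
    - sphere.
    - sphere.
    - intros l m Hm.
      rewrite d_mu_add, d_lambda_sub, !d_mu_mul, !d_lambda_mul, d_mu_scal by sphere.
      unfold csub, cmul, cscal, laplacian, d_mer.
      ring. }
  rewrite !pairingE.
  replace (sphere_int (cmul (laplacian u) v))
    with (sphere_int (cadd (csub (cmul (laplacian u) v) (cmul u (laplacian v)))
                           (cmul u (laplacian v)))).
  2:{ apply sphere_int_ext. intros l m _. unfold cadd, csub. ring. }
  rewrite sphere_int_add, Z by sphere. ring.
Qed.

(** The pairing is invariant for the Poisson bracket. *)
Lemma pairing_poisson f g h :
  smooth_on_sphere f -> smooth_on_sphere g -> smooth_on_sphere h ->
  pairing (poisson f g) h = pairing f (poisson g h).
Proof.
  intros Hf Hg Hh.
  (* {f, g} h - f {g, h} = d_lambda (f h g_mu) - d_mu (f h g_lambda) *)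
  assert (Z : sphere_int (csub (cmul (poisson f g) h) (cmul f (poisson g h))) = RtoC 0).
  { apply (sphere_int_divergence
      (cmul (cscal (RtoC (-1)) (cmul f h)) (d_lambda g)) (cmul f (cmul (d_mer g) h))).
    - apply vanishes_mul; sphere; now apply vanishes_d_lambda.
    - sphere.
    - sphere.
    - intros l m Hm.
      rewrite d_mu_mul, d_mu_scal, d_mu_mul, !d_lambda_mul, d_lambda_d_mer by sphere.
      unfold csub, cmul, cscal, poisson, d_mer.
      pose proof (RtoC_inv_strip m Hm) as E. ring [E]. }
  rewrite !pairingE.
  replace (sphere_int (cmul (poisson f g) h))
    with (sphere_int (cadd (csub (cmul (poisson f g) h) (cmul f (poisson g h)))
                           (cmul f (poisson g h)))).
  2:{ apply sphere_int_ext. intros l m _. unfold cadd, csub. ring. }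
  rewrite sphere_int_add, Z by sphere. ring.
Qed.

Lemma poisson_antisym f g : strip_eq (poisson f g) (cscal (RtoC (-1)) (poisson g f)).
Proof. intros l m _. unfold poisson, cscal. ring. Qed.

Lemma d_mu_height l m : d_mu height l m = RtoC 1.
Proof.
  unfold d_mu, CDerive, height, RtoC; simpl. f_equal; [apply Derive_id|apply Derive_const].
Qed.
Lemma d_lambda_height l m : d_lambda height l m = RtoC 0.
Proof.
  unfold d_lambda, CDerive, height, RtoC; simpl. f_equal; apply Derive_const.
Qed.

(** The bracket with the height function is the rotation field. *)
Lemma poisson_height f : strip_eq (poisson f height) (d_lambda f).
Proof.
  intros l m _. unfold poisson. rewrite d_mu_height, d_lambda_height. ring.
Qed.

(** Integration by parts in the longitude, as invariance for the bracket with the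
    height. *)
Lemma pairing_d_lambda f g : smooth_on_sphere f -> smooth_on_sphere g ->
  pairing (d_lambda f) g = (RtoC (-1) * pairing f (d_lambda g))%C.
Proof.
  intros Hf Hg.
  assert (H0 : forall h, strip_eq h h) by (intros ? ? ? _; reflexivity).
  rewrite <- (pairing_ext _ _ g g (poisson_height f) (H0 g)).
  rewrite pairing_poisson by sphere.
  rewrite (pairing_ext f f _ (cscal (RtoC (-1)) (d_lambda g)) (H0 f)).
  2:{ intros l m Hm. rewrite poisson_antisym by exact Hm. unfold cscal.
      now rewrite poisson_height. }
  now rewrite pairing_scal_r by sphere.
Qed.

Lemma laplacian_scal c f : smooth_on_sphere f ->
  strip_eq (laplacian (cscal c f)) (cscal c (laplacian f)).
Proof.
  intros Hf l m Hm. unfold laplacian. fold (d_mer f) (d_mer (cscal c f)).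
  rewrite (d_mu_ext (d_mer (cscal c f)) (cscal c (d_mer f))).
  - rewrite (d_lambda_ext _ (cscal c (d_lambda f))).
    + rewrite d_mu_scal, d_lambda_scal by sphere.
      unfold cscal. ring.
    + intros l' m' Hm'. now rewrite d_lambda_scal.
    + exact Hm.
  - intros l' m' Hm'. unfold d_mer. rewrite d_mu_scal by sphere. unfold cscal. ring.
  - exact Hm.
Qed.

Lemma laplacian_add f g : smooth_on_sphere f -> smooth_on_sphere g ->
  strip_eq (laplacian (cadd f g)) (cadd (laplacian f) (laplacian g)).
Proof.
  intros Hf Hg l m Hm. unfold laplacian. fold (d_mer f) (d_mer g) (d_mer (cadd f g)).
  rewrite (d_mu_ext (d_mer (cadd f g)) (cadd (d_mer f) (d_mer g))).
  - rewrite (d_lambda_ext _ (cadd (d_lambda f) (d_lambda g))).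
    + rewrite d_mu_add, d_lambda_add by sphere.
      unfold cadd. fold (d_mer f) (d_mer g). ring.
    + intros l' m' Hm'. now rewrite d_lambda_add.
    + exact Hm.
  - intros l' m' Hm'. unfold d_mer. rewrite d_mu_add by sphere. unfold cadd. ring.
  - exact Hm.
Qed.

Lemma smooth_Delta_theta alpha f : smooth_on_sphere f -> smooth_on_sphere (Delta_theta alpha f).
Proof.
  intros Hf. exact (smooth_sub _ _ (smooth_scal (RtoC (alpha ^ 2)) f Hf) (smooth_laplacian f Hf)).
Qed.
#[local] Hint Resolve smooth_Delta_theta : sphere.

Lemma Delta_theta_self_adjoint alpha u v : smooth_on_sphere u -> smooth_on_sphere v ->
  pairing (Delta_theta alpha u) v = pairing u (Delta_theta alpha v).
Proof.
  intros Hu Hv.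
  change (Delta_theta alpha u) with (csub (cscal (RtoC (alpha ^ 2)) u) (laplacian u)).
  change (Delta_theta alpha v) with (csub (cscal (RtoC (alpha ^ 2)) v) (laplacian v)).
  rewrite pairing_sub_l, pairing_sub_r, pairing_scal_l, pairing_scal_r by sphere.
  now rewrite laplacian_self_adjoint by sphere.
Qed.

(** * Associated Legendre functions *)

(** Differentiation rules over [R], in ring notation. *)
Lemma der_const c t : is_derive (fun _ : R => c : R) t 0.
Proof. apply (@is_derive_const R_AbsRing R_NormedModule). Qed.
Lemma der_id t : is_derive (fun s : R => s) t 1.
Proof. apply (@is_derive_id R_AbsRing). Qed.
Lemma der_plus (f g : R -> R) (t a b : R) :
  is_derive f t a -> is_derive g t b -> is_derive (fun s => f s + g s) t (a + b).
Proof. apply (@is_derive_plus R_AbsRing R_NormedModule). Qed.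
Lemma der_minus (f g : R -> R) (t a b : R) :
  is_derive f t a -> is_derive g t b -> is_derive (fun s => f s - g s) t (a - b).
Proof. apply (@is_derive_minus R_AbsRing R_NormedModule). Qed.
Lemma der_mul (f g : R -> R) (t a b : R) :
  is_derive f t a -> is_derive g t b ->
  is_derive (fun s => f s * g s) t (a * g t + f t * b).
Proof. intros Hf Hg. apply (is_derive_mult f g t); [exact Hf|exact Hg|exact Rmult_comm]. Qed.
Lemma der_scal (f : R -> R) (k t a : R) :
  is_derive f t a -> is_derive (fun s => k * f s) t (k * a).
Proof. apply is_derive_scal. Qed.
Lemma der_scal_r (f : R -> R) (k t a : R) :
  is_derive f t a -> is_derive (fun s => f s * k) t (a * k).
Proof. apply (is_derive_scal_l (V := R_NormedModule)). Qed.
Lemma der_pow (f : R -> R) n (t a : R) :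
  is_derive f t a -> is_derive (fun s => f s ^ n) t (INR n * a * f t ^ pred n).
Proof. apply is_derive_pow. Qed.
Lemma der_val (f : R -> R) (t a b : R) : is_derive f t a -> a = b -> is_derive f t b.
Proof. intros H <-. exact H. Qed.

(** Real polynomial functions. *)
Inductive is_poly : (R -> R) -> Prop :=
| poly_const c : is_poly (fun _ => c)
| poly_id : is_poly (fun t => t)
| poly_add f g : is_poly f -> is_poly g -> is_poly (fun t => f t + g t)
| poly_mul f g : is_poly f -> is_poly g -> is_poly (fun t => f t * g t).

Lemma poly_derive f : is_poly f ->
  exists f', is_poly f' /\ forall t, is_derive f t (f' t).
Proof.
  induction 1 as [c| |f g Hf (f' & Pf & Df) Hg (g' & Pg & Dg)
                 |f g Hf (f' & Pf & Df) Hg (g' & Pg & Dg)].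
  - exists (fun _ => 0). split; [constructor|]. intros t.
    apply der_const.
  - exists (fun _ => 1). split; [constructor|]. intros t. apply der_id.
  - exists (fun t => f' t + g' t). split; [now constructor|]. intros t.
    now apply der_plus.
  - exists (fun t => f' t * g t + f t * g' t). split.
    + apply poly_add; now apply poly_mul.
    + intros t. apply (der_mul f g); [apply Df|apply Dg].
Qed.

Lemma poly_is_derive f t : is_poly f -> is_derive f t (Derive f t).
Proof.
  intros Hf. destruct (poly_derive f Hf) as (f' & _ & D).
  apply Derive_correct. eexists; apply D.
Qed.

Lemma poly_Derive f : is_poly f -> is_poly (Derive f).
Proof.
  intros Hf. destruct (poly_derive f Hf) as (f' & Pf & D).
  replace (Derive f) with f'; [exact Pf|].
  apply functional_extensionality. intros t. symmetry. now apply is_derive_unique.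
Qed.

Lemma poly_Derive_n f n : is_poly f -> is_poly (Derive_n f n).
Proof. intros Hf; induction n as [|n IH]; [exact Hf|]. now apply (poly_Derive (Derive_n f n)). Qed.

Lemma poly_pow f n : is_poly f -> is_poly (fun t => f t ^ n).
Proof.
  intros Hf; induction n as [|n IH]; [exact (poly_const 1)|].
  exact (poly_mul f (fun t => f t ^ n) Hf IH).
Qed.

Lemma poly_smooth3 f : is_poly f -> smooth3 (fun _ _ z => f z).
Proof.
  induction 1 as [c| |f g Hf IHf Hg IHg|f g Hf IHf Hg IHg].
  - apply smooth3_const.
  - apply smooth3_pZ.
  - exact (smooth3_add _ _ IHf IHg).
  - exact (smooth3_mul _ _ IHf IHg).
Qed.

Lemma der_sq_minus_1 t : is_derive (fun s => s ^ 2 - 1) t (2 * t).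
Proof.
  eapply der_val; [apply (der_minus (fun s => s ^ 2) (fun _ => 1));
                   [apply (der_pow (fun s => s) 2 t 1), der_id|apply der_const]|].
  simpl. ring.
Qed.
Lemma der_1_minus_sq t : is_derive (fun s => 1 - s ^ 2) t (- 2 * t).
Proof.
  eapply der_val; [apply (der_minus (fun _ => 1) (fun s => s ^ 2));
                   [apply der_const|apply (der_pow (fun s => s) 2 t 1), der_id]|].
  simpl. ring.
Qed.

(** The [n]-th derivative of [(t^2 - 1)^l / (2^l l!)]. *)
Definition rodrigues (l n : nat) (t : R) : R :=
  Derive_n (fun t => (t ^ 2 - 1) ^ l) n t / (2 ^ l * INR (fact l)).

Lemma poly_rodrigues_base l : is_poly (fun t => (t ^ 2 - 1) ^ l).
Proof.
  apply poly_pow.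
  exact (poly_add (fun t => t ^ 2) (fun _ => - 1) (poly_pow _ 2 poly_id) (poly_const _)).
Qed.

Lemma poly_rodrigues l n : is_poly (rodrigues l n).
Proof.
  apply (poly_mul _ (fun _ => / (2 ^ l * INR (fact l)))); [|apply poly_const].
  apply poly_Derive_n, poly_rodrigues_base.
Qed.

Lemma is_derive_rodrigues l n t : is_derive (rodrigues l n) t (rodrigues l (S n) t).
Proof.
  apply der_scal_r.
  apply (poly_is_derive (Derive_n (fun t => (t ^ 2 - 1) ^ l) n)).
  apply poly_Derive_n, poly_rodrigues_base.
Qed.

Lemma rodrigues_0 l t : rodrigues l 0 t = (t ^ 2 - 1) ^ l / (2 ^ l * INR (fact l)).
Proof. reflexivity. Qed.

(** Equal functions have equal derivatives. *)
Lemma is_derive_eq (f g : R -> R) (t a b : R) :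
  (forall s, f s = g s) -> is_derive f t a -> is_derive g t b -> a = b.
Proof.
  intros E Hf Hg. rewrite <- (is_derive_unique _ _ _ Hg).
  symmetry. apply is_derive_unique. apply (is_derive_ext f); assumption.
Qed.

Lemma rodrigues_0_S l t :
  2 * INR (S l) * rodrigues (S l) 0 t = (t ^ 2 - 1) * rodrigues l 0 t.
Proof.
  rewrite !rodrigues_0. rewrite fact_simpl, mult_INR.
  pose proof (INR_fact_lt_0 l). pose proof (lt_0_INR (S l) (Nat.lt_0_succ l)).
  pose proof (pow_lt 2 l ltac:(lra)). simpl pow. field. lra.
Qed.

Lemma rodrigues_1_S l t : rodrigues (S l) 1 t = t * rodrigues l 0 t.
Proof.
  symmetry. rewrite rodrigues_0.
  apply (is_derive_eq (fun s => (s ^ 2 - 1) ^ S l / (2 ^ S l * INR (fact (S l))))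
           (rodrigues (S l) 0) t); [reflexivity| |apply is_derive_rodrigues].
  eapply der_val.
  { apply der_scal_r.
    apply (der_pow (fun s => s ^ 2 - 1) (S l) t (2 * t)).
    apply der_sq_minus_1. }
  cbv beta.
  rewrite fact_simpl, mult_INR.
  pose proof (INR_fact_lt_0 l). pose proof (lt_0_INR (S l) (Nat.lt_0_succ l)).
  pose proof (pow_lt 2 l ltac:(lra)). simpl Nat.pred.
  change (2 ^ S l) with (2 * 2 ^ l). field. lra.
Qed.

Lemma INR_mult_pred (f : nat -> R) n : INR n * f (S (pred n)) = INR n * f n.
Proof. destruct n; simpl; [ring|reflexivity]. Qed.

(** The [n]-th derivative of the identity [D R_(l+1) = t R_l], with [R_l] the polynomial
    [(t^2 - 1)^l / (2^l l!)].  For [n = 0] the last term has coefficient zero. *)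
Lemma rodrigues_raise l n t :
  rodrigues (S l) (S n) t = t * rodrigues l n t + INR n * rodrigues l (pred n) t.
Proof.
  revert t; induction n as [|n IH]; intros t.
  - rewrite rodrigues_1_S. simpl. ring.
  - assert (E : rodrigues (S l) (S (S n)) t
      = (1 * rodrigues l n t + t * rodrigues l (S n) t)
        + INR n * rodrigues l (S (pred n)) t).
    { apply (is_derive_eq _ _ t _ _ IH); [apply is_derive_rodrigues|].
      apply der_plus.
      - apply (der_mul (fun s => s) (rodrigues l n));
          [apply der_id|apply is_derive_rodrigues].
      - apply der_scal, is_derive_rodrigues. }
    rewrite E, (INR_mult_pred (fun k => rodrigues l k t)), S_INR. simpl pred. ring.
Qed.

(** The [n]-th derivative of [D^2 R_(k+2) = (2 k + 3) R_(k+1) + R_k]. *)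
Lemma rodrigues_shift k n t :
  rodrigues (S (S k)) (S (S n)) t
  = (2 * INR k + 3) * rodrigues (S k) n t + rodrigues k n t.
Proof.
  revert t; induction n as [|n IH]; intros t.
  - rewrite rodrigues_raise, rodrigues_1_S. simpl pred.
    pose proof (rodrigues_0_S k t) as E. rewrite S_INR in E. simpl INR at 1. lra.
  - apply (is_derive_eq _ _ t _ _ IH); [apply is_derive_rodrigues|].
    apply der_plus.
    + apply der_scal, is_derive_rodrigues.
    + apply is_derive_rodrigues.
Qed.

(** The [n]-th derivative of [(t^2 - 1) R_l' = 2 l t R_l]. *)
Lemma rodrigues_ode l n t :
  (t ^ 2 - 1) * rodrigues l (S n) t + 2 * (INR n - INR l) * (t * rodrigues l n t)
  + (INR n * (INR n - 1 - 2 * INR l)) * rodrigues l (pred n) t = 0.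
Proof.
  revert t; induction n as [|n IH]; intros t.
  - destruct l as [|l].
    + replace (rodrigues 0 1 t) with 0; [simpl; ring|].
      apply (is_derive_eq (fun _ => 1) (rodrigues 0 0) t).
      * intros s. rewrite rodrigues_0. simpl. field.
      * apply der_const.
      * apply is_derive_rodrigues.
    + rewrite rodrigues_1_S. pose proof (rodrigues_0_S l t) as E.
      simpl INR at 1 3. simpl pred. rewrite Rmult_0_l, Rmult_0_l, Rplus_0_r.
      replace ((t ^ 2 - 1) * (t * rodrigues l 0 t))
        with (t * ((t ^ 2 - 1) * rodrigues l 0 t)) by ring.
      rewrite <- E. ring.
  - assert (E : (2 * t * rodrigues l (S n) t + (t ^ 2 - 1) * rodrigues l (S (S n)) t)
        + 2 * (INR n - INR l) * (1 * rodrigues l n t + t * rodrigues l (S n) t)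
        + (INR n * (INR n - 1 - 2 * INR l)) * rodrigues l (S (pred n)) t = 0).
    { apply (is_derive_eq _ _ t _ _ IH);
        [|apply der_const].
      apply der_plus;
        [apply der_plus|].
      - apply (der_mul (fun s => s ^ 2 - 1) (rodrigues l (S n)));
          [apply der_sq_minus_1|apply is_derive_rodrigues].
      - apply der_scal.
        apply (der_mul (fun s => s) (rodrigues l n));
          [apply der_id|apply is_derive_rodrigues].
      - apply der_scal, is_derive_rodrigues. }
    replace (INR n * (INR n - 1 - 2 * INR l) * rodrigues l (S (pred n)) t)
      with ((INR n - 1 - 2 * INR l) * (INR n * rodrigues l (S (pred n)) t)) in E by ring.
    rewrite (INR_mult_pred (fun k => rodrigues l k t)) in E.
    rewrite S_INR. simpl pred. rewrite <- E. ring.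
Qed.

(** [(t^2 - 1)^m] has degree [2 m]. *)
Lemma rodrigues_high m t : rodrigues m (S (2 * m)) t = 0.
Proof.
  revert t; induction m as [|m IH]; intros t.
  - apply (is_derive_eq (rodrigues 0 0) (fun _ => 1) t).
    + intros s. rewrite rodrigues_0. simpl. field.
    + apply is_derive_rodrigues.
    + apply der_const.
  - replace (S (2 * S m)) with (S (S (S (2 * m)))) by lia.
    rewrite rodrigues_raise. simpl pred. rewrite IH.
    replace (rodrigues m (S (S (2 * m))) t) with 0; [ring|].
    symmetry. apply (is_derive_eq (rodrigues m (S (2 * m))) (fun _ => 0) t); [exact IH| |].
    + apply is_derive_rodrigues.
    + apply der_const.
Qed.

Lemma rodrigues_top m t :
  rodrigues (S m) (2 * S m) t = (2 * INR m + 1) * rodrigues m (2 * m) t.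
Proof.
  replace (2 * S m)%nat with (S (S (2 * m))) by lia.
  rewrite rodrigues_raise, rodrigues_high, S_INR, mult_INR.
  change (pred (S (2 * m))) with (2 * m)%nat. simpl (INR 2). ring.
Qed.

Lemma legendre_rodrigues l m t :
  legendre l m t = sqrt (1 - t ^ 2) ^ m * rodrigues l (l + m) t.
Proof. unfold legendre, rodrigues, Rdiv. ring. Qed.

(** Bonnet's recursion. *)
Lemma legendre_mul_mu k m t :
  t * legendre (S k) m t
  = (INR (S k) - INR m + 1) / (2 * INR (S k) + 1) * legendre (S (S k)) m t
    + (INR (S k) + INR m) / (2 * INR (S k) + 1) * legendre k m t.
Proof.
  rewrite !legendre_rodrigues.
  pose proof (rodrigues_raise (S k) (S k + m) t) as E1.
  pose proof (rodrigues_shift k (k + m) t) as E2.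
  replace (pred (S k + m)) with (k + m)%nat in E1 by lia.
  replace (S (S k + m)) with (S (S k) + m)%nat in E1 by lia.
  replace (S (S (k + m))) with (S (S k) + m)%nat in E2 by lia.
  rewrite plus_INR, !S_INR in E1. rewrite !S_INR. pose proof (pos_INR k).
  set (r := sqrt (1 - t ^ 2) ^ m).
  replace ((INR k + 1 - INR m + 1) / (2 * (INR k + 1) + 1)
             * (r * rodrigues (S (S k)) (S (S k) + m) t)
           + (INR k + 1 + INR m) / (2 * (INR k + 1) + 1) * (r * rodrigues k (k + m) t))
    with (r / (2 * INR k + 3) *
      ((INR k + 2 - INR m) * rodrigues (S (S k)) (S (S k) + m) t
       + (INR k + 1 + INR m) * rodrigues k (k + m) t)) by (field; lra).
  replace ((INR k + 2 - INR m) * rodrigues (S (S k)) (S (S k) + m) t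
       + (INR k + 1 + INR m) * rodrigues k (k + m) t)
    with ((2 * INR k + 3) * (t * rodrigues (S k) (S k + m) t)).
  { field. lra. }
  replace (rodrigues k (k + m) t) with
    (rodrigues (S (S k)) (S (S k) + m) t - (2 * INR k + 3) * rodrigues (S k) (k + m) t) by lra.
  replace (t * rodrigues (S k) (S k + m) t) with
    (rodrigues (S (S k)) (S (S k) + m) t
     - (INR k + 1 + INR m) * rodrigues (S k) (k + m) t) by lra.
  ring.
Qed.

(** Derivative of a function times the weight [(1 - t^2)^(m/2)]. *)
Lemma is_derive_weight m (f f' : R -> R) t : -1 < t < 1 -> is_derive f t (f' t) ->
  is_derive (fun s => sqrt (1 - s ^ 2) ^ m * f s) t
    (sqrt (1 - t ^ 2) ^ m * (f' t - INR m * t / (1 - t ^ 2) * f t)).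
Proof.
  intros Ht Hf. pose proof (strip_pos t Ht) as Hp. pose proof (sqrt_lt_R0 _ Hp) as Hr.
  eapply der_val.
  { apply (der_mul (fun s => sqrt (1 - s ^ 2) ^ m) f); [|exact Hf].
    apply (der_pow (fun s => sqrt (1 - s ^ 2)) m t). now apply is_derive_sqrt_1_m2. }
  assert (E : sqrt (1 - t ^ 2) * sqrt (1 - t ^ 2) = 1 - t ^ 2) by (apply sqrt_sqrt; lra).
  rewrite <- E at 5.
  set (s := sqrt (1 - t ^ 2)) in *.
  destruct m as [|m]; simpl Nat.pred.
  - simpl. field. lra.
  - change (s ^ S m) with (s * s ^ m). field. lra.
Qed.

(** The associated Legendre equation, in self-adjoint form. *)
Lemma legendre_ode l m t : -1 < t < 1 ->
  exists P' : R -> R,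
    (forall s, -1 < s < 1 -> is_derive (legendre l m) s (P' s)) /\
    is_derive (fun s => (1 - s ^ 2) * P' s) t
      (INR m ^ 2 / (1 - t ^ 2) * legendre l m t - INR l * (INR l + 1) * legendre l m t).
Proof.
  intros Ht.
  set (p := rodrigues l (l + m)).
  set (p1 := rodrigues l (S (l + m))). set (p2 := rodrigues l (S (S (l + m)))).
  set (P' := fun s => sqrt (1 - s ^ 2) ^ m * (p1 s - INR m * s / (1 - s ^ 2) * p s)).
  exists P'. split.
  - intros s Hs. apply (is_derive_ext (fun s => sqrt (1 - s ^ 2) ^ m * p s)).
    + intros u. now rewrite legendre_rodrigues.
    + apply (is_derive_weight m p p1 s Hs), is_derive_rodrigues.
  - apply (is_derive_ext_loc
      (fun s => sqrt (1 - s ^ 2) ^ m * ((1 - s ^ 2) * p1 s - INR m * (s * p s)))).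
    { apply (filter_imp (fun s => -1 < s < 1)); [|now apply locally_strip].
      intros s Hs. unfold P'. pose proof (strip_pos s Hs). match goal with |- @eq _ ?x ?y => change (@eq R x y) end. field. lra. }
    eapply der_val.
    { apply (is_derive_weight m (fun s => (1 - s ^ 2) * p1 s - INR m * (s * p s))
        (fun s => (-2 * s * p1 s + (1 - s ^ 2) * p2 s) - INR m * (1 * p s + s * p1 s)) t Ht).
      apply der_minus.
      - apply (der_mul (fun s => 1 - s ^ 2) p1);
          [apply der_1_minus_sq|apply is_derive_rodrigues].
      - apply der_scal.
        apply (der_mul (fun s => s) p);
          [apply der_id|apply is_derive_rodrigues]. }
    rewrite legendre_rodrigues. fold p.
    pose proof (rodrigues_ode l (S (l + m)) t) as E. simpl pred in E. fold p p1 p2 in E.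
    rewrite S_INR, plus_INR in E.
    pose proof (strip_pos t Ht).
    set (r := sqrt (1 - t ^ 2) ^ m).
    replace (p2 t) with
      ((2 * (INR m + 1) * (t * p1 t)
        + (INR l + INR m + 1) * (INR m - INR l) * p t) / (1 - t ^ 2)).
    { field. lra. }
    apply (Rmult_eq_reg_l (1 - t ^ 2)); [|lra].
    transitivity (2 * (INR m + 1) * (t * p1 t)
        + (INR l + INR m + 1) * (INR m - INR l) * p t); [field; lra|].
    lra.
Qed.

Lemma legendre_below m t : legendre m (S m) t = 0.
Proof.
  rewrite legendre_rodrigues. replace (m + S m)%nat with (S (2 * m)) by lia.
  rewrite rodrigues_high. ring.
Qed.

(** * Separated functions and spherical harmonics *)

Lemma strip_eq_refl f : strip_eq f f.
Proof. intros l m _. reflexivity. Qed.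

(** Functions with separated variables, zonal functions (independent of the
    longitude) and combinations of waves of frequencies [m] and [- m]. *)
Definition sep (u : R -> R) (E : R -> C) : chart_fun := fun l m => (RtoC (u m) * E l)%C.

Definition zonal (g : R -> R) : chart_fun := fun _ m => RtoC (g m).

Definition wave (m : nat) (A B : C) : R -> C :=
  fun l => (A * cis (INR m * l) + B * cis (- (INR m * l)))%C.

(** [P_l^m(mu) (A exp(i m lambda) + B exp(- i m lambda))]: a combination of [Y_lm] and
    [Y_l(-m)] without their normalization constants. *)
Definition Phi (l m : nat) (A B : C) : chart_fun := sep (legendre l m) (wave m A B).

Lemma cis_plus s t : cis (s + t) = (cis s * cis t)%C.
Proof. unfold cis, Cmult; simpl. rewrite cos_plus, sin_plus. f_equal; ring. Qed.

Lemma cis_opp_mul s : (cis s * cis (- s))%C = RtoC 1.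
Proof. rewrite <- cis_plus, Rplus_opp_r. unfold cis. now rewrite cos_0, sin_0. Qed.

Lemma smooth_zonal g : is_poly g -> smooth_on_sphere (zonal g).
Proof.
  intros Hg. rewrite smooth_extends. exists (fun _ _ z => g z), (cst3 0).
  repeat split; [now apply poly_smooth3|smooth3].
Qed.

(** [(1 - mu^2)^(m/2) exp(i m lambda)] is the [m]-th power of [x + i y]; [s = -1] gives
    the conjugate. *)
Lemma smooth_weight_cis m (s : R) : s = 1 \/ s = -1 ->
  smooth_on_sphere (fun l t => RtoC (sqrt (1 - t ^ 2) ^ m) * cis (s * (INR m * l)))%C.
Proof.
  intros Hs. induction m as [|m IH].
  - apply (smooth_ext (ccst (RtoC 1))); [|sphere].
    intros l t _. simpl. rewrite Rmult_0_l, Rmult_0_r. unfold cis, ccst.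
    rewrite cos_0, sin_0. unfold RtoC, Cmult; simpl. f_equal; ring.
  - assert (H1 : smooth_on_sphere (fun l t => RtoC (sqrt (1 - t ^ 2)) * cis (s * l))%C).
    { rewrite smooth_extends. exists pX, (mul3 (cst3 s) pY). repeat split; smooth3.
      intros l t _. unfold pull, pX, mul3, cst3, pY, cis, RtoC, Cmult; simpl.
      destruct Hs as [-> | ->].
      - rewrite Rmult_1_l. f_equal; ring.
      - replace (-1 * l) with (- l) by ring. rewrite cos_neg, sin_neg. f_equal; ring. }
    apply (smooth_ext (cmul (fun l t => RtoC (sqrt (1 - t ^ 2)) * cis (s * l))%C
      (fun l t => RtoC (sqrt (1 - t ^ 2) ^ m) * cis (s * (INR m * l)))%C)); [|sphere].
    intros l t _. unfold cmul. rewrite S_INR.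
    replace (s * ((INR m + 1) * l)) with (s * l + s * (INR m * l)) by ring.
    rewrite cis_plus. change (sqrt (1 - t ^ 2) ^ S m)
      with (sqrt (1 - t ^ 2) * sqrt (1 - t ^ 2) ^ m). rewrite RtoC_mult. ring.
Qed.

Lemma smooth_Phi l m A B : smooth_on_sphere (Phi l m A B).
Proof.
  pose proof (smooth_weight_cis m 1 (or_introl eq_refl)) as H1.
  pose proof (smooth_weight_cis m (-1) (or_intror eq_refl)) as H2.
  eapply smooth_ext;
    [|exact (smooth_mul _ _ (smooth_zonal _ (poly_rodrigues l (l + m)))
        (smooth_add _ _ (smooth_scal A _ H1) (smooth_scal B _ H2)))].
  intros x t _. unfold Phi, sep, wave, cmul, cadd, cscal, zonal.
  rewrite legendre_rodrigues, RtoC_mult, Rmult_1_l.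
  replace (-1 * (INR m * x)) with (- (INR m * x)) by ring. ring.
Qed.
#[local] Hint Resolve smooth_Phi : sphere.

Lemma CDerive_wave m A B l :
  CDerive (wave m A B) l = wave m (Ci * RtoC (INR m) * A) (- (Ci * RtoC (INR m) * B)) l.
Proof.
  destruct A as [a1 a2], B as [b1 b2]. unfold CDerive, wave, cis, Ci, RtoC, Cmult, Cplus, Copp.
  simpl fst; simpl snd. unfold Re, Im. simpl fst; simpl snd.
  set (k := INR m).
  f_equal; apply is_derive_unique; auto_derive; trivial; ring.
Qed.

Lemma d_lambda_sep u E l m :
  ex_derive (fun t => Re (E t)) l -> ex_derive (fun t => Im (E t)) l ->
  d_lambda (sep u E) l m = (RtoC (u m) * CDerive E l)%C.
Proof.
  intros H1 H2. unfold d_lambda.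
  change (fun t => sep u E t m) with (fun t => ((fun _ : R => RtoC (u m)) t * E t)%C).
  rewrite CDerive_mul; trivial.
  - unfold CDerive at 1. rewrite !Derive_const. change (0, 0) with (RtoC 0). ring.
  - apply (@ex_derive_const R_AbsRing R_NormedModule).
  - apply (@ex_derive_const R_AbsRing R_NormedModule).
Qed.

Lemma d_mu_sep u E l m u' : is_derive u m u' -> d_mu (sep u E) l m = (RtoC u' * E l)%C.
Proof.
  intros Hu. unfold d_mu, CDerive, sep, RtoC, Cmult; unfold Re, Im; simpl fst; simpl snd.
  f_equal; apply is_derive_unique.
  - eapply der_val; [apply der_minus; [apply der_scal_r, Hu|apply der_const]|]. ring.
  - eapply der_val; [apply der_plus; [apply der_scal_r, Hu|apply der_const]|]. ring.
Qed.

Lemma ex_derive_wave m A B l :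
  ex_derive (fun t => Re (wave m A B t)) l /\ ex_derive (fun t => Im (wave m A B t)) l.
Proof.
  destruct A as [a1 a2], B as [b1 b2]. unfold wave, cis, Cmult, Cplus.
  unfold Re, Im; simpl fst; simpl snd. set (k := INR m).
  split; auto_derive; trivial.
Qed.

Lemma d_lambda_Phi l m A B x t :
  d_lambda (Phi l m A B) x t
  = Phi l m (Ci * RtoC (INR m) * A) (- (Ci * RtoC (INR m) * B)) x t.
Proof.
  unfold Phi. destruct (ex_derive_wave m A B x).
  rewrite d_lambda_sep by assumption. now rewrite CDerive_wave.
Qed.

Lemma RtoC_m1 : RtoC (-1) = (- RtoC 1)%C.
Proof. now rewrite <- RtoC_opp. Qed.

Lemma Ci_sqr : (Ci * Ci)%C = RtoC (-1).
Proof. unfold Ci, Cmult, RtoC; simpl. f_equal; ring. Qed.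

Lemma laplacian_Phi l m A B :
  strip_eq (laplacian (Phi l m A B))
           (cscal (RtoC (- (INR l * (INR l + 1)))) (Phi l m A B)).
Proof.
  intros x t Ht. unfold laplacian. fold (d_mer (Phi l m A B)).
  destruct (legendre_ode l m t Ht) as (P' & D1 & D2).
  rewrite (d_mu_ext _ (sep (fun s => (1 - s ^ 2) * P' s) (wave m A B))); [| |exact Ht].
  2:{ intros y s Hs. unfold d_mer, Phi. rewrite (d_mu_sep _ _ _ _ _ (D1 s Hs)).
      unfold sep. rewrite RtoC_mult. ring. }
  rewrite (d_mu_sep _ _ _ _ _ D2).
  rewrite (d_lambda_ext _ _ (fun x t _ => d_lambda_Phi l m A B x t)) by exact Ht.
  rewrite d_lambda_Phi. unfold Phi, sep, wave, cscal.
  pose proof (strip_pos t Ht).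
  set (P := legendre l m t). set (k := INR m). set (e := cis (k * x)). set (e' := cis (- (k * x))).
  unfold Rdiv. rewrite RtoC_minus, !RtoC_mult.
  replace (RtoC (k ^ 2)) with (RtoC k * RtoC k)%C by (rewrite <- RtoC_mult; f_equal; ring).
  rewrite RtoC_opp, RtoC_mult.
  pose proof Ci_sqr as E. rewrite RtoC_m1 in E. ring [E].
Qed.

Lemma Delta_theta_Phi alpha l m A B :
  strip_eq (Delta_theta alpha (Phi l m A B))
           (cscal (RtoC (alpha ^ 2 + INR l * (INR l + 1))) (Phi l m A B)).
Proof.
  intros x t Ht. unfold Delta_theta. rewrite laplacian_Phi by exact Ht.
  unfold cscal. rewrite RtoC_opp, RtoC_plus. ring.
Qed.

(** Coefficients in [mu P_l^m = coef_up P_(l+1)^m + coef_down P_(l-1)^m]. *)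
Definition coef_up (l m : nat) : R := (INR l - INR m + 1) / (2 * INR l + 1).
Definition coef_down (l m : nat) : R := (INR l + INR m) / (2 * INR l + 1).

Lemma height_mul_Phi k m A B x t :
  cmul height (Phi (S k) m A B) x t
  = (RtoC (coef_up (S k) m) * Phi (S (S k)) m A B x t
     + RtoC (coef_down (S k) m) * Phi k m A B x t)%C.
Proof.
  unfold cmul, height, Phi, sep.
  rewrite !Cmult_assoc, <- !RtoC_mult, legendre_mul_mu.
  fold (coef_up (S k) m) (coef_down (S k) m). rewrite RtoC_plus. ring.
Qed.

(** ** Zonal functions *)

Lemma d_lambda_zonal g l m : d_lambda (zonal g) l m = RtoC 0.
Proof. apply (d_lambda_const (RtoC (g m)) l m). Qed.

Lemma d_mu_zonal g l m g' : is_derive g m g' -> d_mu (zonal g) l m = RtoC g'.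
Proof.
  intros Hg. unfold d_mu, CDerive, zonal, RtoC, Re, Im; simpl fst; simpl snd.
  f_equal; [now apply is_derive_unique|apply Derive_const].
Qed.

Lemma poisson_zonal g g' f : (forall t, is_derive g t (g' t)) ->
  strip_eq (poisson (zonal g) f) (cscal (RtoC (-1)) (cmul (zonal g') (d_lambda f))).
Proof.
  intros Hg l m _. unfold poisson. rewrite d_lambda_zonal, (d_mu_zonal _ _ _ _ (Hg m)).
  unfold cscal, cmul, zonal. rewrite RtoC_m1. ring.
Qed.

Lemma CRInt_RtoC u a b : ex_RInt u a b -> CRInt (fun t => RtoC (u t)) a b = RtoC (RInt u a b).
Proof.
  intros Hu. unfold RtoC at 1. rewrite (CRInt_pair u (fun _ => 0)).
  - rewrite RInt_const. unfold scal; simpl; unfold mult; simpl. now rewrite Rmult_0_r.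
  - exact Hu.
  - apply (ex_RInt_const (V := R_NormedModule)).
Qed.

Lemma sphere_int_zonal g : is_poly g -> sphere_int (zonal g) = RtoC (2 * PI * RInt g (-1) 1).
Proof.
  intros Hg. unfold sphere_int, zonal.
  assert (Cg : ex_RInt g (-1) 1).
  { apply (ex_RInt_continuous (V := R_CompleteNormedModule)). intros t _.
    apply (ex_derive_continuous (V := R_NormedModule)). eexists. now apply poly_is_derive. }
  transitivity (CRInt (fun m => RtoC (scal (2 * PI) (g m))) (-1) 1).
  - apply CRInt_ext; [lra|]. intros m _.
    rewrite (CRInt_RtoC (fun _ => g m)).
    + rewrite RInt_const. now rewrite Rminus_0_r.
    + apply (ex_RInt_const (V := R_NormedModule)).
  - rewrite CRInt_RtoC by now apply (@ex_RInt_scal R_NormedModule).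
    now rewrite (RInt_scal (V := R_CompleteNormedModule)).
Qed.

(** ** Orthogonality and norms *)

(** Eigenfunctions with different eigenvalues are orthogonal. *)
Lemma pairing_eigen_orthogonal f g (c d : R) :
  smooth_on_sphere f -> smooth_on_sphere g ->
  strip_eq (laplacian f) (cscal (RtoC c) f) -> strip_eq (laplacian g) (cscal (RtoC d) g) ->
  c <> d -> pairing f g = RtoC 0.
Proof.
  intros Hf Hg Ef Eg Hcd.
  pose proof (laplacian_self_adjoint f g Hf Hg) as E.
  rewrite (pairing_ext _ _ g g Ef (strip_eq_refl _)) in E.
  rewrite (pairing_ext f f _ _ (strip_eq_refl _) Eg) in E.
  rewrite pairing_scal_l, pairing_scal_r in E by assumption.
  set (z := pairing f g) in *.
  assert (E' : (RtoC (c - d) * z)%C = RtoC 0).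
  { rewrite RtoC_minus. transitivity (RtoC c * z - RtoC d * z)%C; [ring|]. rewrite E. ring. }
  destruct (Ceq_dec z (RtoC 0)) as [|Hz]; [assumption|exfalso].
  apply (Cmult_neq_0 (RtoC (c - d)) z); trivial.
  intros e. injection e. lra.
Qed.

Lemma pairing_Phi_orthogonal i j m A B A' B' : i <> j ->
  pairing (Phi i m A B) (Phi j m A' B') = RtoC 0.
Proof.
  intros Hij.
  apply (pairing_eigen_orthogonal _ _ _ _ (smooth_Phi i m A B) (smooth_Phi j m A' B')
           (laplacian_Phi i m A B) (laplacian_Phi j m A' B')).
  pose proof (pos_INR i). pose proof (pos_INR j).
  assert (INR i <> INR j) by (intros e; apply Hij, INR_eq, e).
  intros e. assert (Z : (INR i - INR j) * (INR i + INR j + 1) = 0) by lra.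
  apply Rmult_integral in Z. lra.
Qed.

(** A function on which [d/dlambda] acts by a non-zero scalar is isotropic. *)
Lemma pairing_rotation_null f c : smooth_on_sphere f ->
  strip_eq (d_lambda f) (cscal c f) -> c <> RtoC 0 -> pairing f f = RtoC 0.
Proof.
  intros Hf Ef Hc.
  pose proof (pairing_d_lambda f f Hf Hf) as E.
  rewrite (pairing_ext _ _ f f Ef (strip_eq_refl _)) in E.
  rewrite (pairing_ext f f _ _ (strip_eq_refl _) Ef) in E.
  rewrite pairing_scal_l, pairing_scal_r in E by assumption.
  set (z := pairing f f) in *.
  destruct (Ceq_dec z (RtoC 0)) as [|Hz]; [assumption|exfalso].
  assert (E2 : (RtoC 2 * c * z)%C = RtoC 0).
  { replace (RtoC 2) with (RtoC 1 + RtoC 1)%C by (rewrite <- RtoC_plus; f_equal; ring).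
    transitivity (c * z + c * z)%C; [ring|]. rewrite E at 1. rewrite RtoC_m1. ring. }
  assert (N2 : RtoC 2 <> RtoC 0) by (intros e; injection e; lra).
  revert E2. repeat apply Cmult_neq_0; assumption.
Qed.

Lemma Phi_linear l m A B :
  strip_eq (Phi l m A B)
    (cadd (cscal A (Phi l m (RtoC 1) (RtoC 0))) (cscal B (Phi l m (RtoC 0) (RtoC 1)))).
Proof. intros x t _. unfold Phi, sep, wave, cadd, cscal. ring. Qed.

Lemma pairing_Phi_null l m A B : (1 <= m)%nat -> A = RtoC 0 \/ B = RtoC 0 ->
  pairing (Phi l m A B) (Phi l m A B) = RtoC 0.
Proof.
  intros Hm HAB.
  assert (Nm : RtoC (INR m) <> RtoC 0) by (intros e; injection e; apply not_0_INR; lia).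
  assert (Ni : Ci <> RtoC 0) by (intros e; injection e; lra).
  destruct HAB as [-> | ->].
  - apply (pairing_rotation_null _ (RtoC (-1) * (Ci * RtoC (INR m)))%C (smooth_Phi _ _ _ _)).
    + intros x t _. rewrite d_lambda_Phi. unfold Phi, sep, wave, cscal. rewrite RtoC_m1. ring.
    + apply Cmult_neq_0; [intros e; injection e; lra|now apply Cmult_neq_0].
  - apply (pairing_rotation_null _ (Ci * RtoC (INR m))%C (smooth_Phi _ _ _ _)).
    + intros x t _. rewrite d_lambda_Phi. unfold Phi, sep, wave, cscal. ring.
    + now apply Cmult_neq_0.
Qed.

(** The integral of the square of [P_l^m] over the interval from [-1] to [1]. *)
Definition legendre_norm (l m : nat) : R :=
  2 / (2 * INR l + 1) * (INR (fact (l + m)) / INR (fact (l - m))).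

Lemma wallis m :
  RInt (fun t => (1 - t ^ 2) ^ S m) (-1) 1
  = (2 * INR m + 2) / (2 * INR m + 3) * RInt (fun t => (1 - t ^ 2) ^ m) (-1) 1.
Proof.
  pose proof (pos_INR m) as Hm.
  assert (D : forall t, is_derive (fun t => (1 - t ^ 2) ^ m) t
                (INR m * (-2 * t) * (1 - t ^ 2) ^ pred m)).
  { intros t. apply (der_pow (fun s => 1 - s ^ 2)), der_1_minus_sq. }
  assert (Cm : forall t, continuous (fun t => (1 - t ^ 2) ^ m) t).
  { intros t. apply (ex_derive_continuous (V := R_NormedModule)). eexists; apply D. }
  assert (DS : forall t, is_derive (fun t => (1 - t ^ 2) ^ S m) t
                (INR (S m) * (-2 * t) * (1 - t ^ 2) ^ m)).
  { intros t. apply (der_pow (fun s => 1 - s ^ 2) (S m)), der_1_minus_sq. }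
  assert (CS : forall t, continuous (fun t => (1 - t ^ 2) ^ S m) t).
  { intros t. apply (ex_derive_continuous (V := R_NormedModule)). eexists; apply DS. }
  (* derivative of t (1 - t^2)^(m+1) *)
  assert (F : RInt (fun t => (2 * INR m + 3) * (1 - t ^ 2) ^ S m
                    - (2 * INR m + 2) * (1 - t ^ 2) ^ m) (-1) 1 = 0).
  { rewrite (RInt_derive_open (fun t => t * (1 - t ^ 2) ^ S m)).
    - simpl. ring.
    - lra.
    - intros t. apply (continuous_minus (V := R_NormedModule));
        apply (continuous_scal_r (V := R_NormedModule)); auto.
    - intros t. apply (continuous_mult (K := R_AbsRing)); [apply continuous_id|auto].
    - intros t _. eapply der_val; [apply der_mul; [apply der_id|apply DS]|].
      rewrite S_INR. simpl. ring. }
  assert (X : forall n, (forall t, continuous (fun t => (1 - t ^ 2) ^ n) t) ->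
     ex_RInt (fun t => (1 - t ^ 2) ^ n) (-1) 1).
  { intros n Hn. apply (ex_RInt_continuous (V := R_CompleteNormedModule)). auto. }
  specialize (X m Cm) as X1. specialize (X (S m) CS) as X2.
  change (RInt (fun t => minus (scal (2 * INR m + 3) ((1 - t ^ 2) ^ S m))
                  (scal (2 * INR m + 2) ((1 - t ^ 2) ^ m))) (-1) 1 = 0) in F.
  rewrite (RInt_minus (V := R_CompleteNormedModule)), !(RInt_scal (V := R_CompleteNormedModule))
    in F; try assumption; try (now apply (@ex_RInt_scal R_NormedModule)).
  unfold minus, plus, opp, scal in F; simpl in F; unfold mult in F; simpl in F.
  apply (Rmult_eq_reg_l (2 * INR m + 3)); [|lra].
  simpl. simpl in F.
  transitivity ((2 * INR m + 2) * RInt (fun t => (1 - t * (t * 1)) ^ m) (-1) 1); [lra|].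
  field. lra.
Qed.

Lemma rodrigues_top_const m t : rodrigues m (2 * m) t = rodrigues m (2 * m) 0.
Proof.
  induction m as [|m IH].
  - rewrite !rodrigues_0. reflexivity.
  - rewrite !rodrigues_top. now rewrite IH.
Qed.

Lemma legendre_norm_base m :
  rodrigues m (2 * m) 0 ^ 2 * RInt (fun t => (1 - t ^ 2) ^ m) (-1) 1 = legendre_norm m m.
Proof.
  induction m as [|m IH].
  - unfold legendre_norm. rewrite rodrigues_0. simpl.
    rewrite RInt_const. unfold scal; simpl; unfold mult; simpl. field.
  - rewrite rodrigues_top, wallis. pose proof (pos_INR m) as Hm.
    transitivity ((2 * INR m + 1) ^ 2 * ((2 * INR m + 2) / (2 * INR m + 3))
      * (rodrigues m (2 * m) 0 ^ 2 * RInt (fun t => (1 - t ^ 2) ^ m) (-1) 1)); [ring|].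
    rewrite IH. unfold legendre_norm.
    rewrite !Nat.sub_diag. change (INR (fact 0)) with 1.
    replace (S m + S m)%nat with (S (S (m + m))) by lia.
    rewrite (fact_simpl (S (m + m))), (fact_simpl (m + m)), !mult_INR, !S_INR, plus_INR.
    field. lra.
Qed.

(** Ratio of consecutive norms, in the form given by the symmetry of the
    multiplication by [mu]. *)
Lemma legendre_norm_step l m : (1 <= m <= l)%nat ->
  coef_up l m * legendre_norm (S l) m = coef_down (S l) m * legendre_norm l m.
Proof.
  intros [Hm Hl]. unfold coef_up, coef_down, legendre_norm.
  replace (S l - m)%nat with (S (l - m)) by lia.
  replace (S l + m)%nat with (S (l + m)) by lia.
  rewrite !fact_simpl, !mult_INR, !S_INR, minus_INR, plus_INR by lia.
  pose proof (INR_fact_lt_0 (l - m)). pose proof (INR_fact_lt_0 (l + m)).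
  pose proof (pos_INR m). pose proof (le_INR _ _ Hl).
  field. lra.
Qed.

Lemma coef_up_neq_0 l m : (m <= l)%nat -> coef_up l m <> 0.
Proof.
  intros Hl. pose proof (pos_INR l). pose proof (le_INR _ _ Hl). unfold coef_up, Rdiv.
  apply Rmult_integral_contrapositive_currified; [lra|].
  apply Rinv_neq_0_compat. lra.
Qed.

Lemma pairing_height f g : pairing (cmul height f) g = pairing f (cmul height g).
Proof.
  rewrite !pairingE. apply sphere_int_ext. intros l m _. unfold cmul. ring.
Qed.

(** The norms are propagated from [l = m] by pairing [mu P_l^m] with [P_(l+1)^m]. *)
Lemma pairing_Phi_basis l m : (1 <= m <= l)%nat ->
  pairing (Phi l m (RtoC 1) (RtoC 0)) (Phi l m (RtoC 0) (RtoC 1))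
  = RtoC (2 * PI * legendre_norm l m).
Proof.
  intros [Hm Hl]. induction Hl as [|l Hl IH].
  - rewrite pairingE.
    rewrite (sphere_int_ext _ (zonal (fun t => rodrigues m (2 * m) 0 ^ 2 * (1 - t ^ 2) ^ m))).
    + rewrite sphere_int_zonal.
      * rewrite <- legendre_norm_base.
        rewrite (RInt_scal (V := R_CompleteNormedModule) (fun t => (1 - t ^ 2) ^ m)).
        -- reflexivity.
        -- apply (ex_RInt_continuous (V := R_CompleteNormedModule)). intros t _.
           apply (ex_derive_continuous (V := R_NormedModule)). eexists.
           apply (der_pow (fun s => 1 - s ^ 2)), der_1_minus_sq.
      * apply (poly_mul (fun _ => rodrigues m (2 * m) 0 ^ 2)); [apply poly_const|].
        apply poly_pow.
        apply (poly_add (fun _ => 1) (fun t => - t ^ 2)); [apply poly_const|].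
        replace (fun t : R => - t ^ 2) with (fun t : R => -1 * t ^ 2)
          by (apply functional_extensionality; intros; ring).
        apply (poly_mul (fun _ => -1)); [apply poly_const|]. apply poly_pow, poly_id.
    + intros x t Ht. unfold cmul, Phi, sep, wave, zonal.
      pose proof (strip_pos t Ht).
      replace (rodrigues m (2 * m) 0 ^ 2 * (1 - t ^ 2) ^ m)
        with (legendre m m t * legendre m m t).
      * rewrite RtoC_mult.
        transitivity (RtoC (legendre m m t) * RtoC (legendre m m t)
           * (cis (INR m * x) * cis (- (INR m * x))))%C; [ring|].
        rewrite cis_opp_mul. ring.
      * rewrite legendre_rodrigues. replace (m + m)%nat with (2 * m)%nat by lia.
        rewrite rodrigues_top_const.
        replace ((1 - t ^ 2) ^ m) with (sqrt (1 - t ^ 2) ^ m * sqrt (1 - t ^ 2) ^ m); [ring|].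
        rewrite <- Rpow_mult_distr, sqrt_sqrt by lra. reflexivity.
  - destruct l as [|k]; [lia|].
    set (F := fun j => Phi j m (RtoC 1) (RtoC 0)).
    set (G := fun j => Phi j m (RtoC 0) (RtoC 1)).
    pose proof (pairing_height (F (S k)) (G (S (S k)))) as E.
    rewrite (pairing_ext (cmul height (F (S k))) (cadd (cscal (RtoC (coef_up (S k) m)) (F (S (S k))))
       (cscal (RtoC (coef_down (S k) m)) (F k))) (G (S (S k))) (G (S (S k)))) in E.
    2:{ intros x t _. apply height_mul_Phi. }
    2:{ apply strip_eq_refl. }
    rewrite (pairing_ext (F (S k)) (F (S k)) (cmul height (G (S (S k))))
       (cadd (cscal (RtoC (coef_up (S (S k)) m)) (G (S (S (S k)))))
       (cscal (RtoC (coef_down (S (S k)) m)) (G (S k))))) in E.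
    2:{ apply strip_eq_refl. }
    2:{ intros x t _. apply height_mul_Phi. }
    unfold F, G in E.
    rewrite pairing_add_l, pairing_add_r, !pairing_scal_l, !pairing_scal_r in E by sphere.
    rewrite (pairing_Phi_orthogonal k (S (S k))), (pairing_Phi_orthogonal (S k) (S (S (S k))))
      in E by lia.
    rewrite IH in E.
    pose proof (legendre_norm_step (S k) m (conj Hm Hl)) as N.
    pose proof (coef_up_neq_0 (S k) m Hl) as U.
    set (z := pairing (Phi (S (S k)) m (RtoC 1) (RtoC 0)) (Phi (S (S k)) m (RtoC 0) (RtoC 1))) in *.
    replace (2 * PI * legendre_norm (S (S k)) m)
      with (2 * PI * (coef_up (S k) m * legendre_norm (S (S k)) m) / coef_up (S k) m)
      by (field; exact U).
    rewrite N.
    assert (Uc : RtoC (coef_up (S k) m) <> RtoC 0) by (intros e; apply U; now injection e).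
    unfold Rdiv. rewrite RtoC_mult, RtoC_inv by exact U.
    apply (f_equal (fun w => (w * / RtoC (coef_up (S k) m))%C)) in E.
    transitivity ((RtoC (coef_up (S k) m) * z + RtoC (coef_down (S k) m) * RtoC 0)
       * / RtoC (coef_up (S k) m))%C; [field; exact Uc|].
    rewrite E. rewrite !RtoC_mult. ring.
Qed.

Lemma pairing_Phi l m A B A' B' : (1 <= m <= l)%nat ->
  pairing (Phi l m A B) (Phi l m A' B')
  = (RtoC (2 * PI * legendre_norm l m) * (A * B' + B * A'))%C.
Proof.
  intros H.
  rewrite (pairing_ext _ _ _ _ (Phi_linear l m A B) (Phi_linear l m A' B')).
  rewrite !pairing_add_l, !pairing_add_r, !pairing_scal_l, !pairing_scal_r by sphere.
  rewrite (pairing_sym (Phi l m (RtoC 0) (RtoC 1)) (Phi l m (RtoC 1) (RtoC 0))).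
  rewrite !pairing_Phi_null, pairing_Phi_basis by (auto; lia).
  ring.
Qed.

(** The mode [P_(m-1)^m] is zero, so that Bonnet's recursion at [l = m] has no lower
    term. *)
Lemma Phi_below m A B : strip_eq (Phi m (S m) A B) (cscal (RtoC 0) (ccst (RtoC 0))).
Proof.
  intros x t _. unfold Phi, sep, cscal, ccst. rewrite legendre_below. ring.
Qed.

(** * The inner product of the central extension *)

Lemma Delta_theta_ext alpha f g : strip_eq f g ->
  strip_eq (Delta_theta alpha f) (Delta_theta alpha g).
Proof.
  intros E l m Hm. unfold Delta_theta. now rewrite (laplacian_ext f g E), E.
Qed.

Lemma Delta_theta_scal alpha c f : smooth_on_sphere f ->
  strip_eq (Delta_theta alpha (cscal c f)) (cscal c (Delta_theta alpha f)).
Proof.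
  intros Hf l m Hm. unfold Delta_theta. rewrite laplacian_scal by assumption.
  unfold cscal. ring.
Qed.

Lemma Delta_theta_add alpha f g : smooth_on_sphere f -> smooth_on_sphere g ->
  strip_eq (Delta_theta alpha (cadd f g)) (cadd (Delta_theta alpha f) (Delta_theta alpha g)).
Proof.
  intros Hf Hg l m Hm. unfold Delta_theta. rewrite laplacian_add by assumption.
  unfold cadd. ring.
Qed.

Lemma inner_eq alpha X Y : smooth_on_sphere (fst X) -> smooth_on_sphere (fst Y) ->
  inner alpha X Y = (pairing (fst X) (Delta_theta alpha (fst Y)) + snd X * snd Y)%C.
Proof. intros HX HY. unfold inner. now rewrite Delta_theta_self_adjoint. Qed.

Lemma inner_gsub alpha X Y Z :
  smooth_on_sphere (fst X) -> smooth_on_sphere (fst Y) -> smooth_on_sphere (fst Z) ->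
  inner alpha (gsub X Y) Z = (inner alpha X Z - inner alpha Y Z)%C.
Proof.
  intros HX HY HZ.
  assert (S : smooth_on_sphere (fst (gsub X Y)))
    by exact (smooth_add _ _ HX (smooth_scal (RtoC (-1)) _ HY)).
  rewrite !inner_eq by assumption.
  change (fst (gsub X Y)) with (cadd (fst X) (cscal (RtoC (-1)) (fst Y))).
  rewrite pairing_add_l, pairing_scal_l by sphere.
  unfold gsub, gadd, gscale; simpl snd. ring.
Qed.

Lemma smooth_gsub X Y : smooth_on_sphere (fst X) -> smooth_on_sphere (fst Y) ->
  smooth_on_sphere (fst (gsub X Y)).
Proof. intros HX HY. exact (smooth_add _ _ HX (smooth_scal (RtoC (-1)) _ HY)). Qed.

Lemma inner_bracket_antisym alpha X Y Z :
  smooth_on_sphere (fst X) -> smooth_on_sphere (fst Y) -> smooth_on_sphere (fst Z) ->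
  inner alpha (bracket X Y) Z = (- inner alpha (bracket Y X) Z)%C.
Proof.
  intros HX HY HZ. rewrite !inner_eq by (try assumption; now apply smooth_poisson).
  unfold bracket; simpl fst; simpl snd. unfold Omega.
  fold height.
  rewrite (pairing_ext _ _ _ _ (poisson_antisym (fst X) (fst Y)) (strip_eq_refl _)).
  rewrite (pairing_ext height height _ _ (strip_eq_refl _) (poisson_antisym (fst X) (fst Y))).
  rewrite pairing_scal_l, pairing_scal_r by sphere. rewrite RtoC_m1. ring.
Qed.

Lemma poisson_zonal_zonal g1 g2 f1 f2 :
  (forall t, is_derive g1 t (f1 t)) -> (forall t, is_derive g2 t (f2 t)) ->
  strip_eq (poisson (zonal g1) (zonal g2)) (cscal (RtoC 0) (zonal g1)).
Proof.
  intros H1 H2 l m _. unfold poisson.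
  rewrite !d_lambda_zonal, (d_mu_zonal _ _ _ _ (H1 m)), (d_mu_zonal _ _ _ _ (H2 m)).
  unfold cscal. ring.
Qed.

(** * Brackets with the zonal direction *)

(** The zonal profile [k mu^2] of the first direction. *)
Definition quad (k : R) : R -> R := fun t => k * t ^ 2.

(** [Delta_theta (k mu^2) + a mu], with its derivative. *)
Definition potential (alpha a k : R) : R -> R :=
  fun t => k * (alpha ^ 2 + 6) * t ^ 2 + (a * t + - (2 * k)).
Definition potential' (alpha a k : R) : R -> R := fun t => 2 * k * (alpha ^ 2 + 6) * t + a.

Lemma der_quad k t : is_derive (quad k) t (2 * k * t).
Proof.
  eapply der_val; [apply der_scal, (der_pow (fun s => s) 2 t 1), der_id|]. simpl. ring.
Qed.

Lemma der_potential alpha a k t : is_derive (potential alpha a k) t (potential' alpha a k t).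
Proof.
  eapply der_val.
  - apply der_plus; [apply (der_quad (k * (alpha ^ 2 + 6)))|].
    apply der_plus; [apply der_scal, der_id|apply der_const].
  - unfold potential'. ring.
Qed.

Lemma poly_quad k : is_poly (quad k).
Proof. apply (poly_mul (fun _ => k)); [apply poly_const|apply poly_pow, poly_id]. Qed.

Lemma poly_potential alpha a k : is_poly (potential alpha a k).
Proof.
  apply poly_add; [apply (poly_quad (k * (alpha ^ 2 + 6)))|].
  apply poly_add; [|apply poly_const].
  apply (poly_mul (fun _ => a)); [apply poly_const|apply poly_id].
Qed.

Lemma poly_potential' alpha a k : is_poly (potential' alpha a k).
Proof.
  apply poly_add; [|apply poly_const].
  apply (poly_mul (fun _ => 2 * k * (alpha ^ 2 + 6))); [apply poly_const|apply poly_id].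
Qed.

Lemma smooth_quad k : smooth_on_sphere (zonal (quad k)).
Proof. apply smooth_zonal, poly_quad. Qed.
Lemma smooth_potential alpha a k : smooth_on_sphere (zonal (potential alpha a k)).
Proof. apply smooth_zonal, poly_potential. Qed.
Lemma smooth_potential' alpha a k : smooth_on_sphere (zonal (potential' alpha a k)).
Proof. apply smooth_zonal, poly_potential'. Qed.
#[local] Hint Resolve smooth_quad smooth_potential smooth_potential' : sphere.

Lemma laplacian_quad k l m : -1 < m < 1 ->
  laplacian (zonal (quad k)) l m = RtoC (2 * k - 6 * k * m ^ 2).
Proof.
  intros Hm. unfold laplacian. fold (d_mer (zonal (quad k))).
  rewrite (d_mu_ext _ (zonal (fun t => (1 - t ^ 2) * (2 * k * t)))); [| |exact Hm].
  2:{ intros x t _. unfold d_mer. rewrite (d_mu_zonal _ _ _ _ (der_quad k t)).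
      unfold zonal. now rewrite <- RtoC_mult. }
  rewrite (d_mu_zonal _ _ _ ((- 2 * m) * (2 * k * m) + (1 - m ^ 2) * (2 * k * 1))).
  2:{ apply (der_mul (fun t => 1 - t ^ 2) (fun t => 2 * k * t));
        [apply der_1_minus_sq|apply der_scal, der_id]. }
  rewrite (d_lambda_ext _ (ccst (RtoC 0))); [| |exact Hm].
  2:{ intros x t _. apply d_lambda_zonal. }
  rewrite d_lambda_const, Cmult_0_r, Cplus_0_r. f_equal. ring.
Qed.

Lemma Delta_theta_quad alpha a k :
  strip_eq (cadd (Delta_theta alpha (zonal (quad k))) (cscal (RtoC a) height))
           (zonal (potential alpha a k)).
Proof.
  intros l m Hm. unfold cadd, Delta_theta. rewrite laplacian_quad by exact Hm.
  unfold zonal, quad, potential, cscal, height.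
  rewrite <- !RtoC_mult, <- RtoC_minus, <- RtoC_plus. f_equal. ring.
Qed.

(** The inner product with [xi], cocycle included, is the pairing with
    [Delta_theta (k mu^2) + a mu]. *)
Lemma inner_bracket_xi alpha a k X Y :
  smooth_on_sphere (fst X) -> smooth_on_sphere (fst Y) ->
  inner alpha (bracket X Y) (zonal (quad k), RtoC a)
  = pairing (poisson (fst X) (fst Y)) (zonal (potential alpha a k)).
Proof.
  intros HX HY. rewrite inner_eq by (simpl; sphere).
  unfold bracket; simpl fst; simpl snd. unfold Omega. fold height.
  rewrite (pairing_sym height), Cmult_comm.
  rewrite <- pairing_scal_r, <- pairing_add_r by sphere.
  apply pairing_ext; [apply strip_eq_refl|apply Delta_theta_quad].
Qed.

(** Two zonal functions Poisson-commute, so brackets with [xi] are orthogonal to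
    [xi]. *)
Lemma inner_bracket_xi_xi alpha a k W : smooth_on_sphere (fst W) ->
  inner alpha (bracket (zonal (quad k), RtoC a) W) (zonal (quad k), RtoC a) = RtoC 0.
Proof.
  intros HW. rewrite inner_bracket_antisym by (simpl; sphere).
  rewrite inner_bracket_xi by (simpl; sphere). simpl fst.
  rewrite pairing_poisson by sphere.
  rewrite (pairing_ext _ _ _ _ (strip_eq_refl _)
    (poisson_zonal_zonal _ _ _ _ (der_quad k) (der_potential alpha a k))).
  rewrite pairing_scal_r by sphere. ring.
Qed.

Lemma inner_bracket_zonal_self alpha a b k W : smooth_on_sphere (fst W) ->
  inner alpha (bracket (zonal (quad k), a) (zonal (quad k), b)) W = RtoC 0.
Proof.
  intros HW. rewrite inner_eq by (simpl; sphere).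
  unfold bracket; simpl fst; simpl snd. unfold Omega. fold height.
  pose proof (poisson_zonal_zonal _ _ _ _ (der_quad k) (der_quad k)) as E.
  rewrite (pairing_ext _ _ _ _ E (strip_eq_refl _)),
    (pairing_ext height height _ _ (strip_eq_refl _) E).
  rewrite pairing_scal_l, pairing_scal_r by sphere. ring.
Qed.

Lemma Omega_zonal k f : smooth_on_sphere f -> Omega (zonal (quad k)) f = RtoC 0.
Proof.
  intros Hf. unfold Omega. fold height.
  rewrite pairing_sym.
  rewrite (pairing_ext _ _ _ _ (poisson_antisym (zonal (quad k)) f) (strip_eq_refl _)).
  rewrite pairing_scal_l, pairing_poisson by sphere.
  assert (E : strip_eq (poisson (zonal (quad k)) height) (cscal (RtoC 0) height)).
  { intros l m Hm. rewrite poisson_height by exact Hm. rewrite d_lambda_zonal.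
    unfold cscal. ring. }
  rewrite (pairing_ext _ _ _ _ (strip_eq_refl _) E), pairing_scal_r by sphere. ring.
Qed.

Lemma inner_xi_xi alpha a k :
  inner alpha (zonal (quad k), RtoC a) (zonal (quad k), RtoC a)
  = RtoC (32 * PI / 15 * k ^ 2 * (3 / 8 * alpha ^ 2 + 1) + a ^ 2).
Proof.
  rewrite inner_eq by (simpl; sphere). simpl fst; simpl snd.
  set (c1 := k ^ 2 * (alpha ^ 2 + 6)). set (c2 := 2 * k ^ 2).
  rewrite pairingE, (sphere_int_ext _ (zonal (fun t => c1 * t ^ 4 + (- c2) * t ^ 2))).
  2:{ intros l m Hm. unfold cmul, Delta_theta. rewrite laplacian_quad by exact Hm.
      unfold zonal, quad. rewrite <- !RtoC_mult, <- RtoC_minus, <- RtoC_mult.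
      f_equal. unfold c1, c2. ring. }
  rewrite sphere_int_zonal.
  2:{ apply poly_add; [apply (poly_mul (fun _ => c1)); [apply poly_const|apply poly_pow, poly_id]|].
      apply (poly_mul (fun _ => - c2)); [apply poly_const|apply poly_pow, poly_id]. }
  assert (DG : forall t, is_derive (fun t => c1 / 5 * t ^ 5 + - c2 / 3 * t ^ 3) t
                  (c1 * t ^ 4 + - c2 * t ^ 2)).
  { intros t. eapply der_val.
    - apply der_plus; apply der_scal.
      + apply (der_pow (fun s => s) 5 t 1), der_id.
      + apply (der_pow (fun s => s) 3 t 1), der_id.
    - simpl. field. }
  rewrite (RInt_derive_open (fun t => c1 / 5 * t ^ 5 + - c2 / 3 * t ^ 3)).
  - rewrite <- RtoC_mult, <- RtoC_plus. f_equal. unfold c1, c2. field.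
  - lra.
  - intros t. apply (ex_derive_continuous (V := R_NormedModule)).
    eexists. apply der_plus; apply der_scal.
    + apply (der_pow (fun s => s) 4 t 1), der_id.
    + apply (der_pow (fun s => s) 2 t 1), der_id.
  - intros t. apply (ex_derive_continuous (V := R_NormedModule)). eexists; apply DG.
  - intros t _. apply DG.
Qed.

(** * The curvature of the plane spanned by the two directions *)

(** The eigenvalue of [Delta_theta] on [Y_jm]. *)
Definition theta_ev (alpha : R) (j : nat) : R := alpha ^ 2 + INR j * (INR j + 1).

(** The coefficients of the longitude derivative of a wave: multiplication by [i m]
    and by [- i m]. *)
Definition dcoef1 (m : nat) (A : C) : C := (Ci * RtoC (INR m) * A)%C.
Definition dcoef2 (m : nat) (B : C) : C := (- (Ci * RtoC (INR m) * B))%C.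

(** The mode [P_j^m E'], with [E'] the derivative of the wave [E] of [eta].  From here
    on the degree of [eta] is written [p + 1]. *)
Definition dPhi (m : nat) (A B : C) (j : nat) : chart_fun :=
  Phi j m (dcoef1 m A) (dcoef2 m B).

(** The expansion of [mu d_lambda eta] in modes. *)
Definition mu_dPhi (p m : nat) (A B : C) : chart_fun :=
  cadd (cscal (RtoC (coef_up (S p) m)) (dPhi m A B (S (S p))))
       (cscal (RtoC (coef_down (S p) m)) (dPhi m A B p)).

Lemma smooth_dPhi m A B j : smooth_on_sphere (dPhi m A B j).
Proof. apply smooth_Phi. Qed.
#[local] Hint Resolve smooth_dPhi : sphere.
Lemma smooth_mu_dPhi p m A B : smooth_on_sphere (mu_dPhi p m A B).
Proof. unfold mu_dPhi. sphere. Qed.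
#[local] Hint Resolve smooth_mu_dPhi : sphere.

Lemma height_d_lambda_Phi p m A B x t :
  (RtoC t * d_lambda (Phi (S p) m A B) x t)%C = mu_dPhi p m A B x t.
Proof. rewrite d_lambda_Phi. apply height_mul_Phi. Qed.

Lemma poisson_quad_Phi k p m A B :
  strip_eq (poisson (zonal (quad k)) (Phi (S p) m A B))
           (cscal (RtoC (- (2 * k))) (mu_dPhi p m A B)).
Proof.
  intros x t Ht. rewrite (poisson_zonal _ _ _ (der_quad k)) by exact Ht.
  unfold cscal at 1, cmul at 1, zonal. rewrite RtoC_mult.
  unfold cscal at 1. rewrite <- height_d_lambda_Phi, RtoC_m1, RtoC_opp. ring.
Qed.

Lemma poisson_Phi_potential alpha a k p m A B :
  strip_eq (poisson (Phi (S p) m A B) (zonal (potential alpha a k)))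
    (cadd (cscal (RtoC (2 * k * (alpha ^ 2 + 6))) (mu_dPhi p m A B))
          (cscal (RtoC a) (dPhi m A B (S p)))).
Proof.
  intros x t Ht. rewrite poisson_antisym by exact Ht. unfold cscal at 1.
  rewrite (poisson_zonal _ _ _ (der_potential alpha a k)) by exact Ht.
  unfold cscal at 1, cmul at 1, zonal, potential'. rewrite RtoC_plus, RtoC_mult.
  unfold cadd, cscal. rewrite <- height_d_lambda_Phi, d_lambda_Phi, RtoC_m1.
  unfold dPhi, dcoef1, dcoef2. ring.
Qed.

Lemma pairing_mu_dPhi p m A B y : smooth_on_sphere y ->
  pairing y (mu_dPhi p m A B)
  = (RtoC (coef_up (S p) m) * pairing y (dPhi m A B (S (S p)))
     + RtoC (coef_down (S p) m) * pairing y (dPhi m A B p))%C.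
Proof. intros Hy. unfold mu_dPhi. now rewrite pairing_add_r, !pairing_scal_r by sphere. Qed.

Lemma Delta_theta_mu_dPhi alpha p m A B :
  strip_eq (Delta_theta alpha (mu_dPhi p m A B))
    (cadd (cscal (RtoC (coef_up (S p) m * theta_ev alpha (S (S p)))) (dPhi m A B (S (S p))))
          (cscal (RtoC (coef_down (S p) m * theta_ev alpha p)) (dPhi m A B p))).
Proof.
  intros x t Ht. unfold mu_dPhi. rewrite Delta_theta_add by sphere.
  unfold cadd at 1. rewrite !Delta_theta_scal by sphere.
  unfold cscal at 1, cscal at 1. unfold dPhi at 1 2. rewrite !Delta_theta_Phi by exact Ht.
  unfold cadd, cscal, theta_ev, dPhi. rewrite !RtoC_mult. ring.
Qed.

Lemma inner_bracket_eta_xi alpha a k p m A B Y : smooth_on_sphere (fst Y) ->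
  inner alpha (bracket Y (Phi (S p) m A B, RtoC 0)) (zonal (quad k), RtoC a)
  = (RtoC (2 * k * (alpha ^ 2 + 6)) * pairing (fst Y) (mu_dPhi p m A B)
     + RtoC a * pairing (fst Y) (dPhi m A B (S p)))%C.
Proof.
  intros HY. rewrite inner_bracket_xi by (simpl; sphere). simpl fst.
  rewrite pairing_poisson by sphere.
  rewrite (pairing_ext _ _ _ _ (strip_eq_refl _) (poisson_Phi_potential alpha a k p m A B)).
  now rewrite pairing_add_r, !pairing_scal_r by sphere.
Qed.

Lemma inner_bracket_xi_eta_r alpha a k p m A B Y : smooth_on_sphere (fst Y) ->
  inner alpha (bracket Y (zonal (quad k), RtoC a)) (Phi (S p) m A B, RtoC 0)
  = (RtoC (theta_ev alpha (S p) * - (2 * k)) * pairing (fst Y) (mu_dPhi p m A B))%C.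
Proof.
  intros HY. rewrite inner_eq by (simpl; sphere).
  unfold bracket; simpl fst; simpl snd.
  rewrite (pairing_ext _ _ _ _ (strip_eq_refl _) (Delta_theta_Phi alpha (S p) m A B)).
  rewrite pairing_scal_r, pairing_poisson by sphere.
  rewrite (pairing_ext _ _ _ _ (strip_eq_refl _) (poisson_quad_Phi k p m A B)).
  rewrite pairing_scal_r by sphere. fold (theta_ev alpha (S p)).
  rewrite (RtoC_mult (theta_ev _ _)). ring.
Qed.

Lemma inner_bracket_xi_eta_l alpha a k p m A B Y : smooth_on_sphere (fst Y) ->
  inner alpha (bracket (zonal (quad k), RtoC a) (Phi (S p) m A B, RtoC 0)) Y
  = (RtoC (- (2 * k)) *
      (RtoC (coef_up (S p) m * theta_ev alpha (S (S p))) * pairing (fst Y) (dPhi m A B (S (S p)))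
       + RtoC (coef_down (S p) m * theta_ev alpha p) * pairing (fst Y) (dPhi m A B p)))%C.
Proof.
  intros HY. unfold inner, bracket; simpl fst; simpl snd.
  rewrite (Omega_zonal k _ (smooth_Phi (S p) m A B)). rewrite pairing_sym.
  rewrite (pairing_ext _ _ _ _ (strip_eq_refl _)
    (Delta_theta_ext alpha _ _ (poisson_quad_Phi k p m A B))).
  rewrite (pairing_ext _ _ _ _ (strip_eq_refl _) (Delta_theta_scal alpha _ _ (smooth_mu_dPhi p m A B))).
  rewrite pairing_scal_r by sphere.
  rewrite (pairing_ext _ _ _ _ (strip_eq_refl _) (Delta_theta_mu_dPhi alpha p m A B)).
  rewrite pairing_add_r, !pairing_scal_r by sphere. ring.
Qed.

(** [eta] is a longitude derivative, hence orthogonal to zonal functions. *)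
Lemma inner_xi_eta alpha a k l m A B : (1 <= m)%nat ->
  inner alpha (zonal (quad k), RtoC a) (Phi l m A B, RtoC 0) = RtoC 0.
Proof.
  intros Hm. rewrite inner_eq by (simpl; sphere). simpl fst; simpl snd.
  rewrite (pairing_ext _ _ _ _ (strip_eq_refl _) (Delta_theta_Phi alpha l m A B)).
  rewrite pairing_scal_r by sphere.
  assert (Nm : RtoC (INR m) <> RtoC 0) by (intros e; injection e; apply not_0_INR; lia).
  set (P := Phi l m (- (Ci * A / RtoC (INR m)))%C (Ci * B / RtoC (INR m))%C).
  assert (E : strip_eq (Phi l m A B) (d_lambda P)).
  { intros x t _. unfold P. rewrite d_lambda_Phi. f_equal.
    - transitivity (- (Ci * Ci) * A)%C; [rewrite Ci_sqr, RtoC_m1; ring|field; exact Nm].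
    - transitivity (- (Ci * Ci) * B)%C; [rewrite Ci_sqr, RtoC_m1; ring|field; exact Nm]. }
  rewrite (pairing_ext _ _ _ _ (strip_eq_refl _) E), pairing_sym.
  rewrite pairing_d_lambda, pairing_sym by (unfold P; sphere).
  rewrite (pairing_ext (d_lambda (zonal (quad k))) (cscal (RtoC 0) height) _ P);
    [| |apply strip_eq_refl].
  2:{ intros x t _. rewrite d_lambda_zonal. unfold cscal. ring. }
  rewrite pairing_scal_l by (unfold P; sphere). ring.
Qed.

Lemma inner_eta_eta alpha l m A B : (1 <= m <= l)%nat ->
  inner alpha (Phi l m A B, RtoC 0) (Phi l m A B, RtoC 0)
  = (RtoC (theta_ev alpha l * (2 * PI * legendre_norm l m)) * (RtoC 2 * A * B))%C.
Proof.
  intros H. rewrite inner_eq by (simpl; sphere). simpl fst; simpl snd.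
  rewrite (pairing_ext _ _ _ _ (strip_eq_refl _) (Delta_theta_Phi alpha l m A B)).
  rewrite pairing_scal_r, pairing_Phi by (try assumption; sphere).
  fold (theta_ev alpha l). rewrite (RtoC_mult (theta_ev _ _)).
  replace (RtoC 2) with (RtoC 1 + RtoC 1)%C by (rewrite <- RtoC_plus; f_equal; ring).
  ring.
Qed.

Lemma coef_up_sq_norm l m : (1 <= m <= l)%nat ->
  coef_up l m ^ 2 * legendre_norm (S l) m
  = coef_a (INR l + 1) (INR m) * legendre_norm l m.
Proof.
  intros H. replace (coef_up l m ^ 2 * legendre_norm (S l) m)
    with (coef_up l m * (coef_up l m * legendre_norm (S l) m)) by ring.
  rewrite legendre_norm_step by exact H.
  unfold coef_up, coef_down, coef_a. rewrite S_INR.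
  pose proof (pos_INR l).
  field. nra.
Qed.

Lemma coef_down_sq_norm p m : (1 <= m <= p)%nat ->
  coef_down (S p) m ^ 2 * legendre_norm p m
  = coef_a (INR (S p)) (INR m) * legendre_norm (S p) m.
Proof.
  intros H. replace (coef_down (S p) m ^ 2 * legendre_norm p m)
    with (coef_down (S p) m * (coef_down (S p) m * legendre_norm p m)) by ring.
  rewrite <- legendre_norm_step by exact H.
  unfold coef_up, coef_down, coef_a. rewrite S_INR.
  pose proof (le_INR _ _ (proj1 H)). pose proof (le_INR _ _ (proj2 H)). simpl in H0.
  field. nra.
Qed.

Lemma RtoC_div_eq c d z : c <> 0 -> (RtoC c * z)%C = RtoC d -> z = RtoC (d / c).
Proof.
  intros Hc E. assert (Hc' : RtoC c <> RtoC 0) by (intros e; apply Hc; now injection e).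
  unfold Rdiv. rewrite RtoC_mult, RtoC_inv, <- E by exact Hc. field. exact Hc'.
Qed.

Lemma theta_ev_pos alpha l : (1 <= l)%nat -> 0 < theta_ev alpha l.
Proof.
  intros H. apply le_INR in H. simpl in H. unfold theta_ev. nra.
Qed.

(** The squared norms of the modes, for [eta] of norm one, weighted by the squared
    coefficients of Bonnet's recursion.  The last one holds also for [m = p + 1], where
    both sides vanish. *)
Lemma dPhi_norms alpha p m A B : (1 <= m <= S p)%nat ->
  inner alpha (Phi (S p) m A B, RtoC 0) (Phi (S p) m A B, RtoC 0) = RtoC 1 ->
  let n0 := INR m ^ 2 / theta_ev alpha (S p) in
  pairing (dPhi m A B (S p)) (dPhi m A B (S p)) = RtoC n0 /\
  (RtoC (coef_up (S p) m ^ 2) * pairing (dPhi m A B (S (S p))) (dPhi m A B (S (S p))))%C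
    = RtoC (coef_a (INR (S p) + 1) (INR m) * n0) /\
  (RtoC (coef_down (S p) m ^ 2) * pairing (dPhi m A B p) (dPhi m A B p))%C
    = RtoC (coef_a (INR (S p)) (INR m) * n0).
Proof.
  intros H N n0. rewrite inner_eta_eta in N by exact H.
  pose proof (theta_ev_pos alpha (S p) ltac:(lia)) as Ht.
  assert (Q : forall l, (m <= l)%nat ->
    pairing (dPhi m A B l) (dPhi m A B l)
    = (RtoC (2 * PI * legendre_norm l m) * (RtoC (INR m ^ 2) * (RtoC 2 * A * B)))%C).
  { intros l Hl. unfold dPhi. rewrite pairing_Phi by lia. unfold dcoef1, dcoef2.
    replace (RtoC (INR m ^ 2)) with (RtoC (INR m) * RtoC (INR m))%C
      by (rewrite <- RtoC_mult; f_equal; ring).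
    replace (RtoC 2) with (RtoC 1 + RtoC 1)%C by (rewrite <- RtoC_plus; f_equal; ring).
    pose proof Ci_sqr as E. rewrite RtoC_m1 in E. ring [E]. }
  assert (Q0 : (RtoC (2 * PI * legendre_norm (S p) m) * (RtoC (INR m ^ 2) * (RtoC 2 * A * B)))%C
               = RtoC n0).
  { apply RtoC_div_eq; [lra|]. rewrite RtoC_mult in N.
    transitivity (RtoC (INR m ^ 2) * (RtoC (theta_ev alpha (S p)) * RtoC (2 * PI * legendre_norm (S p) m) * (RtoC 2 * A * B)))%C; [ring|]. rewrite N. ring. }
  split; [|split].
  - rewrite Q by lia. exact Q0.
  - rewrite Q by lia. rewrite (RtoC_mult (coef_a _ _)), <- Q0.
    transitivity (RtoC (2 * PI) * RtoC (coef_up (S p) m ^ 2 * legendre_norm (S (S p)) m)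
       * (RtoC (INR m ^ 2) * (RtoC 2 * A * B)))%C; [rewrite !RtoC_mult; ring|].
    rewrite coef_up_sq_norm by exact H. rewrite !RtoC_mult. ring.
  - destruct (Nat.eq_dec m (S p)) as [->|Hne].
    + assert (E : pairing (dPhi (S p) A B p) (dPhi (S p) A B p) = RtoC 0).
      { unfold dPhi.
        rewrite (pairing_ext _ _ _ _ (Phi_below p _ _) (strip_eq_refl _)).
        rewrite pairing_scal_l by sphere. ring. }
      rewrite E. unfold coef_a, Rdiv. rewrite Rminus_diag, !Rmult_0_l. ring.
    + rewrite Q by lia. rewrite (RtoC_mult (coef_a _ _)), <- Q0.
      transitivity (RtoC (2 * PI) * RtoC (coef_down (S p) m ^ 2 * legendre_norm p m)
         * (RtoC (INR m ^ 2) * (RtoC 2 * A * B)))%C; [rewrite !RtoC_mult; ring|].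
      rewrite coef_down_sq_norm by lia. rewrite !RtoC_mult. ring.
Qed.

Lemma pairing_dPhi_orthogonal m A B i j : i <> j ->
  pairing (dPhi m A B i) (dPhi m A B j) = RtoC 0.
Proof. apply pairing_Phi_orthogonal. Qed.

(** [<R(xi, eta) eta, xi>] in terms of the eigenvalues [t0], [tp], [tm] of the modes
    [l], [l + 1], [l - 1].  Here [n0] is the squared norm of the mode [l], and [ap], [am]
    are the products of two coefficients of Bonnet's recursion, going up and down
    again, and conversely. *)
Definition curvature_value (alpha a k n0 ap am t0 tp tm : R) : R :=
  let s := alpha ^ 2 + 6 in
  k ^ 2 * n0 * (ap * (((t0 - s) ^ 2 - tp ^ 2) / tp + 2 * (t0 + s - tp))
                + am * (((t0 - s) ^ 2 - tm ^ 2) / tm + 2 * (t0 + s - tm)))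
  + a ^ 2 * n0 / (4 * t0).

Lemma smooth_nabla alpha nabla X Y : is_connection alpha nabla ->
  smooth_on_sphere (fst X) -> smooth_on_sphere (fst Y) ->
  smooth_on_sphere (fst (nabla X Y)).
Proof. intros H HX HY. exact (connection_closed _ _ H X Y HX HY). Qed.

Lemma RtoC_2_cancel z w : (RtoC 2 * z)%C = w -> z = (RtoC (/ 2) * w)%C.
Proof.
  intros <-. rewrite Cmult_assoc, <- RtoC_mult, Rinv_l by lra. ring.
Qed.

(** [nabla_xi W] is orthogonal to [xi]; this is [nabla_xi xi = 0] without dividing out
    the kernel of the inner product. *)
Lemma koszul_xi_xi alpha a k nabla W : is_connection alpha nabla ->
  smooth_on_sphere (fst W) ->
  inner alpha (nabla (zonal (quad k), RtoC a) W) (zonal (quad k), RtoC a) = RtoC 0.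
Proof.
  intros Hn HW.
  pose proof (connection_koszul _ _ Hn (zonal (quad k), RtoC a) W (zonal (quad k), RtoC a)
    (smooth_quad k) HW (smooth_quad k)) as E.
  rewrite (inner_bracket_antisym alpha W), inner_bracket_zonal_self, !inner_bracket_xi_xi
    in E by (simpl; sphere).
  rewrite (RtoC_2_cancel _ _ E). ring.
Qed.

(** [<nabla_eta U, xi>] depends only on the pairings of [U] with three modes. *)
Lemma koszul_eta_xi alpha a k p m A B nabla U : is_connection alpha nabla ->
  smooth_on_sphere (fst U) ->
  inner alpha (nabla (Phi (S p) m A B, RtoC 0) U) (zonal (quad k), RtoC a)
  = (RtoC (/ 2) *
      (RtoC (2 * k * (theta_ev alpha (S p) - (alpha ^ 2 + 6) - theta_ev alpha (S (S p))))
         * (RtoC (coef_up (S p) m) * pairing (fst U) (dPhi m A B (S (S p))))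
       + RtoC (2 * k * (theta_ev alpha (S p) - (alpha ^ 2 + 6) - theta_ev alpha p))
         * (RtoC (coef_down (S p) m) * pairing (fst U) (dPhi m A B p))
       - RtoC a * pairing (fst U) (dPhi m A B (S p))))%C.
Proof.
  intros Hn HU.
  pose proof (connection_koszul _ _ Hn (Phi (S p) m A B, RtoC 0) U (zonal (quad k), RtoC a)
    (smooth_Phi _ _ _ _) HU (smooth_quad k)) as E.
  rewrite (inner_bracket_antisym alpha (Phi (S p) m A B, RtoC 0)),
    inner_bracket_eta_xi, inner_bracket_xi_eta_r, inner_bracket_xi_eta_l,
    pairing_mu_dPhi in E by (simpl; sphere).
  rewrite (RtoC_2_cancel _ _ E). f_equal.
  rewrite !RtoC_mult, !RtoC_minus, !RtoC_plus, !RtoC_opp, !RtoC_mult. ring.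
Qed.

(** The Koszul formula for [<nabla_V Y, X>], with its brackets turned to [[V, Y]],
    [[X, Y]] and [[V, X]]. *)
Lemma koszul_turned alpha nabla X Y V : is_connection alpha nabla ->
  smooth_on_sphere (fst X) -> smooth_on_sphere (fst Y) -> smooth_on_sphere (fst V) ->
  inner alpha (nabla V Y) X
  = (RtoC (/ 2) * (inner alpha (bracket V Y) X + inner alpha (bracket X Y) V
                   - inner alpha (bracket V X) Y))%C.
Proof.
  intros Hn HX HY HV. apply RtoC_2_cancel.
  rewrite (connection_koszul _ _ Hn V Y X HV HY HX).
  pose proof (inner_bracket_antisym alpha Y X V HY HX HV) as E1.
  pose proof (inner_bracket_antisym alpha X V Y HX HV HY) as E2.
  ring [E1 E2].
Qed.

Lemma koszul_nabla_V_eta alpha a k p m A B nabla V : is_connection alpha nabla ->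
  smooth_on_sphere (fst V) ->
  inner alpha (nabla V (Phi (S p) m A B, RtoC 0)) (zonal (quad k), RtoC a)
  = (RtoC (/ 2) *
      (RtoC (2 * k * (theta_ev alpha (S p) + (alpha ^ 2 + 6) - theta_ev alpha (S (S p))))
         * (RtoC (coef_up (S p) m) * pairing (fst V) (dPhi m A B (S (S p))))
       + RtoC (2 * k * (theta_ev alpha (S p) + (alpha ^ 2 + 6) - theta_ev alpha p))
         * (RtoC (coef_down (S p) m) * pairing (fst V) (dPhi m A B p))
       + RtoC a * pairing (fst V) (dPhi m A B (S p))))%C.
Proof.
  intros Hn HV.
  rewrite (koszul_turned alpha nabla (zonal (quad k), RtoC a) (Phi (S p) m A B, RtoC 0) V
             Hn (smooth_quad k) (smooth_Phi _ _ _ _) HV).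
  rewrite inner_bracket_eta_xi, inner_bracket_xi_eta_r, inner_bracket_xi_eta_l,
    pairing_mu_dPhi by exact HV.
  f_equal.
  rewrite !RtoC_mult, !RtoC_minus, !RtoC_plus, !RtoC_opp, !RtoC_mult. ring.
Qed.

(** The pairing of [nabla_xi eta] with a mode. *)
Lemma koszul_xi_eta alpha a k p m A B nabla j : is_connection alpha nabla ->
  (RtoC (theta_ev alpha j)
   * pairing (fst (nabla (zonal (quad k), RtoC a) (Phi (S p) m A B, RtoC 0))) (dPhi m A B j))%C
  = (RtoC (/ 2) *
      (RtoC (2 * k * ((alpha ^ 2 + 6) - theta_ev alpha (S p) - theta_ev alpha (S (S p))))
         * (RtoC (coef_up (S p) m) * pairing (dPhi m A B j) (dPhi m A B (S (S p))))
       + RtoC (2 * k * ((alpha ^ 2 + 6) - theta_ev alpha (S p) - theta_ev alpha p))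
         * (RtoC (coef_down (S p) m) * pairing (dPhi m A B j) (dPhi m A B p))
       + RtoC a * pairing (dPhi m A B j) (dPhi m A B (S p))))%C.
Proof.
  intros Hn.
  pose proof (connection_koszul _ _ Hn (zonal (quad k), RtoC a) (Phi (S p) m A B, RtoC 0)
    (dPhi m A B j, RtoC 0) (smooth_quad k) (smooth_Phi _ _ _ _) (smooth_dPhi m A B j)) as E.
  assert (HU : smooth_on_sphere (fst (nabla (zonal (quad k), RtoC a)
                                            (Phi (S p) m A B, RtoC 0))))
    by (apply (smooth_nabla alpha); simpl; sphere).
  rewrite (inner_bracket_antisym alpha (Phi (S p) m A B, RtoC 0)),
    inner_bracket_eta_xi, inner_bracket_xi_eta_r, inner_bracket_xi_eta_l,
    pairing_mu_dPhi in E by (simpl; sphere).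
  rewrite inner_eq in E by (simpl; sphere). simpl fst in E; simpl snd in E.
  unfold dPhi at 1 in E.
  rewrite (pairing_ext _ _ _ _ (strip_eq_refl _) (Delta_theta_Phi alpha j m _ _)) in E.
  rewrite pairing_scal_r in E by (try exact HU; apply smooth_Phi).
  fold (dPhi m A B j) (theta_ev alpha j) in E. apply RtoC_2_cancel in E.
  rewrite Cmult_0_r, Cplus_0_r in E. rewrite E. f_equal.
  rewrite !RtoC_mult, !RtoC_minus, !RtoC_plus, !RtoC_opp, !RtoC_mult. ring.
Qed.

Lemma inner_curvature alpha a k p m A B nabla : is_connection alpha nabla ->
  (1 <= m <= S p)%nat ->
  inner alpha (Phi (S p) m A B, RtoC 0) (Phi (S p) m A B, RtoC 0) = RtoC 1 ->
  inner alpha (curvature nabla (zonal (quad k), RtoC a) (Phi (S p) m A B, RtoC 0)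
                 (Phi (S p) m A B, RtoC 0)) (zonal (quad k), RtoC a)
  = RtoC (curvature_value alpha a k (INR m ^ 2 / theta_ev alpha (S p))
      (coef_a (INR (S p) + 1) (INR m)) (coef_a (INR (S p)) (INR m))
      (theta_ev alpha (S p)) (theta_ev alpha (S (S p))) (theta_ev alpha p)).
Proof.
  intros Hn Hm N.
  destruct (dPhi_norms alpha p m A B Hm N) as (N0 & Np & Nm). cbv zeta in N0, Np, Nm.
  set (n0 := INR m ^ 2 / theta_ev alpha (S p)) in *.
  set (ap := coef_a (INR (S p) + 1) (INR m)) in *.
  set (am := coef_a (INR (S p)) (INR m)) in *.
  set (xi := (zonal (quad k), RtoC a)). set (eta := (Phi (S p) m A B, RtoC 0)).
  assert (Sxi : smooth_on_sphere (fst xi)) by (simpl; sphere).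
  assert (Seta : smooth_on_sphere (fst eta)) by (simpl; sphere).
  assert (SU := smooth_nabla alpha nabla xi eta Hn Sxi Seta).
  assert (SW := smooth_nabla alpha nabla eta eta Hn Seta Seta).
  assert (SV : smooth_on_sphere (fst (bracket xi eta))) by (simpl; sphere).
  unfold curvature.
  rewrite !inner_gsub by (try exact Sxi; try apply smooth_gsub; now apply (smooth_nabla alpha)).
  assert (E1 := koszul_xi_xi alpha a k nabla _ Hn SW).
  assert (E2 := koszul_eta_xi alpha a k p m A B nabla _ Hn SU).
  assert (E3 := koszul_nabla_V_eta alpha a k p m A B nabla _ Hn SV).
  fold xi eta in E1, E2, E3. rewrite E1, E2, E3. clear E1 E2 E3.
  (* the components of [nabla_xi eta] *)
  assert (Ep := koszul_xi_eta alpha a k p m A B nabla (S (S p)) Hn).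
  assert (Ez := koszul_xi_eta alpha a k p m A B nabla (S p) Hn).
  assert (Em := koszul_xi_eta alpha a k p m A B nabla p Hn).
  fold xi eta in Ep, Ez, Em.
  rewrite N0 in Ez.
  rewrite (pairing_dPhi_orthogonal m A B (S (S p)) p), (pairing_dPhi_orthogonal m A B (S (S p)) (S p))
    in Ep by lia.
  rewrite (pairing_dPhi_orthogonal m A B (S p) p), (pairing_dPhi_orthogonal m A B (S p) (S (S p)))
    in Ez by lia.
  rewrite (pairing_dPhi_orthogonal m A B p (S p)), (pairing_dPhi_orthogonal m A B p (S (S p)))
    in Em by lia.
  set (U := nabla xi eta) in *.
  set (t0 := theta_ev alpha (S p)) in *. set (tp := theta_ev alpha (S (S p))) in *.
  set (tm := theta_ev alpha p) in *. set (s := alpha ^ 2 + 6) in *.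
  assert (H0 : 0 < t0) by (apply theta_ev_pos; lia).
  assert (Hp : 0 < tp) by (apply theta_ev_pos; lia).
  set (up := coef_up (S p) m) in *. set (dn := coef_down (S p) m) in *.
  assert (Up : (RtoC up * pairing (fst U) (dPhi m A B (S (S p))))%C
               = RtoC (k * (s - t0 - tp) * (ap * n0) / tp)).
  { apply RtoC_div_eq; [lra|].
    rewrite (RtoC_mult (k * _)), <- Np.
    transitivity (RtoC up * (RtoC tp * pairing (fst U) (dPhi m A B (S (S p)))))%C; [ring|].
    rewrite Ep.
    replace (RtoC (2 * k * (s - t0 - tp))) with (RtoC 2 * RtoC (k * (s - t0 - tp)))%C
      by (rewrite <- RtoC_mult; f_equal; ring).
    replace (RtoC (up ^ 2)) with (RtoC up * RtoC up)%C
      by (rewrite <- RtoC_mult; f_equal; ring).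
    assert (E2 : (RtoC (/ 2) * RtoC 2)%C = RtoC 1)
      by (rewrite <- RtoC_mult; f_equal; field).
    ring [E2]. }
  assert (Uz : pairing (fst U) (dPhi m A B (S p)) = RtoC (/ 2 * (a * n0) / t0)).
  { apply RtoC_div_eq; [lra|]. rewrite Ez, !RtoC_mult. ring. }
  (* for [m = p + 1] the eigenvalue [tm] may be zero, but the mode vanishes *)
  assert (Um : (RtoC dn * pairing (fst U) (dPhi m A B p))%C
               = RtoC (k * (s - t0 - tm) * (am * n0) / tm)).
  { destruct (Nat.eq_dec m (S p)) as [e|Hne].
    - assert (Z : pairing (fst U) (dPhi m A B p) = RtoC 0).
      { unfold dPhi. rewrite e.
        rewrite (pairing_ext _ _ _ _ (strip_eq_refl _) (Phi_below p _ _)).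
        rewrite pairing_scal_r by (try exact SU; sphere). ring. }
      rewrite Z. assert (Za : am = 0)
        by (unfold am, coef_a; rewrite e; unfold Rdiv; rewrite Rminus_diag; ring).
      rewrite Za. unfold Rdiv. rewrite Rmult_0_l, Rmult_0_r, Rmult_0_l. ring.
    - assert (Hm' : 0 < tm) by (apply theta_ev_pos; lia).
      apply RtoC_div_eq; [lra|].
      rewrite (RtoC_mult (k * _)), <- Nm.
      transitivity (RtoC dn * (RtoC tm * pairing (fst U) (dPhi m A B p)))%C; [ring|].
      rewrite Em.
      replace (RtoC (2 * k * (s - t0 - tm))) with (RtoC 2 * RtoC (k * (s - t0 - tm)))%C
        by (rewrite <- RtoC_mult; f_equal; ring).
      replace (RtoC (dn ^ 2)) with (RtoC dn * RtoC dn)%C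
        by (rewrite <- RtoC_mult; f_equal; ring).
      assert (E2 : (RtoC (/ 2) * RtoC 2)%C = RtoC 1)
        by (rewrite <- RtoC_mult; f_equal; field).
      ring [E2]. }
  rewrite Up, Uz, Um.
  (* the components of [[xi, eta]] *)
  assert (V : forall j, pairing (fst (bracket xi eta)) (dPhi m A B j)
     = (RtoC (- (2 * k)) * (RtoC up * pairing (dPhi m A B j) (dPhi m A B (S (S p)))
          + RtoC dn * pairing (dPhi m A B j) (dPhi m A B p)))%C).
  { intros j. rewrite pairing_sym. unfold xi, eta, bracket. simpl fst.
    rewrite (pairing_ext _ _ _ _ (strip_eq_refl _) (poisson_quad_Phi k p m A B)).
    rewrite pairing_scal_r, pairing_mu_dPhi by sphere. reflexivity. }
  assert (Vp : (RtoC up * pairing (fst (bracket xi eta)) (dPhi m A B (S (S p))))%C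
               = RtoC (- (2 * k) * (ap * n0))).
  { rewrite V, (pairing_dPhi_orthogonal m A B (S (S p)) p) by lia.
    rewrite (RtoC_mult (- _)), <- Np.
    replace (RtoC (up ^ 2)) with (RtoC up * RtoC up)%C
      by (rewrite <- RtoC_mult; f_equal; ring). ring. }
  assert (Vm : (RtoC dn * pairing (fst (bracket xi eta)) (dPhi m A B p))%C
               = RtoC (- (2 * k) * (am * n0))).
  { rewrite V, (pairing_dPhi_orthogonal m A B p (S (S p))) by lia.
    rewrite (RtoC_mult (- _)), <- Nm.
    replace (RtoC (dn ^ 2)) with (RtoC dn * RtoC dn)%C
      by (rewrite <- RtoC_mult; f_equal; ring). ring. }
  assert (Vz : pairing (fst (bracket xi eta)) (dPhi m A B (S p)) = RtoC 0).
  { rewrite V, (pairing_dPhi_orthogonal m A B (S p) p),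
      (pairing_dPhi_orthogonal m A B (S p) (S (S p))) by lia. ring. }
  rewrite Vp, Vm, Vz.
  rewrite <- ?RtoC_mult, <- ?RtoC_plus, <- ?RtoC_minus, <- ?RtoC_mult, <- ?RtoC_plus,
    <- ?RtoC_minus, <- ?RtoC_mult, <- ?RtoC_plus, <- ?RtoC_minus.
  f_equal. unfold curvature_value. fold s.
  destruct (Nat.eq_dec m (S p)) as [e|Hne].
  - assert (Za : am = 0)
      by (unfold am, coef_a; rewrite e; unfold Rdiv; rewrite Rminus_diag; ring).
    rewrite Za. unfold Rdiv. rewrite ?Rmult_0_l, ?Rmult_0_r, ?Rmult_0_l. field. lra.
  - assert (Hm' : 0 < tm) by (apply theta_ev_pos; lia). field. lra.
Qed.

(** * The closed formula and its limit *)

(** The coefficient of [mu^2] in the first direction. *)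
Definition xi_coef : R := 1 / 2 * sqrt (15 / (8 * PI)).

Lemma xi_coef_sqr : xi_coef ^ 2 = 15 / (32 * PI).
Proof.
  unfold xi_coef. pose proof PI_RGT_0. rewrite Rpow_mult_distr, pow2_sqrt.
  - field. lra.
  - left. apply Rdiv_lt_0_compat; lra.
Qed.

Lemma xi_hat_eq a : xi_hat a = (zonal (quad xi_coef), RtoC a).
Proof. reflexivity. Qed.

Lemma abs_nat_opp m : Z.abs_nat (- Z.of_nat m) = m.
Proof. lia. Qed.

Lemma eta_hat_eq l m p q :
  eta_hat l m p q
  = (Phi l m (p * RtoC (Y_const l (Z.of_nat m))) (q * RtoC (Y_const l (- Z.of_nat m))),
     RtoC 0).
Proof.
  unfold eta_hat. f_equal.
  apply functional_extensionality; intros x. apply functional_extensionality; intros t.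
  unfold Ylm, Phi, sep, wave. rewrite abs_nat_opp, Zabs2Nat.id.
  rewrite opp_IZR, <- INR_IZR_INZ, !RtoC_mult.
  replace (- INR m * x) with (- (INR m * x)) by ring. ring.
Qed.

Lemma Y_const_mul l m : (1 <= m <= l)%nat ->
  2 * (2 * PI * legendre_norm l m) * (Y_const l (Z.of_nat m) * Y_const l (- Z.of_nat m))
  = 2 * (-1) ^ m.
Proof.
  intros [Hm Hl]. unfold Y_const, condon_shortley, legendre_norm.
  rewrite abs_nat_opp, Zabs2Nat.id.
  replace (0 <=? Z.of_nat m)%Z with true by (symmetry; apply Z.leb_le; lia).
  replace (0 <=? - Z.of_nat m)%Z with false by (symmetry; apply Z.leb_gt; lia).
  set (r := (2 * INR l + 1) / (4 * PI) * (INR (fact (l - m)) / INR (fact (l + m)))).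
  pose proof PI_RGT_0. pose proof (INR_fact_lt_0 (l - m)). pose proof (INR_fact_lt_0 (l + m)).
  pose proof (pos_INR l).
  assert (Hr : 0 <= r).
  { left. apply Rmult_lt_0_compat; apply Rdiv_lt_0_compat; lra. }
  replace ((-1) ^ m * sqrt r * (1 * sqrt r)) with ((-1) ^ m * (sqrt r * sqrt r)) by ring.
  rewrite sqrt_sqrt by exact Hr. unfold r. field. lra.
Qed.

Lemma inner_eta_hat alpha l m p q : (1 <= m <= l)%nat ->
  inner alpha (eta_hat l m p q) (eta_hat l m p q)
  = (RtoC (2 * (-1) ^ m * (alpha ^ 2 + INR l * (INR l + 1))) * p * q)%C.
Proof.
  intros H. rewrite eta_hat_eq, inner_eta_eta by exact H.
  rewrite <- (Y_const_mul l m H). fold (theta_ev alpha l). rewrite !RtoC_mult. ring.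
Qed.

(** In the case [m = p + 1] the coefficient [am] is zero and the possibly vanishing
    denominator [tm] disappears from both sides. *)
Lemma curvature_value_Theta alpha a p m : (1 <= m <= S p)%nat ->
  curvature_value alpha a xi_coef (INR m ^ 2 / theta_ev alpha (S p))
    (coef_a (INR (S p) + 1) (INR m)) (coef_a (INR (S p)) (INR m))
    (theta_ev alpha (S p)) (theta_ev alpha (S (S p))) (theta_ev alpha p)
  = 15 * INR m ^ 2 / (32 * PI) * Theta alpha (S p) m
    + 1 / 4 * (a ^ 2 * INR m ^ 2 / (alpha ^ 2 + INR (S p) * (INR (S p) + 1)) ^ 2).
Proof.
  intros Hm. unfold curvature_value, Theta. cbv zeta. rewrite xi_coef_sqr.
  unfold coef_b, coef_c, coef_x.
  set (am := coef_a (INR (S p)) (INR m)). set (ap := coef_a (INR (S p) + 1) (INR m)).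
  assert (Z : m = S p -> am = 0).
  { intros ->. unfold am, coef_a, Rdiv. rewrite Rminus_diag. ring. }
  pose proof (theta_ev_pos alpha (S p) ltac:(lia)) as H0.
  pose proof (theta_ev_pos alpha (S (S p)) ltac:(lia)) as H1.
  assert (H2 : m <> S p -> 0 < theta_ev alpha p) by (intros; apply theta_ev_pos; lia).
  unfold theta_ev in *. rewrite !S_INR in *.
  set (L := INR p) in *. set (M := INR m) in *. pose proof PI_RGT_0 as HP.
  replace (alpha ^ 2 + (L + 1) * (L + 1 - 1)) with (alpha ^ 2 + L * (L + 1)) by ring.
  replace (alpha ^ 2 + (L + 1 - 1) * (L + 1 - 1 + 1)) with (alpha ^ 2 + L * (L + 1)) by ring.
  replace (alpha ^ 2 + (L + 1 + 1) * (L + 1 + 1 - 1))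
    with (alpha ^ 2 + (L + 1) * (L + 1 + 1)) by ring.
  set (t0 := alpha ^ 2 + (L + 1) * (L + 1 + 1)) in *.
  set (tp := alpha ^ 2 + (L + 1 + 1) * (L + 1 + 1 + 1)) in *.
  set (tm := alpha ^ 2 + L * (L + 1)) in *.
  destruct (Nat.eq_dec m (S p)) as [e|Hne].
  - rewrite (Z e). unfold Rdiv. rewrite ?Rmult_0_l, ?Rmult_0_r, ?Rmult_0_l. field. lra.
  - specialize (H2 Hne). field. lra.
Qed.

Lemma denominator_pos alpha a : 0 < 3 / 8 * alpha ^ 2 + 1 + a ^ 2.
Proof. nra. Qed.

Lemma inner_xi_hat alpha a :
  inner alpha (xi_hat a) (xi_hat a) = RtoC (3 / 8 * alpha ^ 2 + 1 + a ^ 2).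
Proof.
  rewrite xi_hat_eq, inner_xi_xi, xi_coef_sqr. f_equal. pose proof PI_RGT_0. field. lra.
Qed.

Lemma sectional_curvature_formula alpha a nabla l m p q : is_connection alpha nabla ->
  (1 <= m <= l)%nat ->
  inner alpha (eta_hat l m p q) (eta_hat l m p q) = RtoC 1 ->
  sectional_curvature alpha nabla (xi_hat a) (eta_hat l m p q)
  = RtoC (1 / (3 / 8 * alpha ^ 2 + 1 + a ^ 2)
          * (15 * INR m ^ 2 / (32 * PI) * Theta alpha l m
             + 1 / 4 * (a ^ 2 * INR m ^ 2 / (alpha ^ 2 + INR l * (INR l + 1)) ^ 2))).
Proof.
  intros Hn Hm N. destruct l as [|l]; [lia|].
  unfold sectional_curvature. rewrite N, inner_xi_hat.
  rewrite eta_hat_eq in *. rewrite xi_hat_eq.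
  rewrite (inner_curvature alpha a xi_coef l m _ _ nabla Hn Hm N).
  rewrite inner_xi_eta by lia. rewrite curvature_value_Theta by exact Hm.
  pose proof (denominator_pos alpha a) as Hd.
  replace (RtoC (3 / 8 * alpha ^ 2 + 1 + a ^ 2) * RtoC 1 - RtoC 0 * RtoC 0)%C
    with (RtoC (3 / 8 * alpha ^ 2 + 1 + a ^ 2)) by ring.
  rewrite <- RtoC_div by lra. f_equal. unfold Rdiv. ring.
Qed.

(** The curvature for [m0 = l0], as a function of [x = 1 / l0]; it is continuous at
    [x = 0]. *)
Definition diagonal_value (alpha a x : R) : R :=
  let s := alpha ^ 2 + 6 in
  let t0 := alpha ^ 2 * x ^ 2 + 1 + x in
  let tp := alpha ^ 2 * x ^ 2 + (1 + x) * (1 + 2 * x) in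
  1 / (3 / 8 * alpha ^ 2 + 1 + a ^ 2) *
  (15 / (32 * PI)
     * ((s ^ 2 * x ^ 3 - 8 * t0 * (1 + x) - 12 * (1 + x) ^ 2 * x + 4 * s * (1 + x) * x ^ 2)
        / ((2 + 3 * x) * t0 * tp))
   + 1 / 4 * (a ^ 2 * x ^ 2 / t0 ^ 2)).

Lemma diagonal_value_eq alpha a l : (1 <= l)%nat ->
  1 / (3 / 8 * alpha ^ 2 + 1 + a ^ 2)
    * (15 * INR l ^ 2 / (32 * PI) * Theta alpha l l
       + 1 / 4 * (a ^ 2 * INR l ^ 2 / (alpha ^ 2 + INR l * (INR l + 1)) ^ 2))
  = diagonal_value alpha a (/ INR l).
Proof.
  intros Hl. destruct l as [|p]; [lia|].
  rewrite <- curvature_value_Theta by lia.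
  unfold diagonal_value, curvature_value. cbv zeta. rewrite xi_coef_sqr.
  pose proof (denominator_pos alpha a) as Hd. pose proof PI_RGT_0 as HP.
  pose proof (theta_ev_pos alpha (S p) ltac:(lia)) as H0.
  pose proof (theta_ev_pos alpha (S (S p)) ltac:(lia)) as H1.
  unfold theta_ev in *. rewrite (S_INR (S p)) in *.
  pose proof (lt_0_INR (S p) ltac:(lia)) as HL. set (L := INR (S p)) in *.
  assert (Z : coef_a L L = 0) by (unfold coef_a, Rdiv; rewrite Rminus_diag; ring).
  rewrite Z, Rmult_0_l, Rplus_0_r. unfold coef_a.
  replace (((L + 1) ^ 2 - L ^ 2) / (4 * (L + 1) ^ 2 - 1)) with (1 / (2 * L + 3))
    by (field; nra).
  field. repeat split; nra.
Qed.

Lemma RtoC_continuous x : filterlim RtoC (locally x) (locally (RtoC x)).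
Proof.
  intros P [eps H]. exists eps. intros y Hy. apply H. split; [exact Hy|].
  apply ball_center.
Qed.

Lemma diagonal_value_limit alpha a :
  filterlim (fun l : nat => diagonal_value alpha a (/ INR l)) eventually
    (locally (-1 / (3 / 8 * alpha ^ 2 + 1 + a ^ 2) * (15 / (8 * PI)))).
Proof.
  pose proof (denominator_pos alpha a) as Hd. pose proof PI_RGT_0 as HP.
  replace (-1 / (3 / 8 * alpha ^ 2 + 1 + a ^ 2) * (15 / (8 * PI)))
    with (diagonal_value alpha a 0) by (unfold diagonal_value; field; nra).
  apply (filterlim_comp _ _ _ (fun l : nat => / INR l) (diagonal_value alpha a) _ (locally 0)).
  - assert (E : is_lim_seq (fun n => / INR n) 0).
    { apply (is_lim_seq_inv INR p_infty); [apply is_lim_seq_INR|discriminate]. }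
    exact E.
  - apply (ex_derive_continuous (V := R_NormedModule)).
    unfold diagonal_value. auto_derive. repeat split; nra.
Qed.

Theorem theorem4p3 (alpha a : R) (nabla : ghat -> ghat -> ghat)
    (Hnabla : is_connection alpha nabla) :
  (forall (l0 m0 : nat) (p q : C), (1 <= m0 <= l0)%nat ->
     (inner alpha (eta_hat l0 m0 p q) (eta_hat l0 m0 p q) = RtoC 1 <->
      (RtoC (2 * (-1) ^ m0 * (alpha ^ 2 + INR l0 * (INR l0 + 1))) * p * q)%C
      = RtoC 1))
  /\
  (forall (l0 m0 : nat) (p q : C), (1 <= m0 <= l0)%nat ->
     inner alpha (eta_hat l0 m0 p q) (eta_hat l0 m0 p q) = RtoC 1 ->
     sectional_curvature alpha nabla (xi_hat a) (eta_hat l0 m0 p q)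
     = RtoC (1 / (3 / 8 * alpha ^ 2 + 1 + a ^ 2)
             * (15 * INR m0 ^ 2 / (32 * PI) * Theta alpha l0 m0
                + 1 / 4 * (a ^ 2 * INR m0 ^ 2
                           / (alpha ^ 2 + INR l0 * (INR l0 + 1)) ^ 2))))
  /\
  (forall p q : nat -> C,
     (forall l0 : nat, (1 <= l0)%nat ->
        inner alpha (eta_hat l0 l0 (p l0) (q l0)) (eta_hat l0 l0 (p l0) (q l0))
        = RtoC 1) ->
     filterlim
       (fun l0 : nat =>
          sectional_curvature alpha nabla (xi_hat a)
            (eta_hat l0 l0 (p l0) (q l0)))
       eventually
       (locally (RtoC (-1 / (3 / 8 * alpha ^ 2 + 1 + a ^ 2) * (15 / (8 * PI)))))).
Proof.
  split; [|split].
  - intros l m p q H. rewrite inner_eta_hat by exact H. tauto.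
  - intros l m p q H N. now apply sectional_curvature_formula.
  - intros p q N.
    apply (filterlim_ext_loc (fun l : nat => RtoC (diagonal_value alpha a (/ INR l)))).
    + exists 1%nat. intros l Hl.
      rewrite (sectional_curvature_formula alpha a nabla l l) by auto.
      now rewrite diagonal_value_eq.
    + exact (filterlim_comp _ _ _ _ _ _ _ _ (diagonal_value_limit alpha a) (RtoC_continuous _)).
Qed.
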